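(* Assume that $\mathcal Z=\mathcal V$. Let $\{\mathrm{tol}_n\}_{n\in\mathbb N}\subset(0,\infty)$ be any sequence converging to zero. For each $n$ let the adaptive algorithm be run with tolerance $\mathrm{tol}_n$ and an initial step size $\tau_1^n$ satisfying $\frac{\mathrm{tol}_n}{2\bar c}\le\tau_1^n$, and let $\hat t_n,\hat z_n,S_n$ denote the resulting (constantly extended) affine interpolants and the resulting maximal curve parameter. Then there is a subsequence, denoted by the same symbol, such that $$S_n\to S\ \text{ in }\mathbb R,\qquad \hat t_n\rightharpoonup^*\hat t\ \text{ in }W^{1,\infty}(0,S;\mathbb R),\qquad \hat z_n\rightharpoonup^*\hat z\ \text{ in }W^{1,\infty}(0,S;\mathcal V),$$ and every limit $(\hat t,\hat z)$ obtained in this sense (i.e. along any subsequence for which these three convergences hold, with the corresponding $S$) is a $\mathbb V$-parametrized BV solution of the rate-independent system $0\in\partial\mathcal R(\dot z(t))+D_z\mathcal I(t,z(t))$, $z(0)=z_0$.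
   Context: **Data.** $T>0$. $\mathcal Z,\mathcal V$ are real Hilbert spaces, $\mathcal X,\mathcal W$ real Banach spaces with continuous embeddings $\mathcal Z\hookrightarrow\mathcal W\hookrightarrow\mathcal V\hookrightarrow\mathcal X$, the first one compact, and $\mathcal Z$ dense in $\mathcal V$ (so $\mathcal V^*\subset\mathcal Z^*$). $\mathbb V\in L(\mathcal V,\mathcal V^* )$ is self-adjoint with $\langle\mathbb Vv,v\rangle\ge\gamma\|v\|_{\mathcal V}^2$, $\gamma>0$; $\|v\|_{\mathbb V}:=\langle\mathbb Vv,v\rangle^{1/2}$ on $\mathcal V$ and $\|\eta\|_{\mathbb V^{-1}}:=\langle\eta,\mathbb V^{-1}\eta\rangle^{1/2}$ on $\mathcal V^*$. Dissipation: $\mathcal R:\mathcal X\to[0,\infty)$ is convex, lower semicontinuous, $\mathcal R(\lambda v)=\lambda\mathcal R(v)$ for $\lambda>0$, and $\rho\|v\|_{\mathcal X}\le\mathcal R(v)\le R\|v\|_{\mathcal V}$ for $v\in\mathcal V$ with constants $\rho,R>0$. It is regarded as a functional on $\mathcal Z$, so $\partial\mathcal R(0)=\{\xi\in\mathcal Z^*:\langle\xi,v\rangle\le\mathcal R(v)\ \forall v\in\mathcal Z\}$. Energy: $\mathcal I(t,z)=\frac12\langle Az,z\rangle_{\mathcal Z^*,\mathcal Z}+\mathcal F(z)-f(t,z)$ on $[0,T]\times\mathcal Z$, where $A\in L(\mathcal Z,\mathcal Z^* )$ is self-adjoint with $\langle Az,z\rangle\ge\alpha\|z\|_{\mathcal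 Z}^2$, $\alpha>0$; $\mathcal F\in C^2(\mathcal Z;\mathbb R)$, $\mathcal F\ge0$, $D_z\mathcal F\in C^1(\mathcal Z;\mathcal V^* )$, $\|D_z^2\mathcal F(z)v\|_{\mathcal V^*}\le C(1+\|z\|_{\mathcal Z}^q)\|v\|_{\mathcal Z}$ for constants $C>0,q\ge1$, and $z_k\rightharpoonup z$ in $\mathcal Z$ implies $D_z\mathcal F(z_k)\rightharpoonup D_z\mathcal F(z)$ in $\mathcal Z^*$; $f\in C^1([0,T]\times\mathcal Z;\mathbb R)$, $f(t,z)\le c(\|z\|_{\mathcal Z}+1)$, $|\partial_tf(t,z)|\le\mu(\|z\|_{\mathcal Z}+1)$, $|\langle D_zf(t_1,z_1)-D_zf(t_2,z_2),v\rangle_{\mathcal V^*,\mathcal V}|\le\nu(|t_1-t_2|+\|z_1-z_2\|_{\mathcal W})\|v\|_{\mathcal V}$ (constants $c,\mu,\nu>0$), $f(t,\cdot)$ is weakly continuous for each $t$, and $t_k\to t$, $z_k\rightharpoonup z$ in $\mathcal Z$ imply $\partial_tf(t_k,z_k)\to\partial_tf(t,z)$. Initial state: $z_0\in\mathcal Z$ with $D_z\mathcal I(0,z_0)\in\mathcal V^*$. Convention: $\mathcal I(t,\cdot):=\mathcal I(T,\cdot)$ for $t>T$. **Distance.** For $\eta\in\mathcal Z^*$: $\overline{\mathrm{dist}}_{\mathcal V^*}\{\eta,\partial\mathcal R(0)\}:=\inf\{\|w\|_{\mathbb V^{-1}}:w\in\mathcal V^*\cap(\partial\mathcal R(0)-\eta)\}\in[0,\infty]$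 ($\inf\emptyset=\infty$). **Scheme.** Set $t_0=s_0=0$. While $t_{k-1}<T$ ($k=1,2,\dots$), for a step size $\tau_k>0$ choose any $z_k\in\mathcal Z$ with $$0\in\partial(\mathcal R+I_{\tau_k})(z_k-z_{k-1})+D_z\mathcal I(t_{k-1},z_k),\qquad \mathcal I(t_{k-1},z_k)+\mathcal R(z_k-z_{k-1})\le\mathcal I(t_{k-1},z_{k-1}),$$ where $I_\tau:\mathcal Z\to[0,\infty]$ is the indicator functional of $\{\|z\|_{\mathbb V}\le\tau\}$ and $\partial$ is the convex subdifferential in $\mathcal Z^*$; set $t_k=t_{k-1}+\tau_k-\|z_k-z_{k-1}\|_{\mathbb V}$, $s_k=\sum_{i=1}^k\tau_i$. For $s\in[s_{k-1},s_k)$: $\hat z(s)=z_{k-1}+\frac{s-s_{k-1}}{\tau_k}(z_k-z_{k-1})$, $\hat t(s)=t_{k-1}+\frac{s-s_{k-1}}{\tau_k}(t_k-t_{k-1})$, $\bar z(s)=z_k$, $\underline t(s)=t_{k-1}$. Any sequence generated in this way with arbitrary positive step sizes is called a run. Put $r(s)=\langle D_z\mathcal I(\hat t(s),\hat z(s))-D_z\mathcal I(\underline t(s),\bar z(s)),\hat z'(s)\rangle_{\mathcal Z^*,\mathcal Z}$ and $$I_1^k=\int_{s_{k-1}}^{s_k}\hat t'\,\overline{\mathrm{dist}}_{\mathcal V^*}\{-D_z\mathcal I(\hat t,\hat z),\partial\mathcal R(0)\}\,ds,$$ $$I_2^k=\int_{s_{k-1}}^{s_k}\Big[r+\|\hat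 z'\|_{\mathbb V}\big(\overline{\mathrm{dist}}_{\mathcal V^*}\{-D_z\mathcal I(\hat t,\hat z),\partial\mathcal R(0)\}-\overline{\mathrm{dist}}_{\mathcal V^*}\{-D_z\mathcal I(\underline t,\bar z),\partial\mathcal R(0)\}\big)\Big]ds.$$ $\bar c>0$ denotes a constant depending only on the data such that $r(s)\le\bar c\,\tau_k$ on $(s_{k-1},s_k)$, $I_1^k\le\bar c\,\tau_k$ and $I_2^k\le\bar c\,\tau_k$ for every run and every $k$. **Adaptive algorithm** (tolerance $\mathrm{tol}>0$, initial step size $\tau_1>0$). In iteration $k$ compute $z_k,t_k,s_k$, the interpolants and $I_1^k,I_2^k$ with the current $\tau_k$. If $I_1^k<\mathrm{tol}$ and $I_2^k<\mathrm{tol}$, accept the step and put $\tau_{k+1}=2\tau_k$ if moreover $I_1^k<\frac{\mathrm{tol}}2$ and $I_2^k<\frac{\mathrm{tol}}2$, and $\tau_{k+1}=\tau_k$ otherwise, and go on to iteration $k+1$. If not, replace $\tau_k$ by $\tau_k/2$ and repeat iteration $k$. Stop as soon as $t_k\ge T$. **Notation for the sequence.** For tolerance $\mathrm{tol}_n$ the algorithm terminates after $N_n$ iterations with final parameter $s^n_{N_n}$; $S_n:=\min\{s\ge0:\hat t_n(s)=T\}$. $\hat t_n,\hat z_n$ are extended constantly beyond $s^n_{N_n}$. Weak* convergence in $W^{1,\infty}(0,S;Y)$ means weak* convergence of the functions (restricted to $(0,S)$) and their derivatives in $L^\infty(0,S;Y)$. **$\mathbb V$-parametrized BV solution.** A pair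 $(\hat t,\hat z)$ for which there is $S\ge T$ (here the $S$ above) such that: $\hat t\in W^{1,\infty}(0,S)$, $\hat z\in W^{1,\infty}(0,S;\mathcal V)\cap L^\infty(0,S;\mathcal Z)$; $\hat z(0)=z_0$, $\hat t(0)=0$, $\hat t(S)=T$; for a.a. $s\in(0,S)$: $\hat t'(s)\ge0$, $\hat t'(s)+\|\hat z'(s)\|_{\mathbb V}\le1$, $\hat t'(s)\,\overline{\mathrm{dist}}_{\mathcal V^*}\{-D_z\mathcal I(\hat t(s),\hat z(s)),\partial\mathcal R(0)\}=0$; and for all $s\in[0,S]$ $$\mathcal I(\hat t(s),\hat z(s))+\int_0^s\mathcal R(\hat z'(\sigma))+\|\hat z'(\sigma)\|_{\mathbb V}\,\overline{\mathrm{dist}}_{\mathcal V^*}\{-D_z\mathcal I(\hat t(\sigma),\hat z(\sigma)),\partial\mathcal R(0)\}\,d\sigma=\mathcal I(0,z_0)+\int_0^s\partial_t\mathcal I(\hat t(\sigma),\hat z(\sigma))\,\hat t'(\sigma)\,d\sigma.$$ *)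

(* Defs.v *)
From HB Require Import structures.
From mathcomp Require Import all_boot all_order all_algebra.
From mathcomp Require Import all_classical all_reals all_analysis.

Set Implicit Arguments.
Unset Strict Implicit.
Unset Printing Implicit Defensive.

Import Order.TTheory GRing.Theory Num.Theory.
Import numFieldNormedType.Exports.

Local Open Scope classical_set_scope.
Local Open Scope ring_scope.

Section Spaces.
Context {R : realType}.

(* The norm of E comes from an inner product; completeness is carried by the
   type of E. *)
Definition hilbert_norm (E : normedModType R) : Prop :=
  exists ip : E -> E -> R,
    [/\ forall u v, ip u v = ip v u,
        forall a u v w, ip (a *: u + v) w = a * ip u w + ip v w
      & forall u, ip u u = `|u| ^+ 2].

(* Membership in the topological dual E^*; functionals are plain functions. *)
Definition in_dual (E : normedModType R) (l : E -> R) : Prop :=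
  (forall a u v, l (a *: u + v) = a * l u + l v) /\ continuous l.

Definition dual_norm (E : normedModType R) (l : E -> R) : R :=
  sup [set `|l v| | v in [set v : E | `|v| <= 1]].

(* B belongs to L(E, H^* ), with <B u, v> written B u v. *)
Definition bounded_op_dual (E H : normedModType R) (B : E -> H -> R) : Prop :=
  [/\ forall u, in_dual (B u),
      forall a u w v, B (a *: u + w) v = a * B u v + B w v
    & exists M, forall u v, `|B u v| <= M * `|u| * `|v|].

Definition self_adjoint (E : normedModType R) (B : E -> E -> R) : Prop :=
  forall u v, B u v = B v u.

Definition coercive (E : normedModType R) (B : E -> E -> R) : Prop :=
  exists2 a, 0 < a & forall u, a * `|u| ^+ 2 <= B u u.

Definition weak_cvg (E : normedModType R) (u_ : nat -> E) (u : E) : Prop :=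
  forall l, in_dual l -> (l (u_ n)) @[n --> \oo] --> l u.

(* G : E -> H^* is C^1 with Frechet derivative DG : E -> L(E, H^* ).  A bound
   ||l||_{H^*} <= c is written `|l v| <= c * `|v| for all v. *)
Definition C1_dual (E H : normedModType R) (G : E -> H -> R)
    (DG : E -> E -> H -> R) : Prop :=
  [/\ forall z, in_dual (G z),
      forall z, bounded_op_dual (DG z),
      forall z (e : R), 0 < e -> \forall h \near (0 : E), forall v,
        `|G (z + h) v - G z v - DG z h v| <= e * `|h| * `|v|
    & forall z (e : R), 0 < e -> \forall y \near z, forall h v,
        `|DG y h v - DG z h v| <= e * `|h| * `|v|].

(* Convex subdifferential, with values in E^*, of phi : E -> ]-oo, +oo]. *)
Definition subdifferential (E : normedModType R) (phi : E -> \bar R) (z : E) :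
    set (E -> R) :=
  [set xi | [/\ in_dual xi, (phi z < +oo)%E
              & forall v, (phi z + (xi (v - z))%:E <= phi v)%E]].

End Spaces.

Section BochnerSpaces.
Context {R : realType}.
Local Notation mu := (@lebesgue_measure R).

(* Pointwise limit on D of Borel functions with finitely many values, for the
   distance d on the subset E0 of E; used for a normed space (E0 = setT) and
   for a dual space (E0 = in_dual, where dual_norm is meaningful).  Every
   almost everywhere limit of such functions agrees almost everywhere with a
   pointwise one. *)
Definition strongly_measurable (E : Type) (E0 : set E) (d : E -> E -> R)
    (D : set R) (g : R -> E) : Prop :=
  exists h_ : nat -> R -> E,
    [/\ forall k s, E0 (h_ k s),
        forall k, finite_set (range (h_ k)),
        forall k e, measurable (h_ k @^-1` [set e])
      & forall s, D s -> d (h_ k s) (g s) @[k --> \oo] --> (0 : R)].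

Definition Linfty (Y : normedModType R) (S : R) (u : R -> Y) : Prop :=
  strongly_measurable setT (fun x y => `|x - y|) `]0, S[ u /\
  exists M, {ae mu, forall s, `]0, S[%classic s -> `|u s| <= M}.

Definition L1_dual (Y : normedModType R) (S : R) (phi : R -> Y -> R) : Prop :=
  [/\ forall s, in_dual (phi s),
      strongly_measurable (@in_dual R Y)
        (fun l m => dual_norm (fun v => l v - m v)) `]0, S[ phi
    & (\int[mu]_(s in `]0%R, S[) (dual_norm (phi s))%:E < +oo)%E].

(* u is the continuous representative on [0, S] of an element of
   W^{1,oo}(0, S; Y) with derivative du: u s = u 0 + int_0^s du.  The Bochner
   integral of du (strongly measurable, essentially bounded) is the element of
   Y determined by its values under the functionals l of Y^*. *)
Definition W1infty (Y : normedModType R) (S : R) (u du : R -> Y) : Prop :=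
  [/\ Linfty S u, Linfty S du
    & forall s, 0 <= s <= S -> forall l, in_dual l ->
        l (u s) = l (u 0) + Rintegral mu `]0, s[ (fun r => l (du r))].

(* For Y Hilbert, or Y the real line, L^oo(0, S; Y) is the dual of
   L^1(0, S; Y^* ). *)
Definition weakstar_Linfty (Y : normedModType R) (S : R)
    (u_ : nat -> R -> Y) (u : R -> Y) : Prop :=
  forall phi, L1_dual S phi ->
    Rintegral mu `]0, S[ (fun s => phi s (u_ n s)) @[n --> \oo] -->
    Rintegral mu `]0, S[ (fun s => phi s (u s)).

Definition weakstar_W1infty (Y : normedModType R) (S : R)
    (u_ : nat -> R -> Y) (u : R -> Y) : Prop :=
  exists (du_ : nat -> R -> Y) (du : R -> Y),
    [/\ forall n, W1infty S (u_ n) (du_ n), W1infty S u du,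
        weakstar_Linfty S u_ u & weakstar_Linfty S du_ du].

End BochnerSpaces.

(* load is the function f of the energy and load_t its time derivative; only
   their values at times in [0, Tend] matter. *)
Record ris_data (R : realType) (Z W V X : completeNormedModType R) := RisData {
  Tend : R;
  iZW : {linear Z -> W};
  iWV : {linear W -> V};
  iVX : {linear V -> X};
  VV : V -> V -> R;
  dis : X -> R;
  Aop : Z -> Z -> R;
  Fnl : Z -> R;
  load : R -> Z -> R;
  load_t : R -> Z -> R;
  z0 : Z }.

Section System.
Context {R : realType} {Z W V X : completeNormedModType R}.
Variable P : ris_data Z W V X.
Local Notation mu := (@lebesgue_measure R).

Definition iZV (z : Z) : V := iWV P (iZW P z).

(* Z = V as vector spaces; iZV is then an isomorphism (open mapping theorem),
   that is, the two norms are equivalent. *)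
Definition Z_eq_V : Prop := forall v : V, exists z : Z, iZV z = v.

Definition iZX (z : Z) : X := iVX P (iZV z).

(* l : Z -> R is the restriction to Z of w, an element of V^*. *)
Definition dual_restr (w : V -> R) (l : Z -> R) : Prop :=
  in_dual w /\ forall v, l v = w (iZV v).

Definition normV (v : V) : R := Num.sqrt (VV P v v).

Definition VVinv (w : V -> R) : V := xget 0 [set v | VV P v = w].

Definition normVinv (w : V -> R) : R := Num.sqrt (w (VVinv w)).

(* The minimum implements I(t, .) = I(Tend, .) for t > Tend. *)
Definition energy (t : R) (z : Z) : R :=
  2^-1 * Aop P z z + Fnl P z - load P (Num.min t (Tend P)) z.

Definition DzF (z : Z) : Z -> R := 'd (Fnl P : Z -> R^o) z.

Definition Dzf (t : R) (z : Z) : Z -> R := 'd (load P t : Z -> R^o) z.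

Definition DzE (t : R) (z : Z) : Z -> R :=
  'd (energy t : Z -> R^o) z.

(* Only meant for t in [0, Tend]. *)
Definition DtE (t : R) (z : Z) : R := - load_t P t z.

Definition subdiff_dis0 : set (Z -> R) :=
  [set xi | in_dual xi /\ forall v, xi v <= dis P (iZX v)].

Definition distV (eta : Z -> R) : \bar R :=
  ereal_inf [set (normVinv w)%:E | w in
    [set w : V -> R | in_dual w /\
                      subdiff_dis0 (fun v => w (iZV v) + eta v)]].

Definition dist_DE (t : R) (z : Z) : \bar R := distV (fun v => - DzE t z v).

Let in0T (t : R) : Prop := 0 <= t <= Tend P.

Record space_assumptions : Prop := {
  sp_T : 0 < Tend P;
  sp_hilbertZ : hilbert_norm Z;
  sp_hilbertV : hilbert_norm V;
  sp_contZW : continuous (iZW P);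
  sp_injZW : injective (iZW P);
  sp_contWV : continuous (iWV P);
  sp_injWV : injective (iWV P);
  sp_contVX : continuous (iVX P);
  sp_injVX : injective (iVX P);
  sp_compactZW : compact (closure (iZW P @` [set z | `|z| <= 1]));
  sp_denseZV : dense (range iZV);
  sp_VVop : bounded_op_dual (VV P);
  sp_VVsym : self_adjoint (VV P);
  sp_VVcoer : coercive (VV P) }.

Record dis_assumptions : Prop := {
  dis_ge0 : forall v, 0 <= dis P v;
  dis_convex : forall u v a, 0 <= a <= 1 ->
    dis P (a *: u + (1 - a) *: v) <= a * dis P u + (1 - a) * dis P v;
  dis_lsc : lower_semicontinuous (fun v => (dis P v)%:E);
  dis_hom : forall a v, 0 < a -> dis P (a *: v) = a * dis P v;
  dis_bounds : exists c C, [/\ 0 < c, 0 < C & forall v : V,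
    c * `|iVX P v| <= dis P (iVX P v) <= C * `|v|] }.

Record A_assumptions : Prop := {
  A_op : bounded_op_dual (Aop P);
  A_sym : self_adjoint (Aop P);
  A_coer : coercive (Aop P) }.

(* Since Z is reflexive, weak convergence in Z^* is tested with v in Z. *)
Record F_assumptions : Prop := {
  F_diff : forall z, differentiable (Fnl P : Z -> R^o) z;
  F_C2 : exists D2F, C1_dual DzF D2F;
  F_ge0 : forall z, 0 <= Fnl P z;
  F_DC1 : exists (DF : Z -> V -> R) (D2F : Z -> Z -> V -> R),
    [/\ forall z, dual_restr (DF z) (DzF z),
        C1_dual DF D2F
      & exists C q, [/\ 0 < C, 1 <= q & forall z v w,
          `|D2F z v w| <= C * (1 + `|z| `^ q) * `|v| * `|w|]];
  F_weak : forall z_ z, weak_cvg z_ z -> forall v,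
    DzF (z_ n) v @[n --> \oo] --> DzF z v }.

(* load in C^1([0, Tend] x Z; R): differentiable relatively to [0, Tend] x Z,
   with continuous partial derivatives load_t and Dzf. *)
Record f_C1 : Prop := {
  f_diffz : forall t z, in0T t -> differentiable (load P t : Z -> R^o) z;
  f_diff : forall (t : R) (z : Z) (e : R), in0T t -> 0 < e ->
    \forall p \near within [set p : R * Z | in0T p.1] (nbhs (t, z)),
      `|load P p.1 p.2 - load P t z - load_t P t z * (p.1 - t)
          - Dzf t z (p.2 - z)|
        <= e * (`|p.1 - t| + `|p.2 - z|);
  f_ft_cont : {within [set p : R * Z | in0T p.1],
                continuous (fun p : R * Z => load_t P p.1 p.2)};
  f_Dz_cont : forall (t : R) (z : Z) (e : R), in0T t -> 0 < e ->
    \forall p \near within [set p : R * Z | in0T p.1] (nbhs (t, z)),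
    forall v : Z,
      `|Dzf p.1 p.2 v - Dzf t z v|
        <= e * `|v| }.

Record f_assumptions : Prop := {
  f_isC1 : f_C1;
  f_growth : exists2 c, 0 < c & forall t z, in0T t ->
    load P t z <= c * (`|z| + 1);
  f_ft_growth : exists2 m, 0 < m & forall t z, in0T t ->
    `|load_t P t z| <= m * (`|z| + 1);
  f_Dz_lip : exists2 nu, 0 < nu & forall t1 t2 z1 z2, in0T t1 -> in0T t2 ->
    exists2 w,
      dual_restr w (fun v => Dzf t1 z1 v - Dzf t2 z2 v)
    & forall v, `|w v| <=
        nu * (`|t1 - t2| + `|iZW P z1 - iZW P z2|) * `|v|;
  f_weak : forall t z_ z, in0T t -> weak_cvg z_ z ->
    load P t (z_ n) @[n --> \oo] --> load P t z;
  f_ft_weak : forall t_ t z_ z, (forall n, in0T (t_ n)) -> in0T t ->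
    t_ n @[n --> \oo] --> t -> weak_cvg z_ z ->
    load_t P (t_ n) (z_ n) @[n --> \oo] --> load_t P t z }.

Record assumptions : Prop := {
  as_space : space_assumptions;
  as_dis : dis_assumptions;
  as_A : A_assumptions;
  as_F : F_assumptions;
  as_f : f_assumptions;
  as_z0 : exists w, dual_restr w (DzE 0 (z0 P)) }.

(* One step from (s, t, z) = (st_s, st_t, st_z) with step size st_tau and
   computed state st_znew. *)
Record step := Step {
  st_s : R; st_t : R; st_z : Z; st_tau : R; st_znew : Z }.

Definition indicator (tau : R) (v : Z) : \bar R :=
  if normV (iZV v) <= tau then 0%E else +oo%E.

Definition valid_step (x : step) : Prop :=
  [/\ 0 < st_tau x,
      exists2 xi,
        subdifferential
          (fun v => ((dis P (iZX v))%:E + indicator (st_tau x) v)%E)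
          (st_znew x - st_z x) xi
        & forall v, 0 = xi v + DzE (st_t x) (st_znew x) v
    & energy (st_t x) (st_znew x) + dis P (iZX (st_znew x - st_z x))
        <= energy (st_t x) (st_z x)].

Section Step.
Variable x : step.

Definition st_tnew : R :=
  st_t x + st_tau x - normV (iZV (st_znew x - st_z x)).

Definition st_snew : R := st_s x + st_tau x.

Definition st_zhat (s : R) : Z :=
  st_z x + ((s - st_s x) / st_tau x) *: (st_znew x - st_z x).

Definition st_that (s : R) : R :=
  st_t x + (s - st_s x) / st_tau x * (st_tnew - st_t x).

(* The constant derivatives of st_zhat and st_that. *)
Definition st_dz : Z := (st_tau x)^-1 *: (st_znew x - st_z x).

Definition st_dt : R := (st_tnew - st_t x) / st_tau x.

Definition st_r (s : R) : R :=
  DzE (st_that s) (st_zhat s) st_dz - DzE (st_t x) (st_znew x) st_dz.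

Definition st_I1 : \bar R :=
  (\int[mu]_(s in `]st_s x, st_snew[)
     (st_dt%:E * dist_DE (st_that s) (st_zhat s)))%E.

Definition st_I2 : \bar R :=
  (\int[mu]_(s in `]st_s x, st_snew[)
     ((st_r s)%:E + (normV (iZV st_dz))%:E *
        (dist_DE (st_that s) (st_zhat s)
         - dist_DE (st_t x) (st_znew x))))%E.

End Step.

Section Sequences.
Variables (tau : nat -> R) (z : nat -> Z).

Definition sseq (k : nat) : R := \sum_(1 <= i < k.+1) tau i.

Fixpoint tseq (k : nat) : R :=
  if k is k'.+1 then tseq k' + tau k - normV (iZV (z k - z k')) else 0.

(* The step leading from z k to z k.+1, i.e. iteration k.+1. *)
Definition step_of (k : nat) : step :=
  Step (sseq k) (tseq k) (z k) (tau k.+1) (z k.+1).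

Variable N : nat.

(* The k < N with sseq k <= s < sseq k.+1, and N if s >= sseq N. *)
Definition cell (s : R) : nat := find (fun k => s < sseq k.+1) (iota 0 N).

Definition zhat (s : R) : Z :=
  if (cell s < N)%N then st_zhat (step_of (cell s)) s else z N.

Definition that (s : R) : R :=
  if (cell s < N)%N then st_that (step_of (cell s)) s else tseq N.

End Sequences.

(* The first N steps of a run. *)
Definition is_run (tau : nat -> R) (z : nat -> Z) (N : nat) : Prop :=
  z 0%N = z0 P /\
  forall k, (k < N)%N -> tseq tau z k < Tend P /\ valid_step (step_of tau z k).

Definition is_cbar (cbar : R) : Prop :=
  0 < cbar /\
  forall tau z N, is_run tau z N -> forall k, (k < N)%N ->
    let x := step_of tau z k in
    [/\ forall s, st_s x < s < st_snew x -> st_r x s <= cbar * tau k.+1,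
        (st_I1 x <= (cbar * tau k.+1)%:E)%E
      & (st_I2 x <= (cbar * tau k.+1)%:E)%E].

Definition below (tol : R) (x : step) : bool :=
  (st_I1 x < tol%:E)%E && (st_I2 x < tol%:E)%E.

(* iteration tol s t z sigma tau znew: the iteration that starts from (s, t, z)
   with step size sigma ends by accepting (tau, znew); the state is computed
   afresh after each halving of the step size. *)
Inductive iteration (tol s t : R) (z : Z) : R -> R -> Z -> Prop :=
| Accept tau znew of
    valid_step (Step s t z tau znew) & below tol (Step s t z tau znew) :
    iteration tol s t z tau tau znew
| Reject sigma zrej tau znew of
    valid_step (Step s t z sigma zrej) & ~~ below tol (Step s t z sigma zrej)
    & iteration tol s t z (sigma / 2) tau znew :
    iteration tol s t z sigma tau znew.

Definition next_tau (tol : R) (x : step) : R :=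
  if below (tol / 2) x then 2 * st_tau x else st_tau x.

Definition adaptive_run (tol tau1 : R) (tau : nat -> R) (z : nat -> Z)
    (N : nat) : Prop :=
  [/\ z 0%N = z0 P,
      forall k, (k < N)%N ->
        tseq tau z k < Tend P /\
        iteration tol (sseq tau k) (tseq tau z k) (z k)
          (if k is k'.+1 then next_tau tol (step_of tau z k') else tau1)
          (tau k.+1) (z k.+1)
    & Tend P <= tseq tau z N].

Definition max_param (t_ : R -> R) (S : R) : Prop :=
  let B := [set s | 0 <= s /\ t_ s = Tend P] in B S /\ lbound B S.

Definition BV_solution (S : R) (t_ : R -> R) (z_ : R -> Z) : Prop :=
  Tend P <= S /\
  exists (dt : R -> R) (dz : R -> V),
    [/\ [/\ @W1infty R R^o S t_ dt, W1infty S (iZV \o z_) dz & Linfty S z_],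
        [/\ z_ 0 = z0 P, t_ 0 = 0 & t_ S = Tend P],
        {ae mu, forall s, `]0, S[%classic s ->
          [/\ 0 <= dt s, dt s + normV (dz s) <= 1
            & ((dt s)%:E * dist_DE (t_ s) (z_ s) = 0)%E]}
      & forall s, 0 <= s <= S ->
          ((energy (t_ s) (z_ s))%:E
           + \int[mu]_(r in `]0%R, s[)
               ((dis P (iVX P (dz r)))%:E
                + (normV (dz r))%:E * dist_DE (t_ r) (z_ r))
           = (energy 0 (z0 P))%:E
             + \int[mu]_(r in `]0%R, s[) (DtE (t_ r) (z_ r) * dt r)%:E)%E].

(* Convergence of a sequence (S_n, t_n, z_n) to (S, t, z) in the sense
   S_n -> S, t_n -> t weakly* in W^{1,oo}(0, S; R) and z_n -> z weakly* in
   W^{1,oo}(0, S; V); the functions z_n are written with values in Z. *)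
Definition param_cvg (S_ : nat -> R) (t_ : nat -> R -> R) (z_ : nat -> R -> Z)
    (S : R) (t : R -> R) (z : R -> Z) : Prop :=
  [/\ S_ n @[n --> \oo] --> S,
      @weakstar_W1infty R R^o S t_ t
    & weakstar_W1infty S (fun n => iZV \o z_ n) (iZV \o z)].

End System.

(* Main.v *)
(** Since Z = V and Z embeds compactly into V, Baire's theorem shows that V is
    finite-dimensional.  Hence the distance of -D_z I(t, z) to the stable set is finite,
    equals G(t, z) = max {-<D_z I(t, z), v> - R(v) : ||v||_V <= 1}, and is locally
    Lipschitz.  The optimality condition of a step makes the integrands of I_1 and I_2
    nonnegative and O(tau_k), so an accepted step contributes an error at most
    min(tol, c tau_k^2) <= sqrt(c tol) tau_k; the artificial time before the last step is
    bounded by a discrete Gronwall argument, and the last step costs at most tol.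
    Thus the interpolants satisfy a localized energy-dissipation inequality, and
    g (t(b) - t(a)) <= error whenever g <= G on [a, b], with errors vanishing as tol -> 0.
    Passing to the limit on [r, r + h] and dividing by h gives both conditions pointwise
    at almost every r; the converse inequality is the chain rule together with the
    definition of G.  Integration of the Lipschitz function I(t(s), z(s)) then yields the
    energy balance. *)

Require Import Defs.
From HB Require Import structures.
From mathcomp Require Import all_boot all_order all_algebra.
From mathcomp Require Import all_classical all_reals all_analysis measurable_realfun.
From mathcomp Require finmap.
From mathcomp Require Import ring lra.

Set Implicit Arguments.
Unset Strict Implicit.
Unset Printing Implicit Defensive.

Import Order.TTheory GRing.Theory Num.Theory.
Import numFieldNormedType.Exports.

Local Open Scope classical_set_scope.
Local Open Scope ring_scope.

(** * Lipschitz functions as primitives *)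

(** The energy-dissipation inequality is kept in a form without integrals: on a parameter interval
    where g <= G and where d bounds the power from above, it only involves the constants g, d and
    the values of the curve at the two endpoints. This form is additive in the interval and closed
    under pointwise convergence, and shrinking the interval recovers the densities. An error tol in
    every step need not add up to anything small; after the square root the local error is
    proportional to tau_k, and the tau_k add up to an arc length, which is bounded because the
    dissipation controls the V-norm of the increments. The derivatives in the definition of a
    solution are known only through their integrals; Lebesgue differentiation identifies them almost
    everywhere with pointwise ones. Conversely, Lipschitz curves get their derivatives as
    Radon-Nikodym densities. All curves are 1-Lipschitz with a common initial value in a
    finite-dimensional space, so weak star convergence amounts to pointwise convergence, the form
    used everywhere in between. *)

Section IntegrableItv.
Context {R : realType}.
Local Notation mu := (@lebesgue_measure R).

Lemma aeS (A B : R -> Prop) : (forall x, A x -> B x) ->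
  {ae mu, forall x, A x} -> {ae mu, forall x, B x}.
Proof. by move=> AB; apply: negligibleS; exact: subsetC. Qed.

Lemma aeI (A B : R -> Prop) :
  {ae mu, forall x, A x} -> {ae mu, forall x, B x} ->
  {ae mu, forall x, A x /\ B x}.
Proof.
move=> mA mB.
suff : mu.-negligible (~` ([set x | A x] `&` [set x | B x])) by [].
by rewrite setCI; exact: negligibleU.
Qed.

Lemma ae_eq_Rintegral (D : set R) (f g : R -> R) :
  measurable D -> measurable_fun D f -> measurable_fun D g ->
  {ae mu, forall x, D x -> f x = g x} -> Rintegral mu D f = Rintegral mu D g.
Proof.
move=> mD mf mg fg; rewrite /Rintegral; congr fine.
apply: ae_eq_integral => //; [exact/measurable_EFinP|exact/measurable_EFinP|].
by apply: aeS fg => x fg Dx /=; rewrite fg.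
Qed.

Lemma lebesgue_measure_oo_lty (a b : R) : (mu `]a, b[%classic < +oo)%E.
Proof. by rewrite lebesgue_measure_itv/=; case: ifP => _; rewrite ?ltry. Qed.

Lemma bounded_integrable_oo (a b M : R) (g : R -> R) :
  measurable_fun `]a, b[ g -> (forall x, a < x < b -> `|g x| <= M) ->
  mu.-integrable `]a, b[ (EFin \o g).
Proof.
move=> mg gM; apply: measurable_bounded_integrable => //.
  exact: lebesgue_measure_oo_lty.
exists M; split; rewrite ?num_real// => x Mx y; rewrite /= in_itv/= => yab.
by rewrite (le_trans (gM _ yab))// ltW.
Qed.

Lemma integrable_oo_cst (a b k : R) : mu.-integrable `]a, b[ (EFin \o cst k).
Proof. by apply: (@bounded_integrable_oo _ _ `|k|). Qed.

Lemma lebesgue_measure_oo (a b : R) : a <= b ->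
  mu `]a, b[%classic = (b - a)%:E.
Proof.
move=> ab; rewrite lebesgue_measure_itv/= lte_fin; case: ltP => // ba.
by rewrite (_ : b = a) ?subrr//; apply/eqP; rewrite eq_le ab ba.
Qed.

Lemma Rintegral_oo_cst (a b k : R) : a <= b ->
  Rintegral mu `]a, b[ (fun=> k) = k * (b - a).
Proof.
move=> ab; rewrite Rintegral_cst//; transitivity (k * fine (b - a)%:E) => //.
by congr (_ * fine _); exact: lebesgue_measure_oo.
Qed.

Lemma lipschitz_continuous (f : R -> R) L :
  (forall x y, `|f x - f y| <= L * `|x - y|) -> continuous f.
Proof.
move=> fL x; apply/cvgrPdist_le => /= e e0.
have L1 : 0 < `|L| + 1 by rewrite ltr_wpDl.
near=> y; apply: (le_trans (fL x y)).
apply: (@le_trans _ _ ((`|L| + 1) * `|x - y|)).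
  by rewrite ler_wpM2r// (le_trans (ler_norm _))// lerDl.
rewrite mulrC -ler_pdivlMr//.
near: y; apply: cvgr_dist_le; [exact: cvg_id|exact: divr_gt0].
Unshelve. all: by end_near. Qed.

End IntegrableItv.

Section LipschitzDensity.
Context {R : realType}.
Local Notation mu := (@lebesgue_measure R).
Variables (f : R -> R) (L : R).
Hypothesis L_gt0 : 0 < L.
Hypothesis fL : forall x y, `|f x - f y| <= L * `|x - y|.

Let F x := f x + L * x.

Let F_nd : {homo F : x y / x <= y}.
Proof.
move=> x y xy; rewrite /F; have := fL x y.
rewrite (ler0_norm (_ : x - y <= 0)) ?subr_le0// => h.
by have := ler_norm (f x - f y); lra.
Qed.

Let F_ub x y : x <= y -> F y - F x <= 2 * L * (y - x).
Proof.
move=> xy; rewrite /F; have := fL y x.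
rewrite (ger0_norm (_ : 0 <= y - x)) ?subr_ge0// => h.
by have := ler_norm (f y - f x); lra.
Qed.

Let F_rc : right_continuous F.
Proof.
apply: right_continuousW => x; apply: cvgD; first exact: (lipschitz_continuous fL).
by apply: cvgM; [exact: cvg_cst|exact: cvg_id].
Qed.

HB.instance Definition _ := isCumulative.Build R _ R F F_nd F_rc.

Let nu : {measure set (measurableTypeR R) -> \bar R} := lebesgue_stieltjes_measure F.

Let nuE (a b : R) : a <= b -> nu `]a, b]%classic = (F b - F a)%:E.
Proof.
move=> ab; rewrite /nu/= /lebesgue_stieltjes_measure /measure_extension/=.
rewrite measurable_mu_extE/=; last exact: is_ocitv.
by rewrite wlength_itv_bnd.
Qed.

(** Both measures are infima over the same covers by half-open intervals, and [F_ub] compares them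
    interval by interval. Absolute continuity with respect to Lebesgue measure follows. *)
Let nu_le (A : set R) : (nu A <= (2 * L)%:E * mu A)%E.
Proof.
rewrite /nu /lebesgue_measure/= /lebesgue_stieltjes_measure /measure_extension /mu_ext.
rewrite -ereal_inf_pZl ?mulr_gt0//.
apply: le_ereal_inf_tmp => _ [_ [B [mB AB] <-] <-].
apply: (@le_trans _ _ (\sum_(k <oo) wlength F (B k))%E).
  by apply: ereal_inf_lbound; exists B.
rewrite -nneseriesZl//.
apply: lee_nneseries => // k _.
have /ocitvP[->|[[a b] /= ab ->]] := mB k.
  by rewrite !measure0 mule0.
rewrite (wlength_itv_bnd F _ _ (ltW ab)) (wlength_itv_bnd idfun _ _ (ltW ab)).
by rewrite -EFinM lee_fin F_ub// ltW.
Qed.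

(* f + L x is nondecreasing and its Stieltjes measure is dominated by 2 L times the
   Lebesgue measure: the density is its Radon-Nikodym derivative, minus L. *)
Lemma lipschitz_density (S : R) : 0 < S ->
  exists g : R -> R,
    [/\ measurable_fun setT g,
        mu.-integrable `]0, S[ (EFin \o g)
      & forall s, 0 <= s <= S -> f s = f 0 + Rintegral mu `]0, s[ g].
Proof.
move=> S0.
have mD : measurable (`]0, S]%classic : set (measurableTypeR R)) by exact: measurable_itv.
have nuD : (nu `]0%R, S]%classic < +oo)%E by rewrite nuE ?ltW// ltry.
have dom : mfrestr mD nuD `<< mu.
  apply/null_content_dominatesP => A mA A0; rewrite /mfrestr/= /mrestr.
  apply/eqP; rewrite eq_le measure_ge0 andbT.
  apply: (@le_trans _ _ (nu A)); first by rewrite le_measure// ?inE//; exact: measurableI.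
  by apply: (le_trans (nu_le _)); rewrite A0 mule0.
have [h [h0 hfin hint hE]] := radon_nikodym_sigma_finite dom.
pose k (x : R) : R := fine (h x).
have kE : EFin \o k = h by apply/funext => x /=; rewrite /k fineK.
have kint : mu.-integrable setT (EFin \o k) by rewrite kE.
have kints s : mu.-integrable `]0, s[ (EFin \o k) by exact: integrableS kint.
have Lint s := @integrable_oo_cst R 0 s L.
exists (fun x => k x - L); split.
- apply: measurable_funB => //; apply/measurable_EFinP.
  by case/integrableP: kint.
- have := integrableB _ (kints S) (Lint S).
  by move/(_ (measurable_itv _)); apply: eq_integrable => // x _ /=; rewrite EFinB.
- move=> s /andP[s0 sS].
  rewrite (RintegralB _ (kints s) (Lint s))// (Rintegral_oo_cst _ s0).
  have -> : Rintegral mu `]0, s[ k = F s - F 0.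
    have -> : Rintegral mu `]0, s[ k = Rintegral mu `]0, s] k.
      rewrite Rintegral_itv_bndo_bndc//; exact: integrableS kint.
    rewrite /Rintegral; under eq_integral do rewrite -[(k _)%:E]/((EFin \o k) _) kE.
    rewrite -hE//= /mfrestr/= /mrestr setIidl; last first.
      by move=> x /=; rewrite !in_itv/= => /andP[-> /le_trans ->].
    by rewrite nuE.
  by rewrite /F; lra.
Qed.
End LipschitzDensity.

Section AeDerivative.
Context {R : realType}.
Local Notation mu := (@lebesgue_measure R).

(** Lebesgue differentiation for the extension of g by zero. Its primitive agrees with F - F 0 only
    on [0, S], which is a neighbourhood of every interior point. *)
Lemma ae_is_derive_primitive (S : R) (F g : R -> R) :
  mu.-integrable `]0, S[ (EFin \o g) ->
  (forall s, 0 <= s <= S -> F s = F 0 + Rintegral mu `]0, s[ g) ->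
  {ae mu, forall r, `]0, S[%classic r -> is_derive r 1 F (g r)}.
Proof.
move=> gint FE.
have gS : mu.-integrable setT (EFin \o (g \_ `]0, S[)).
  by rewrite -restrict_EFin; apply/integrable_restrict => //; rewrite setTI.
have gSS A : measurable A -> mu.-integrable A (EFin \o (g \_ `]0, S[)).
  by move=> mA; exact: integrableS gS.
have := @FTC1Ny R (g \_ `]0, S[) (fun y => gSS _ (measurable_itv _))
  (integrable_locally (measurable_itv _) gint).
apply: aeS => r [dr Dr]; rewrite /= in_itv/= => /andP[r0 rS].
set G := (X in derivable X) in dr Dr.
have GE s : 0 <= s <= S -> F s = F 0 + G s.
  move=> s0S; rewrite FE//; congr (_ + _); rewrite /G.
  rewrite -Rintegral_itv_bndo_bndc; last exact: gSS.
  rewrite -Rintegral_mkcondr; congr (Rintegral _ _ _).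
  apply/seteqP; split => x /=; rewrite !in_itv/=.
    by move=> /andP[-> xs]; rewrite xs (lt_le_trans xs)//; case/andP: s0S.
  by move=> [-> /andP[-> _]].
have gr : g r = (g \_ `]0, S[) r by rewrite patchE mem_set//= in_itv/= r0.
apply: (@near_eq_is_derive _ _ _ (fun s => F 0 + G s)).
  near=> s; apply/esym/GE; apply/andP; split; apply: ltW.
    by near: s; exact: lt_nbhsr.
  by near: s; exact: lt_nbhsl.
rewrite gr -Dr derive1E -[X in is_derive _ _ _ X]add0r.
by apply: is_deriveD; apply: DeriveDef.
Unshelve. all: by end_near. Qed.

End AeDerivative.

Section LipschitzDensityBounded.
Context {R : realType}.
Local Notation mu := (@lebesgue_measure R).

Lemma is_derive_right_cvg (F : R -> R) (r d : R) : is_derive r 1 F d ->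
  (F (h + r) - F r) / h @[h --> 0^'] --> d.
Proof.
case=> /cvg_ex[/= l hl] <-; rewrite /derive (cvg_lim _ hl)//.
apply: cvg_trans hl; apply: near_eq_cvg; apply: nearW => h /=.
by rewrite /GRing.scale/= mulr1 mulrC.
Qed.

Lemma is_derive_lipschitz_le (F : R -> R) (r d L S : R) : 0 < r < S ->
  (forall x y, 0 <= x <= S -> 0 <= y <= S -> `|F x - F y| <= L * `|x - y|) ->
  is_derive r 1 F d -> `|d| <= L.
Proof.
move=> /andP[r0 rS] FL /is_derive_right_cvg/cvg_norm Fd.
apply: (cvgr_to_le Fd).
near=> h; rewrite normrM normfV ler_pdivrMr; last first.
  by rewrite normr_gt0; near: h; exact: nbhs_dnbhs_neq.
have hr : 0 <= h + r <= S.
  have : `|h| <= Num.min r (S - r).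
    near: h; apply: dnbhs0_le; rewrite lt_min r0 subr_gt0//.
  by rewrite le_min !ler_norml; lra.
by rewrite (le_trans (FL _ _ hr _)) ?addrK//; lra.
Unshelve. all: by end_near. Qed.

(** The projection of the line onto [0, S]. Composing with it extends a function that is Lipschitz
    on [0, S] to the whole line with the same constant. *)
Definition clamp (S x : R) : R := Num.max 0 (Num.min x S).

Lemma clamp_itv S x : 0 <= S -> 0 <= clamp S x <= S.
Proof. by move=> S0; rewrite /clamp le_max lexx/= ge_max S0 ge_min lexx orbT. Qed.

Lemma clamp_id S x : 0 <= x <= S -> clamp S x = x.
Proof. by move=> /andP[x0 xS]; rewrite /clamp min_l// max_r. Qed.

Lemma clamp_lipschitz S x y : 0 <= S -> `|clamp S x - clamp S y| <= `|x - y|.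
Proof.
move=> S0; rewrite /clamp; wlog xy : x y / x <= y.
  move=> H; have [/H//|/ltW/H] := leP x y.
  by rewrite distrC (distrC y).
rewrite ler0_norm; last first.
  by rewrite subr_le0 ge_max !le_max lexx/= le_min !ge_min lexx orbT xy orbT.
rewrite ler0_norm ?subr_le0//.
by rewrite /Num.max /Num.min; do 4?case: ifPn; lra.
Qed.

Lemma lipschitz_primitive (f : R -> R) (L S : R) : 0 < S -> 0 < L ->
  (forall x y, 0 <= x <= S -> 0 <= y <= S -> `|f x - f y| <= L * `|x - y|) ->
  exists g : R -> R,
    [/\ measurable_fun setT g, forall x, `|g x| <= L
      & forall s, 0 <= s <= S -> f s = f 0 + Rintegral mu `]0, s[ g].
Proof.
move=> S0 L0 fL.
pose c := clamp S.
have c0S x : 0 <= c x <= S by exact/clamp_itv/ltW.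
have cE x : 0 <= x <= S -> c x = x by exact: clamp_id.
have cL x y : `|c x - c y| <= `|x - y| by exact/clamp_lipschitz/ltW.
have fcL x y : `|f (c x) - f (c y)| <= L * `|x - y|.
  by apply: (le_trans (fL _ _ (c0S x) (c0S y))); rewrite ler_pM2l.
have [g [mg gint gE]] := @lipschitz_density R (f \o c) L L0 fcL S S0.
have gE' s : 0 <= s <= S -> f s = f 0 + Rintegral mu `]0, s[ g.
  by move=> sS; have := gE s sS; rewrite /= !cE// lexx ltW.
have aeg := ae_is_derive_primitive gint gE'.
(* On ]0, S[ the density is almost everywhere the derivative of f, so it exceeds L in modulus only
   on a null set of this interval; resetting it gives a bound valid at every point. *)
exists (fun x => if `|g x| <= L then g x else 0); split.
- apply: measurable_fun_ifT => //.
  by apply: measurable_fun_ler => //; exact: measurableT_comp.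
- by move=> x; case: ifP => // _; rewrite normr0 ltW.
- move=> s sS; rewrite gE'//; congr (_ + _).
  apply: ae_eq_Rintegral => //.
  + exact: measurable_funS mg.
  + apply: measurable_funS measurableT _ _ => //.
    apply: measurable_fun_ifT => //.
    by apply: measurable_fun_ler => //; exact: measurableT_comp.
  + apply: aeS aeg => r dr; rewrite /= in_itv/= => /andP[r0 rs].
    have rS : 0 < r < S by rewrite r0 (lt_le_trans rs)//; case/andP: sS.
    have /(is_derive_lipschitz_le rS fL) : is_derive r 1 f (g r).
      by apply: dr; rewrite /= in_itv.
    by move=> ->.
Qed.
End LipschitzDensityBounded.

(** * Weak star convergence and Bochner spaces with finite-dimensional target *)

Section WeakStar.
Context {R : realType}.
Local Notation mu := (@lebesgue_measure R).

(** Heine's theorem with only x confined to the segment, as the near-covering form of compactness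
    yields it. *)
Lemma unif_continuous_segment (phi : R -> R) (a b e : R) : continuous phi ->
  0 < e -> exists2 d, 0 < d & forall x y, a <= x <= b -> `|x - y| < d ->
    `|phi x - phi y| < e.
Proof.
move=> cphi e0.
have /compact_near_coveringP cov := @segment_compact R a b.
have : \forall d \near (0 : R)^'+, forall x, `[a, b]%classic x ->
    forall y, `|x - y| < d -> `|phi x - phi y| < e.
  apply: cov => x _.
  have e2 : 0 < e / 2 by rewrite divr_gt0.
  have /cvgrPdist_lt/(_ _ e2) : phi @ x --> phi x by exact: cphi.
  move=> [r /= r0 hr].
  exists (ball x (r / 2), [set d | d < r / 2]) => /=.
    by split; [apply: nbhsx_ballx|apply: nbhs_right_lt]; exact: divr_gt0.
  move=> [y d] /= [xy dr] z yz.
  rewrite (splitr e) (le_lt_trans (ler_distD (phi x) _ _))// ltrD//.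
    by rewrite distrC; apply: hr => /=; rewrite (lt_le_trans xy)// ler_pdivrMr// ler_pMr// ler1n.
  apply: hr => /=; rewrite (le_lt_trans (ler_distD y _ _))// (splitr r) ltrD//.
  exact: lt_trans yz dr.
move=> H; near (0 : R)^'+ => d; exists d => // x y xab xy.
have : forall x, `[a, b]%classic x -> forall y, `|x - y| < d -> `|phi x - phi y| < e by near: d.
by apply => //; rewrite /= in_itv.
Unshelve. all: by end_near. Qed.

Lemma integrable_ooB (a b : R) (f g : R -> R) :
  mu.-integrable `]a, b[ (EFin \o f) -> mu.-integrable `]a, b[ (EFin \o g) ->
  mu.-integrable `]a, b[ (EFin \o (fun x => f x - g x)).
Proof.
move=> fi gi; have := integrableB _ fi gi; move/(_ (measurable_itv _)).
by apply: eq_integrable => // x _ /=; rewrite EFinB.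
Qed.

Lemma integrable_ooZ (a b r : R) (f : R -> R) :
  mu.-integrable `]a, b[ (EFin \o f) ->
  mu.-integrable `]a, b[ (EFin \o (fun x => r * f x)).
Proof.
move=> fi; have := integrableZl _ r fi; move/(_ (measurable_itv _)).
by apply: eq_integrable => // x _ /=; rewrite EFinM.
Qed.

Lemma integrable_oo_sub (a b c d : R) (f : R -> R) :
  a <= c -> d <= b -> mu.-integrable `]a, b[ (EFin \o f) ->
  mu.-integrable `]c, d[ (EFin \o f).
Proof.
move=> ac db; apply: integrableS => // x /=; rewrite !in_itv/= => /andP[cx xd].
by rewrite (le_lt_trans ac)// (lt_le_trans xd).
Qed.

Lemma Rintegral_oo_split (a b c : R) (f : R -> R) : a <= b -> b <= c ->
  mu.-integrable `]a, c[ (EFin \o f) ->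
  Rintegral mu `]a, c[ f = Rintegral mu `]a, b[ f + Rintegral mu `]b, c[ f.
Proof.
move=> ab bc intf.
have intb : mu.-integrable `]a, b[ (EFin \o f) by exact: integrable_oo_sub intf.
have [->|bc'] := eqVneq b c.
  rewrite (_ : `]c, c[%classic = set0) ?Rintegral_set0 ?addr0//.
  by apply/seteqP; split => x //=; rewrite in_itv/=; lra.
have {}bc : b < c by rewrite lt_neqAle bc' bc.
have := @Rintegral_itvB R f (BRight a) (BLeft c) b intf.
rewrite !bnd_simp => /(_ ab bc) <-.
by rewrite -Rintegral_itv_bndo_bndc// addrC subrK.
Qed.

Lemma normr_Rintegral_oo_le (a b M : R) (f : R -> R) : a <= b ->
  measurable_fun `]a, b[ f -> (forall x, a < x < b -> `|f x| <= M) ->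
  `|Rintegral mu `]a, b[ f| <= M * (b - a).
Proof.
move=> ab mf fM.
have intf := bounded_integrable_oo mf fM.
apply: (le_trans (le_normr_Rintegral _ intf)) => //.
rewrite -(Rintegral_oo_cst M ab); apply: le_Rintegral => //.
- exact: integrable_norm.
- exact: integrable_oo_cst.
Qed.

Lemma bounded_oo (a b M : R) (g : R -> R) :
  (forall x, a < x < b -> `|g x| <= M) -> [bounded g x | x in `]a, b[%classic].
Proof.
move=> gM; exists M; split; rewrite ?num_real// => x Mx y.
by rewrite /= in_itv/= => yab; rewrite (le_trans (gM _ yab))// ltW.
Qed.

Lemma integrable_oo_mulr (a b M : R) (f g : R -> R) :
  mu.-integrable `]a, b[ (EFin \o f) -> measurable_fun `]a, b[ g ->
  (forall x, a < x < b -> `|g x| <= M) ->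
  mu.-integrable `]a, b[ (EFin \o (fun x => f x * g x)).
Proof.
move=> intf mg gM; have := integrableMl _ intf mg (bounded_oo gM).
by move/(_ (measurable_itv _)); apply: eq_integrable => // x _ /=; rewrite EFinM.
Qed.

Variables (S L : R) (k : nat -> R -> R).
Hypothesis S_gt0 : 0 < S.
Hypothesis L_gt0 : 0 < L.
Hypothesis mk : forall n, measurable_fun `]0, S[ (k n).
Hypothesis kL : forall n x, 0 < x < S -> `|k n x| <= L.
Hypothesis k0 : forall s, 0 <= s <= S -> Rintegral mu `]0, s[ (k n) @[n --> \oo] --> 0.

Let intk a b n : 0 <= a -> b <= S -> mu.-integrable `]a, b[ (EFin \o k n).
Proof.
move=> a0 bS; apply: (@integrable_oo_sub 0 S) => //.
exact: bounded_integrable_oo (mk n) (@kL n).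
Qed.

(** On a cell [a, b] so short that phi varies by less than e / (2 L S), the integral of phi times
    [k n] is phi a times an increment of the primitive, which tends to 0, plus an error at most e /
    (2 L S) * L * (b - a). These errors add up to e / 2 over [0, S]. *)
Let weakstar_continuous (phi : R -> R) : continuous phi ->
  Rintegral mu `]0, S[ (fun x => phi x * k n x) @[n --> \oo] --> 0.
Proof.
move=> cphi; apply/cvgr0Pnorm_le => e e0.
have [|d d0 dphi] := @unif_continuous_segment phi 0 S (e / (2 * L * S)) cphi.
  by rewrite divr_gt0// !mulr_gt0.
set e' := e / (2 * L * S) in dphi.
pose m := (Num.truncn (S / d)).+1.
have m0 : 0 < m%:R :> R by rewrite ltr0n.
pose h := S / m%:R.
have h0 : 0 < h by rewrite divr_gt0.
have hd : h < d.
  by rewrite ltr_pdivrMr// mulrC -ltr_pdivrMr// Num.Theory.truncnS_gt.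
have cphik a b n : 0 <= a -> b <= S -> mu.-integrable `]a, b[ (EFin \o (fun x => phi x * k n x)).
  move=> a0 bS; apply: (@integrable_oo_mulr _ _ L).
  - apply: (@integrableS _ _ _ mu `[a, b]%classic) => //.
      by apply: subset_itv_oo_cc.
    apply: continuous_compact_integrable; first exact: segment_compact.
    exact: continuous_subspaceT.
  - by have /integrableP[/measurable_EFinP] := intk n a0 bS.
  - by move=> x xab; apply: kL; lra.
(* Induction on the number of cells. The slack eta is arbitrary at each stage, so half of it pays
   for the next cell. *)
suff H i : (i <= m)%N -> forall eta, 0 < eta -> \forall n \near \oo,
    `|Rintegral mu `]0, (i%:R * h)[ (fun x => phi x * k n x)| <= e' * L * (i%:R * h) + eta.
  have := H m (leqnn _) (e / 2) (divr_gt0 e0 (ltr0Sn R 1)).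
  have -> : m%:R * h = S by rewrite /h mulrC divfK ?gt_eqF.
  apply: filterS => n /le_trans; apply.
  by rewrite /e' (_ : e / (2 * L * S) * L * S = e / 2) -?splitr//; field; rewrite ?gt_eqF.
elim: i => [_ eta eta0|i IH im eta eta0].
  apply: nearW => n; rewrite mul0r (_ : `]0, 0[%classic = set0) ?Rintegral_set0 ?normr0 ?mulr0 ?add0r ?ltW//.
  by apply/seteqP; split => x //=; rewrite in_itv/=; lra.
pose a := i%:R * h; pose b := i.+1%:R * h.
have ab : b = a + h by rewrite /b /a -natr1 mulrDl mul1r.
have a0 : 0 <= a by rewrite mulr_ge0// ltW.
have ab' : a <= b by rewrite ab lerDl ltW.
have bS : b <= S.
  by rewrite /b /h mulrA ler_pdivrMr// mulrC ler_pM2l// ler_nat.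
have eta2 : 0 < eta / 2 by rewrite divr_gt0.
have phia : 0 < `|phi a| + 1 by rewrite ltr_wpDl.
have kab : Rintegral mu `]a, b[ (k n) @[n --> \oo] --> 0.
  have -> : (fun n => Rintegral mu `]a, b[ (k n)) =
    (fun n => Rintegral mu `]0, b[ (k n) - Rintegral mu `]0, a[ (k n)).
    apply/funext => n; rewrite (Rintegral_oo_split a0 ab' (intk n (lexx 0) bS)).
    by rewrite addrC addKr.
  rewrite -[X in _ --> X](subrr 0); apply: cvgB; apply: k0; lra.
have {}kab : \forall n \near \oo, `|Rintegral mu `]a, b[ (k n)| <= eta / 2 / (`|phi a| + 1).
  by move/cvgr0Pnorm_le : kab; apply; exact: divr_gt0.
have IHi := IH (ltnW im) _ eta2.
near=> n.
rewrite (Rintegral_oo_split a0 ab' (cphik _ _ n (lexx 0) bS)).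
have -> : Rintegral mu `]a, b[ (fun x => phi x * k n x) =
    phi a * Rintegral mu `]a, b[ (k n) + Rintegral mu `]a, b[ (fun x => (phi x - phi a) * k n x).
  have ik := intk n a0 bS.
  rewrite -RintegralZl// -RintegralD//.
  - by apply: eq_Rintegral => x _; rewrite -mulrDl addrC subrK.
  - exact: integrable_ooZ.
  - have := integrable_ooB (cphik a b n a0 bS) (integrable_ooZ (phi a) ik).
    by apply: eq_integrable => // x _ /=; rewrite mulrBl.
have h1 : `|Rintegral mu `]0, a[ (fun x => phi x * k n x)| <= e' * L * a + eta / 2.
  by near: n.
have h2 : `|phi a * Rintegral mu `]a, b[ (k n)| <= eta / 2.
  have hn : `|Rintegral mu `]a, b[ (k n)| <= eta / 2 / (`|phi a| + 1) by near: n.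
  rewrite normrM (le_trans (ler_wpM2l (normr_ge0 _) hn))//.
  rewrite mulrCA ler_piMr ?(ltW eta2)// ler_pdivrMr// mul1r lerDl//.
have h3 : `|Rintegral mu `]a, b[ (fun x => (phi x - phi a) * k n x)| <= e' * L * h.
  rewrite (_ : h = b - a); last by rewrite ab addrAC subrr add0r.
  apply: normr_Rintegral_oo_le; first by lra.
    apply: measurable_funM.
      apply: measurable_funB => //; apply: measurable_funTS.
      exact: continuous_measurable_fun.
    by have /integrableP[/measurable_EFinP] := intk n a0 bS.
  move=> x /andP[ax xb]; rewrite normrM ler_pM//.
    rewrite distrC ltW//; apply: dphi; first by lra.
    by rewrite distrC ger0_norm; lra.
  by apply: kL; rewrite (le_lt_trans a0 ax) (lt_le_trans xb bS).
rewrite (le_trans (ler_normD _ _))// (le_trans (lerD (lexx _) (ler_normD _ _)))//.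
have -> : e' * L * b + eta = (e' * L * a + eta / 2) + (eta / 2 + e' * L * h).
  rewrite ab mulrDr {1}(splitr eta) -!addrA; congr (_ + _).
  by rewrite addrC -addrA.
by rewrite lerD// lerD.
Unshelve. all: by end_near. Qed.

(** Continuous functions are dense in L^1, and the uniform bound L on [k] controls the error of
    replacing phi by one of them. *)
Lemma weakstar_primitive (phi : R -> R) :
  mu.-integrable `]0, S[ (EFin \o phi) ->
  Rintegral mu `]0, S[ (fun x => phi x * k n x) @[n --> \oo] --> 0.
Proof.
move=> iphi.
have [g_ [cg ig g_phi]] := approximation_continuous_integrable (measurable_itv _)
  (lebesgue_measure_oo_lty 0 S) iphi.
apply/cvgr0Pnorm_le => e e0.
have e2L : 0 < e / 2 / L by rewrite !divr_gt0.
have e2 : 0 < e / 2 by rewrite divr_gt0.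
have [m gm] : exists m, Rintegral mu `]0, S[ (fun x => `|phi x - g_ m x|) <= e / 2 / L.
  move/fine_cvg : g_phi => /cvgr0Pnorm_le/(_ _ e2L)[m _ /(_ m (leqnn _))] hm.
  by exists m; apply: le_trans hm; exact: ler_norm.
have /cvgr0Pnorm_le/(_ _ e2) := weakstar_continuous (cg m).
apply: filterS => n gkn.
have intd' := integrable_ooB iphi (ig m).
have intdk := integrable_oo_mulr intd' (mk n) (@kL n).
have intgk := integrable_oo_mulr (ig m) (mk n) (@kL n).
have -> : Rintegral mu `]0, S[ (fun x => phi x * k n x) =
  Rintegral mu `]0, S[ (fun x => (phi x - g_ m x) * k n x) +
  Rintegral mu `]0, S[ (fun x => g_ m x * k n x).
  by rewrite -RintegralD//; apply: eq_Rintegral => x _; rewrite -mulrDl subrK.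
rewrite (splitr e) (le_trans (ler_normD _ _))// lerD//.
rewrite (le_trans (le_normr_Rintegral _ intdk))//.
have -> : e / 2 = (e / 2 / L) * L by rewrite divfK ?gt_eqF.
apply: (@le_trans _ _ (Rintegral mu `]0, S[ (fun x => `|phi x - g_ m x|) * L)); last first.
  by rewrite ler_pM2r.
rewrite -RintegralZr//; last exact: integrable_norm intd'.
apply: le_Rintegral => //.
- exact: integrable_norm intdk.
- have := integrable_ooZ L (integrable_norm intd').
  by apply: eq_integrable => // x _ /=; rewrite mulrC.
- move=> x; rewrite /= in_itv/= => xS; rewrite normrM ler_wpM2l//; exact: kL.
Qed.

End WeakStar.

(** * Dual spaces, strong measurability and coordinates *)

Section DualSpace.
Context {R : realType} {Y : normedModType R}.
Implicit Types (l m : Y -> R).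

Lemma in_dual0 l : in_dual l -> l 0 = 0.
Proof.
by move=> [lin _]; have := lin 1 0 0; rewrite scale1r addr0 mul1r; lra.
Qed.

Lemma in_dualD l u v : in_dual l -> l (u + v) = l u + l v.
Proof. by move=> [lin _]; have := lin 1 u v; rewrite scale1r mul1r. Qed.

Lemma in_dualZ l a u : in_dual l -> l (a *: u) = a * l u.
Proof. by move=> hl; have := hl.1 a u 0; rewrite addr0 in_dual0// addr0. Qed.

Lemma in_dualN l u : in_dual l -> l (- u) = - l u.
Proof. by move=> hl; rewrite -scaleN1r in_dualZ// mulN1r. Qed.

Lemma in_dualB l u v : in_dual l -> l (u - v) = l u - l v.
Proof. by move=> hl; rewrite in_dualD// in_dualN. Qed.

Lemma in_dual_sum l (I : Type) (r : seq I) (F : I -> Y) : in_dual l ->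
  l (\sum_(i <- r) F i) = \sum_(i <- r) l (F i).
Proof.
move=> hl; elim: r => [|i r IH]; first by rewrite !big_nil in_dual0.
by rewrite !big_cons in_dualD// IH.
Qed.

Lemma in_dual_bounded l : in_dual l ->
  exists2 C, 0 < C & forall v, `|l v| <= C * `|v|.
Proof.
move=> hl; have /cvgr0Pnorm_lt/(_ 1 ltr01) : l v @[v --> 0] --> 0.
  by rewrite -[X in _ --> X](in_dual0 hl); exact: hl.2.
move=> /nbhs_normP[/= d d0 hd]; exists (2 / d); first by rewrite divr_gt0.
move=> v; have [->|v0] := eqVneq v 0; first by rewrite in_dual0// !normr0 mulr0.
have nv0 : 0 < `|v| by rewrite normr_gt0.
have k0 : 0 < d / (2 * `|v|) by rewrite divr_gt0// mulr_gt0.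
have : `|l ((d / (2 * `|v|)) *: v)| < 1.
  apply: hd => /=; rewrite sub0r normrN normrZ gtr0_norm//.
  rewrite invfM mulrA -(mulrA _ `|v|^-1) mulVf ?gt_eqF// mulr1.
  by rewrite ltr_pdivrMr// ltr_pMr// ltr1n.
rewrite in_dualZ// normrM gtr0_norm// mulrC -ltr_pdivlMr// div1r invf_div => /ltW.
by rewrite mulrAC.
Qed.

Lemma dual_norm_ub l : in_dual l -> forall v, `|l v| <= dual_norm l * `|v|.
Proof.
move=> hl v; have [C C0 lC] := in_dual_bounded hl.
have [->|v0] := eqVneq v 0; first by rewrite in_dual0// !normr0 mulr0.
have nv0 : 0 < `|v| by rewrite normr_gt0.
rewrite -ler_pdivrMr//; apply: ub_le_sup.
  exists C => _ [u /= u1 <-]; rewrite (le_trans (lC _))// ler_piMr// ltW//.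
exists (`|v|^-1 *: v) => /=.
  by rewrite normrZ normfV normr_id mulVf ?gt_eqF.
by rewrite in_dualZ// normrM normfV normr_id mulrC.
Qed.

Lemma dual_norm_le l C : in_dual l -> 0 <= C -> (forall v, `|l v| <= C * `|v|) ->
  dual_norm l <= C.
Proof.
move=> hl C0 lC; apply: ge_sup.
  by exists 0, 0 => /=; rewrite ?normr0 ?ler01// in_dual0// normr0.
by move=> _ [v /= v1 <-]; rewrite (le_trans (lC v))// ler_piMr.
Qed.

Lemma dual_norm_ge0 l : in_dual l -> 0 <= dual_norm l.
Proof.
move=> hl; have [C C0 lC] := in_dual_bounded hl.
apply: (@le_trans _ _ `|l 0|) => //; apply: ub_le_sup.
  exists C => _ [u /= u1 <-]; rewrite (le_trans (lC _))// ler_piMr// ltW//.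
by exists 0 => //=; rewrite normr0.
Qed.

Lemma in_dualBf l m : in_dual l -> in_dual m -> in_dual (fun v => l v - m v).
Proof.
move=> hl hm; split => [a u v|v].
  by rewrite hl.1 hm.1 mulrBr opprD addrACA.
by apply: cvgB; [exact: hl.2|exact: hm.2].
Qed.

Lemma in_dualZf l a : in_dual l -> in_dual (fun v => a * l v).
Proof.
move=> hl; split => [b u v|v]; first by rewrite hl.1 mulrDr mulrCA.
by apply: cvgM; [exact: cvg_cst|exact: hl.2].
Qed.

End DualSpace.

Section StronglyMeasurable.
Context {R : realType}.
Local Notation mu := (@lebesgue_measure R).

Lemma finite_range_measurable (E : Type) (h : R -> E) (phi : E -> R) (D : set R) :
  measurable D -> finite_set (range h) -> (forall e, measurable (h @^-1` [set e])) ->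
  measurable_fun D (phi \o h).
Proof.
move=> mD fr mh _ A mA; apply: measurableI => //.
rewrite (_ : _ @^-1` A = \bigcup_(e in range h `&` (phi @^-1` A)) h @^-1` [set e]).
  apply: fin_bigcup_measurable => [|e _]; last exact: mh.
  by apply: sub_finite_set fr; exact: subIsetl.
apply/seteqP; split => [x Ax|x [e [_ Ae] /= he]]; last by rewrite /= he.
by exists (h x) => //; split => //; exists x.
Qed.

Lemma strongly_measurable_comp (Y : normedModType R) (D : set R) (u : R -> Y) (phi : Y -> R) :
  measurable D -> continuous phi ->
  strongly_measurable setT (fun x y => `|x - y|) D u -> measurable_fun D (phi \o u).
Proof.
move=> mD cphi [h [_ fr mh hu]].
apply: (measurable_fun_cvg (h := fun k => phi \o h k)) => [k|x Dx].
  exact: finite_range_measurable.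
apply: cvg_comp; last exact: cphi.
by apply/subr_cvg0/norm_cvg0P; exact: hu.
Qed.

Lemma strongly_measurable_dual (Y : normedModType R) (D : set R) (phi : R -> Y -> R) (v : Y) :
  measurable D -> (forall s, in_dual (phi s)) ->
  strongly_measurable (@in_dual R Y)
        (fun l m => dual_norm (fun v => l v - m v)) D phi ->
  measurable_fun D (phi ^~ v).
Proof.
move=> mD dphi [h [dh fr mh hphi]].
apply: (measurable_fun_cvg (h := fun k => h k ^~ v)) => [k|x Dx].
  exact: (@finite_range_measurable _ (h k) (fun l => l v)).
have : dual_norm (fun v => h k x v - phi x v) * `|v| @[k --> \oo] --> 0.
  by rewrite -(mul0r `|v|); apply: cvgM; [exact: hphi|exact: cvg_cst].
move=> /cvgr0Pnorm_le H; apply/cvgrPdist_le => e e0.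
apply: filterS (H _ e0) => k; rewrite distrC; apply: le_trans.
have hd := in_dualBf (dh k x) (dphi x).
by rewrite (le_trans (dual_norm_ub hd v))// ler_norm.
Qed.

End StronglyMeasurable.

Lemma cvg_sumr {R : realType} (V : normedModType R) (T I : Type) (F : set_system T)
    (FF : Filter F) (r : seq I) (f : I -> T -> V) (l : I -> V) :
  (forall i, f i t @[t --> F] --> l i) ->
  \sum_(i <- r) f i t @[t --> F] --> \sum_(i <- r) l i.
Proof. by move=> fl; apply: cvg_big => //; exact: add_continuous. Qed.

(** The error of rounding t + M down to a multiple of 1 / N; the shift by M makes the rounded number
    nonnegative, where [Num.truncn] is the integer part. *)
Lemma quantization_error {R : realFieldType} (t M N n : R) : 0 < N ->
  n <= (t + M) * N -> (t + M) * N < n + 1 -> `|t - (n / N - M)| <= N^-1.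
Proof.
move=> N0; rewrite -ler_pdivrMr// -ltr_pdivlMr// mulrDl div1r ler_norml.
by move: (n / N) (N^-1) => x y; lra.
Qed.

(** A basis [e] together with its dual basis [c]; the last clause expresses linear independence. *)
Definition fin_coord {R : realType} (Y : normedModType R) (d : nat)
    (e : 'I_d -> Y) (c : 'I_d -> Y -> R) : Prop :=
  [/\ forall i, in_dual (c i), forall v, v = \sum_i c i v *: e i
    & forall i (x : 'I_d -> R), c i (\sum_j x j *: e j) = x i].

Section Coordinates.
Context {R : realType} {Y : normedModType R}.
Variables (d : nat) (e : 'I_d -> Y) (c : 'I_d -> Y -> R).
Hypothesis ec : fin_coord e c.
Local Notation mu := (@lebesgue_measure R).

Lemma coord_cvg (T : Type) (F : set_system T) (FF : Filter F) (u : T -> Y) (v : Y) :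
  (forall i, c i (u t) @[t --> F] --> c i v) -> u t @[t --> F] --> v.
Proof.
have [dc ce _] := ec.
move=> h; rewrite (ce v) (_ : u = fun t => \sum_i c i (u t) *: e i).
  by apply: cvg_sumr => i; apply: cvgZ; [exact: h|exact: cvg_cst].
by apply/funext => t; exact: ce.
Qed.

Lemma coord_strongly_measurable (D : set R) (g : 'I_d -> R -> R) (u : R -> Y) (M : R) :
  (forall i, measurable_fun setT (g i)) -> (forall i x, `|g i x| <= M) ->
  (forall s, D s -> u s = \sum_i g i s *: e i) ->
  strongly_measurable setT (fun x y => `|x - y|) D u.
Proof.
move=> mg gM uE.
pose fl k i s := Num.truncn ((g i s + M) * k.+1%:R).
pose K k := (Num.truncn ((M + M) * k.+1%:R)).+1.
pose code k s : {ffun 'I_d -> 'I_(K k)} := [ffun i => inord (fl k i s)].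
pose dec k (f : {ffun 'I_d -> 'I_(K k)}) : Y :=
  \sum_i ((f i)%:R / k.+1%:R - M) *: e i.
have gM0 i s : 0 <= g i s + M by have := gM i s; rewrite ler_norml; lra.
have flK k i s : (fl k i s < K k)%N.
  rewrite /K ltnS; apply: le_truncn; rewrite ler_pM2r// lerD2r.
  by have := gM i s; rewrite ler_norml; lra.
have mcode k (f : {ffun 'I_d -> 'I_(K k)}) : measurable (code k @^-1` [set f]).
  rewrite (_ : _ @^-1` _ = \bigcap_(i in [set: 'I_d])
    (g i @^-1` `[(f i)%:R / k.+1%:R - M, (f i).+1%:R / k.+1%:R - M[)).
    apply: fin_bigcap_measurable => // i _.
    by rewrite -[_ @^-1` _]setTI; apply: mg.
  have P i s : (fl k i s == f i :> nat) =
      (g i s \in `[(f i)%:R / k.+1%:R - M, (f i).+1%:R / k.+1%:R - M[).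
    rewrite in_itv/= lerBlDr ltrBrDr ler_pdivrMr// ltr_pdivlMr//.
    by rewrite /fl truncn_eq// mulr_ge0.
  apply/seteqP; split => s /=.
    move=> /ffunP H i _ /=; rewrite -P -H ffunE inordK//; exact: flK.
  move=> H; apply/ffunP => i; rewrite ffunE; apply: val_inj => /=.
  rewrite inordK; last exact: flK.
  by apply/eqP; rewrite P; exact: H.
exists (fun k => dec k \o code k); split => //.
- move=> k; apply: (@sub_finite_set _ _ (range (dec k))).
    by move=> _ [s _ <-]; exists (code k s).
  by apply: finite_image; exact: finite_finset.
- move=> k v; rewrite (_ : _ @^-1` _ =
    \bigcup_(f in [set f | dec k f = v]) code k @^-1` [set f]).
    by apply: fin_bigcup_measurable => // ; exact: finite_finset.
  apply/seteqP; split => s /=; first by move=> h; exists (code k s).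
  by move=> [f /= <- <-].
- move=> s Ds.
  have H : dec k (code k s) @[k --> \oo] --> u s.
    rewrite uE//; apply: cvg_sumr => i; apply: cvgZ; last exact: cvg_cst.
    apply/cvgrPdist_le => eps eps0.
    have : (k.+1%:R : R)^-1 @[k --> \oo] --> 0 by exact: cvg_harmonic.
    move=> /cvgr0Pnorm_le/(_ _ eps0); apply: filterS => k; apply: le_trans.
    rewrite ffunE inordK; last exact: flK.
    have /andP[h1 h2] := truncn_itv (mulr_ge0 (gM0 i s) (ler0n R k.+1)).
    rewrite [leRHS]ger0_norm ?invr_ge0//; apply: quantization_error => //.
    by move: h2; rewrite natr1.
  have /cvg_norm : dec k (code k s) - u s @[k --> \oo] --> 0.
    by apply/subr_cvg0.
  by rewrite normr0.
Qed.

End Coordinates.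

Section RintegralExtra.
Context {R : realType}.
Local Notation mu := (@lebesgue_measure R).

Lemma integrable_oo0 (a b : R) : mu.-integrable `]a, b[ (EFin \o (fun=> 0)).
Proof. exact: integrable_oo_cst. Qed.

Lemma integrable_ooD (a b : R) (f g : R -> R) :
  mu.-integrable `]a, b[ (EFin \o f) -> mu.-integrable `]a, b[ (EFin \o g) ->
  mu.-integrable `]a, b[ (EFin \o (fun x => f x + g x)).
Proof.
move=> fi gi; have := integrableD _ fi gi; move/(_ (measurable_itv _)).
by apply: eq_integrable => // x _ /=; rewrite EFinD.
Qed.

Lemma Rintegral_oo_sum (a b : R) (I : Type) (r : seq I) (F : I -> R -> R) :
  (forall i, mu.-integrable `]a, b[ (EFin \o F i)) ->
  mu.-integrable `]a, b[ (EFin \o (fun x => \sum_(i <- r) F i x)) /\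
  Rintegral mu `]a, b[ (fun x => \sum_(i <- r) F i x) =
  \sum_(i <- r) Rintegral mu `]a, b[ (F i).
Proof.
move=> iF; elim: r => [|i r [IH1 IH2]].
  rewrite big_nil; have -> : (fun x => \sum_(i <- [::]) F i x) = (fun=> 0).
    by apply/funext => x; rewrite big_nil.
  split; first exact: integrable_oo0.
  by rewrite /Rintegral integral0.
rewrite big_cons; have -> : (fun x => \sum_(j <- i :: r) F j x) =
    (fun x => F i x + \sum_(j <- r) F j x).
  by apply/funext => x; rewrite big_cons.
split; first exact: integrable_ooD.
by rewrite RintegralD// IH2.
Qed.

Lemma Rintegral_oo_dominated (a b : R) (f : nat -> R -> R) (g h : R -> R) :
  (forall n, measurable_fun `]a, b[ (f n)) -> mu.-integrable `]a, b[ (EFin \o h) ->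
  (forall n x, a < x < b -> `|f n x| <= h x) ->
  (forall x, a < x < b -> f n x @[n --> \oo] --> g x) ->
  Rintegral mu `]a, b[ (f n) @[n --> \oo] --> Rintegral mu `]a, b[ g.
Proof.
move=> mf ih fh fg.
have mg : measurable_fun `]a, b[ g.
  by apply: (measurable_fun_cvg mf) => x; rewrite /= in_itv/=; exact: fg.
have [] := @dominated_convergence _ _ _ mu `]a, b[%classic (measurable_itv _)
  (fun n => EFin \o f n) (EFin \o g) (EFin \o h).
- by move=> n; apply/measurable_EFinP; exact: mf.
- exact/measurable_EFinP.
- apply: aeW => x; rewrite /= in_itv/= => xab.
  by apply/fine_cvgP; split; [exact: nearW|exact: fg].
- exact: ih.
- apply: aeW => x n; rewrite /= in_itv/= => xab.
  by rewrite lee_fin fh.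
- move=> ig _; rewrite -[X in _ --> X]fineK ?integrable_fin_num//.
  by move=> /fine_cvg; apply.
Qed.

End RintegralExtra.

Section L1Dual.
Context {R : realType} {Y : normedModType R}.
Local Notation mu := (@lebesgue_measure R).

Lemma dual_norm_dist (l m : Y -> R) : in_dual l -> in_dual m ->
  `|dual_norm l - dual_norm m| <= dual_norm (fun v => l v - m v).
Proof.
suff H (l' m' : Y -> R) : in_dual l' -> in_dual m' ->
    dual_norm l' <= dual_norm m' + dual_norm (fun v => l' v - m' v).
  move=> hl hm; rewrite ler_norml lerBlDl H// andbT.
  rewrite lerNl opprB lerBlDl (le_trans (H _ _ hm hl))// lerD2l.
  apply: dual_norm_le; [exact: in_dualBf|exact/dual_norm_ge0/in_dualBf|].
  by move=> v; rewrite distrC; apply: (dual_norm_ub (in_dualBf hl hm)).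
move=> hl hm; have hd := in_dualBf hl hm; apply: dual_norm_le => //.
  by rewrite addr_ge0 ?dual_norm_ge0.
move=> v; rewrite -[l' v](subrK (m' v)) addrC (le_trans (ler_normD _ _))// mulrDl.
by rewrite lerD ?dual_norm_ub//; exact: (dual_norm_ub hd).
Qed.

(** The dominating function is [|v|] times the dual norm of phi. The measurability of this norm
    comes from the approximating functions of finite range, because the dual norm is 1-Lipschitz. *)
Lemma L1_dual_integrable (S : R) (phi : R -> Y -> R) (v : Y) :
  L1_dual S phi -> mu.-integrable `]0, S[ (EFin \o (fun s => phi s v)).
Proof.
move=> [dphi sphi iphi].
have mphi := strongly_measurable_dual v (measurable_itv _) dphi sphi.
have mn : measurable_fun `]0, S[ (fun s => dual_norm (phi s)).
  have [h [dh fr mh hphi]] := sphi.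
  apply: (measurable_fun_cvg (h := fun k s => dual_norm (h k s))) => [k|x Dx].
    exact: (finite_range_measurable (@dual_norm R Y)).
  apply/subr_cvg0/norm_cvg0P.
  apply: (@squeeze_cvgr _ _ _ _ (cst 0) (fun k => dual_norm (fun v => h k x v - phi x v))).
  - by apply: nearW => k; rewrite normr_ge0 dual_norm_dist.
  - exact: cvg_cst.
  - exact: hphi.
have : mu.-integrable `]0, S[ (EFin \o (fun s => `|v| * dual_norm (phi s))).
  apply: integrable_ooZ; apply/integrableP; split; first exact/measurable_EFinP.
  apply: le_lt_trans iphi; rewrite le_eqVlt; apply/orP; left; apply/eqP.
  by apply: eq_integral => x _ /=; rewrite ger0_norm// dual_norm_ge0.
apply: le_integrable => //; first exact/measurable_EFinP.
move=> x _ /=; rewrite lee_fin mulrC (le_trans (dual_norm_ub (dphi x) v))//.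
exact: ler_norm.
Qed.

(** The indicator function of ]0, s[ times l. Testing derivatives with it turns weak star
    convergence into convergence of the increments over [0, s]. *)
Definition itv_test (s : R) (l : Y -> R) (r : R) : Y -> R :=
  if 0 < r < s then l else (fun=> 0).

Lemma itv_test_L1_dual (S s : R) (l : Y -> R) : in_dual l -> L1_dual S (itv_test s l).
Proof.
move=> hl.
have h0 : in_dual (fun _ : Y => 0 : R) by split => [a u v|v]; [rewrite mulr0 addr0|exact: cvg_cst].
have dphi r : in_dual (itv_test s l r) by rewrite /itv_test; case: ifP.
have fr : finite_set (range (itv_test s l)).
  apply: (@sub_finite_set _ _ ([set l] `|` [set (fun=> 0)])).
    by move=> _ [r _ <-]; rewrite /itv_test; case: ifP => _; [left|right].
  by rewrite finite_setU; split; exact: finite_set1.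
(* The condition [l = m] below does not depend on the parameter, so it cuts out the whole line or
   nothing. *)
have mcst (P : Prop) : measurable [set r : R | P].
  have [p|np] := pselect P.
    by rewrite (_ : [set r | P] = setT)//; apply/seteqP; split.
  by rewrite (_ : [set r | P] = set0)//; apply/seteqP; split.
have mh m : measurable (itv_test s l @^-1` [set m]).
  rewrite (_ : _ @^-1` _ = (`]0, s[ `&` [set _ | l = m]) `|`
      (~` `]0, s[ `&` [set _ | (fun=> 0) = m])).
    by apply: measurableU; apply: measurableI => //; exact: measurableC.
  apply/seteqP; split => r /=; rewrite /itv_test/= in_itv/=.
    by case: ifPn => h ->; [left|right; split => //; exact/negP].
  by move=> [[-> //]|[/negP/negbTE ->]].
split => //.
  exists (fun=> itv_test s l); split => // r _.
  have -> : (fun k : nat => dual_norm (fun v => itv_test s l r v - itv_test s l r v)) = cst 0.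
    apply/funext => k /=; have hd := in_dualBf (dphi r) (dphi r).
    apply/eqP; rewrite eq_le; apply/andP; split; last exact: dual_norm_ge0.
    by apply: dual_norm_le => // v; rewrite subrr normr0 mul0r.
  exact: cvg_cst.
apply: (@le_lt_trans _ _ (\int[mu]_(x in `]0%R, S[) (dual_norm l)%:E)%E).
  apply: ge0_le_integral => //.
  - by move=> r _; rewrite lee_fin dual_norm_ge0.
  - apply/measurable_EFinP.
    exact: (finite_range_measurable (@dual_norm R Y) _ fr mh).
  - move=> r _; rewrite lee_fin /itv_test; case: ifP => // _.
    by apply: dual_norm_le => [//||v]; rewrite ?dual_norm_ge0// normr0 mulr_ge0// dual_norm_ge0.
by rewrite integral_cst//= lte_mul_pinfty ?lee_fin ?dual_norm_ge0// lebesgue_measure_oo_lty.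
Qed.

Lemma Rintegral_itv_test (S s : R) (l : Y -> R) (v : R -> Y) : 0 <= s <= S ->
  Rintegral mu `]0, S[ (fun r => itv_test s l r (v r)) =
  Rintegral mu `]0, s[ (fun r => l (v r)).
Proof.
move=> /andP[s0 sS].
have -> : `]0, s[%classic = `]0, S[ `&` `]0, s[ :> set R.
  apply/seteqP; split => r /=; rewrite !in_itv/=; last by case.
  by move=> /andP[-> rs]; rewrite rs (lt_le_trans rs).
rewrite Rintegral_mkcondr; apply: eq_Rintegral => r _.
rewrite patchE /itv_test; case: ifPn => h; first by rewrite mem_set//= in_itv.
by rewrite memNset//= in_itv/=; exact/negP.
Qed.

End L1Dual.

(** * Sobolev functions with finite-dimensional values *)

Section FiniteDimensionalTarget.
Context {R : realType} {Y : normedModType R}.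
Variables (d : nat) (e : 'I_d -> Y) (c : 'I_d -> Y -> R).
Hypothesis ec : fin_coord e c.
Local Notation mu := (@lebesgue_measure R).

Lemma coord_dual (l : Y -> R) (v : Y) : in_dual l -> l v = \sum_i c i v * l (e i).
Proof.
have [dc ce _] := ec.
move=> hl; rewrite {1}(ce v) in_dual_sum//; apply: eq_bigr => i _.
by rewrite in_dualZ.
Qed.

Lemma coord_unif_bounded : exists2 C, 0 < C & forall i v, `|c i v| <= C * `|v|.
Proof.
have [dc ce _] := ec.
have H i : {C | 0 < C & forall v, `|c i v| <= C * `|v|}.
  by apply: cid2; exact: in_dual_bounded.
exists (1 + \sum_i s2val (H i)).
  by rewrite ltr_pwDl// sumr_ge0// => i _; case: (H i) => /= C /ltW.
move=> i v; apply: (le_trans (s2valP' (H i) v)).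
rewrite ler_wpM2r// (bigD1 i)//= addrCA lerDl addr_ge0// sumr_ge0// => j _.
by case: (H j) => /= C /ltW.
Qed.

Lemma Linfty_coord (u : R -> Y) (S M : R) :
  (forall i, measurable_fun setT (c i \o u)) -> (forall i x, `|c i (u x)| <= M) ->
  Linfty S u.
Proof.
have [dc ce _] := ec.
move=> mc cM; split.
  by apply: (coord_strongly_measurable mc cM) => s _; exact: ce.
exists (\sum_i M * `|e i|); apply: aeW => s _.
rewrite [in leLHS](ce (u s)) (le_trans (ler_norm_sum _ _ _))// ler_sum// => i _.
by rewrite normrZ ler_wpM2r.
Qed.

Lemma Linfty_dual_measurable (u : R -> Y) (S : R) (l : Y -> R) :
  Linfty S u -> in_dual l -> measurable_fun `]0, S[ (l \o u).
Proof.
by move=> [su _] hl; exact: strongly_measurable_comp (measurable_itv _) hl.2 su.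
Qed.

Lemma Linfty_dual_integrable (u : R -> Y) (S : R) (l : Y -> R) :
  Linfty S u -> in_dual l -> mu.-integrable `]0, S[ (EFin \o (l \o u)).
Proof.
move=> hu hl; have ml := Linfty_dual_measurable hu hl.
have [_ [M uM]] := hu; have [C C0 lC] := in_dual_bounded hl.
apply/integrableP; split; first exact/measurable_EFinP.
apply: (@le_lt_trans _ _ (\int[mu]_(x in `]0%R, S[) `|C * M|%:E)%E).
  apply: ae_ge0_le_integral => //.
  - by apply/measurable_EFinP; apply: measurableT_comp.
  - apply: aeS uM => x ux xS; rewrite lee_fin /=.
    by rewrite (le_trans (lC _))// (le_trans _ (ler_norm _))// ler_pM2l// ux.
by rewrite integral_cst//= lte_mul_pinfty// lebesgue_measure_oo_lty.
Qed.

Variable C : R.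
Hypothesis cC : forall i v, `|c i v| <= C * `|v|.
Hypothesis C_gt0 : 0 < C.

Lemma Linfty_lipschitz (u : R -> Y) (S L : R) : 0 < S -> 0 < L ->
  (forall x y, 0 <= x <= S -> 0 <= y <= S -> `|u x - u y| <= L * `|x - y|) ->
  Linfty S u.
Proof.
move=> S0 L0 uL; have [dc ce _] := ec.
pose g i s := c i (u (clamp S s)).
have c0S x : 0 <= clamp S x <= S by exact/clamp_itv/ltW.
have gL i x y : `|g i x - g i y| <= (C * L) * `|x - y|.
  rewrite /g -in_dualB// (le_trans (cC _ _))// -mulrA ler_pM2l//.
  by rewrite (le_trans (uL _ _ (c0S x) (c0S y)))// ler_pM2l// clamp_lipschitz// ltW.
have uM x : 0 <= x <= S -> `|u x| <= `|u 0| + L * S.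
  move=> x0S; rewrite -[u x](subrK (u 0)) addrC (le_trans (ler_normD _ _))// lerD2l.
  have S00 : 0 <= (0 : R) <= S by rewrite lexx ltW.
  rewrite (le_trans (uL _ _ x0S S00))// subr0 ler_pM2l//.
  by case/andP: x0S => x0 xS; rewrite ger0_norm.
split.
  apply: (@coord_strongly_measurable _ _ _ e _ g _ (C * (`|u 0| + L * S))).
  - by move=> i; apply: continuous_measurable_fun; exact: lipschitz_continuous (gL i).
  - by move=> i x; rewrite (le_trans (cC _ _))// ler_pM2l// uM.
  - move=> s; rewrite /= in_itv/= => s0S; rewrite [LHS]ce; apply: eq_bigr => i _.
    by rewrite /g clamp_id//; lra.
exists (`|u 0| + L * S); apply: aeW => s; rewrite /= in_itv/= => s0S.
by apply: uM; lra.
Qed.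

(** The derivative is assembled from the densities that [lipschitz_primitive] gives for the
    coordinates. Their measurability and boundedness on the whole line are exported because the weak
    star convergence of derivatives is tested by coordinates. *)
Lemma W1infty_lipschitz (u : R -> Y) (S L : R) : 0 < S -> 0 < L ->
  (forall x y, 0 <= x <= S -> 0 <= y <= S -> `|u x - u y| <= L * `|x - y|) ->
  exists du, [/\ W1infty S u du,
    forall i, measurable_fun setT (c i \o du)
    & forall i x, `|c i (du x)| <= C * L].
Proof.
move=> S0 L0 uL; have [dc ce cK] := ec.
have CL0 : 0 < C * L by rewrite mulr_gt0.
have H i : {g : R -> R | [/\ measurable_fun setT g, forall x, `|g x| <= C * L
      & forall s, 0 <= s <= S -> c i (u s) = c i (u 0) + Rintegral mu `]0, s[ g]}.
  apply: cid; apply: (@lipschitz_primitive _ (c i \o u)) => // x y xS yS /=.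
  by rewrite -in_dualB// (le_trans (cC _ _))// -mulrA ler_pM2l// uL.
pose g i := sval (H i).
have mg i : measurable_fun setT (g i) by rewrite /g; case: (H i) => /= ? [].
have gM i x : `|g i x| <= C * L by rewrite /g; case: (H i) => /= ? [].
have gE i s : 0 <= s <= S -> c i (u s) = c i (u 0) + Rintegral mu `]0, s[ (g i).
  by rewrite /g; case: (H i) => /= ? [_ _]; exact.
pose du s := \sum_i g i s *: e i.
have cdu i : c i \o du = g i by apply/funext => s; rewrite /= cK.
exists du; split; last 2 first.
- by move=> i; rewrite cdu.
- by move=> i x; rewrite -[c i _]/((c i \o du) x) cdu.
split; first exact: Linfty_lipschitz uL.
  apply: (@Linfty_coord _ _ (C * L)) => [i|i x]; first by rewrite cdu.
  by rewrite -[c i _]/((c i \o du) x) cdu.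
move=> s s0S l hl.
have ig i : mu.-integrable `]0, s[ (EFin \o (fun x => g i x * l (e i))).
  apply: (@integrable_oo_mulr _ _ _ `|l (e i)| (g i) (cst (l (e i)))) => //.
  by apply: (@bounded_integrable_oo _ _ _ (C * L)) => //; exact: measurable_funTS.
have -> : Rintegral mu `]0, s[ (fun r => l (du r)) =
    Rintegral mu `]0, s[ (fun r => \sum_i g i r * l (e i)).
  apply: eq_Rintegral => r _; rewrite (coord_dual _ hl); apply: eq_bigr => i _.
  by rewrite -[c i _]/((c i \o du) r) cdu.
rewrite (Rintegral_oo_sum _ ig).2 (coord_dual _ hl) (coord_dual (u 0) hl) -big_split/=.
apply: eq_bigr => i _; rewrite gE// mulrDl; congr (_ + _).
rewrite RintegralZr//.
by apply: (@bounded_integrable_oo _ _ _ (C * L)) => //; exact: measurable_funTS.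
Qed.

Lemma weakstar_of_coord (S K : R) (u_ : nat -> R -> Y) (u : R -> Y) :
  (forall n i, measurable_fun `]0, S[ (c i \o u_ n)) ->
  (forall i, measurable_fun `]0, S[ (c i \o u)) ->
  (forall n i x, 0 < x < S -> `|c i (u_ n x)| <= K) ->
  (forall i x, 0 < x < S -> `|c i (u x)| <= K) ->
  (forall i (psi : R -> R), mu.-integrable `]0, S[ (EFin \o psi) ->
    Rintegral mu `]0, S[ (fun s => psi s * c i (u_ n s)) @[n --> \oo] -->
    Rintegral mu `]0, S[ (fun s => psi s * c i (u s))) ->
  weakstar_Linfty S u_ u.
Proof.
move=> mu_ mu0 uK uK0 H phi hphi; have [dphi _ _] := hphi.
have iphi i : mu.-integrable `]0, S[ (EFin \o (fun s => phi s (e i))).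
  exact: L1_dual_integrable.
have E (v : R -> Y) : (forall i, measurable_fun `]0, S[ (c i \o v)) ->
    (forall i x, 0 < x < S -> `|c i (v x)| <= K) ->
    Rintegral mu `]0, S[ (fun s => phi s (v s)) =
    \sum_i Rintegral mu `]0, S[ (fun s => phi s (e i) * c i (v s)).
  move=> mv vK; rewrite -(Rintegral_oo_sum _ _).2; last first.
    by move=> i; exact: integrable_oo_mulr (iphi i) (mv i) (vK i).
  apply: eq_Rintegral => s _; rewrite (coord_dual _ (dphi s)).
  by apply: eq_bigr => i _; rewrite mulrC.
rewrite (E u)//.
have -> : (fun n => Rintegral mu `]0, S[ (fun s => phi s (u_ n s))) =
    (fun n => \sum_i Rintegral mu `]0, S[ (fun s => phi s (e i) * c i (u_ n s))).
  by apply/funext => n; rewrite (E _ (mu_ n) (uK n)).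
by apply: cvg_sumr => i; exact: H.
Qed.

Lemma weakstar_of_pointwise (S K : R) (u_ : nat -> R -> Y) (u : R -> Y) :
  (forall n i, measurable_fun `]0, S[ (c i \o u_ n)) ->
  (forall n x, 0 < x < S -> `|u_ n x| <= K) ->
  (forall x, 0 < x < S -> u_ n x @[n --> \oo] --> u x) ->
  weakstar_Linfty S u_ u.
Proof.
move=> mu_ uK u_u; have [dc ce cK] := ec.
have cu i x : 0 < x < S -> c i (u_ n x) @[n --> \oo] --> c i (u x).
  by move=> xS; apply: cvg_comp (u_u _ xS) _; exact: (dc i).2.
have mcu i : measurable_fun `]0, S[ (c i \o u).
  by apply: (measurable_fun_cvg (fun n => mu_ n i)) => x; rewrite /= in_itv/=; exact: cu.
have cuK n i x : 0 < x < S -> `|c i (u_ n x)| <= C * K.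
  by move=> xS; rewrite (le_trans (cC _ _))// ler_pM2l// uK.
have cuK' i x : 0 < x < S -> `|c i (u x)| <= C * K.
  move=> xS; apply: (cvgr_to_le (cvg_norm (cu i x xS))).
  by apply: nearW => n; exact: cuK.
apply: (weakstar_of_coord mu_ mcu cuK cuK') => i psi ipsi.
apply: (Rintegral_oo_dominated (h := fun x => (C * K) * `|psi x|)).
- by move=> n; have /integrableP[/measurable_EFinP] := integrable_oo_mulr ipsi (mu_ n i) (cuK n i).
- by apply: integrable_ooZ; exact: integrable_norm.
- by move=> n x xS; rewrite normrM mulrC ler_wpM2r// cuK.
- by move=> x xS; apply: cvgM; [exact: cvg_cst|exact: cu].
Qed.

(** In each coordinate the primitive of the difference of the derivatives is a difference of
    increments of [u_ n] and [u], which tends to 0, so [weakstar_primitive] applies. *)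
Lemma weakstar_of_primitive (S K : R) (u_ du_ : nat -> R -> Y) (u du : R -> Y) :
  0 < S -> 0 < K ->
  (forall n i, measurable_fun `]0, S[ (c i \o du_ n)) ->
  (forall i, measurable_fun `]0, S[ (c i \o du)) ->
  (forall n i x, 0 < x < S -> `|c i (du_ n x)| <= K) ->
  (forall i x, 0 < x < S -> `|c i (du x)| <= K) ->
  (forall n, W1infty S (u_ n) (du_ n)) -> W1infty S u du ->
  (forall s, 0 <= s <= S -> u_ n s @[n --> \oo] --> u s) ->
  weakstar_Linfty S du_ du.
Proof.
move=> S0 K0 md_ md dK_ dK Wu_ Wu u_u; have [dc _ _] := ec.
apply: (weakstar_of_coord md_ md dK_ dK) => i psi ipsi.
pose k n x := c i (du_ n x) - c i (du x).
have ic n s : 0 <= s <= S -> mu.-integrable `]0, s[ (EFin \o (fun x => c i (du_ n x))).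
  move=> /andP[s0 sS]; apply: (@integrable_oo_sub _ 0 S) => //.
  by apply: bounded_integrable_oo (md_ n i) _; exact: dK_.
have ic' s : 0 <= s <= S -> mu.-integrable `]0, s[ (EFin \o (fun x => c i (du x))).
  move=> /andP[s0 sS]; apply: (@integrable_oo_sub _ 0 S) => //.
  by apply: bounded_integrable_oo (md i) _; exact: dK.
have mk n : measurable_fun `]0, S[ (k n) by exact: (measurable_funB (md_ n i) (md i)).
have kK n x : 0 < x < S -> `|k n x| <= K + K.
  by move=> xS; rewrite (le_trans (ler_normB _ _))// lerD ?dK_ ?dK.
have k0 s : 0 <= s <= S -> Rintegral mu `]0, s[ (k n) @[n --> \oo] --> 0.
  move=> s0S; have S00 : 0 <= (0 : R) <= S by rewrite lexx ltW.
  have -> : (fun n => Rintegral mu `]0, s[ (k n)) =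
      (fun n => (c i (u_ n s) - c i (u s)) - (c i (u_ n 0) - c i (u 0))).
    apply/funext => n; rewrite /k RintegralB//; [|exact: ic|exact: ic'].
    have [_ _ H1] := Wu_ n; have [_ _ H2] := Wu.
    by rewrite (H1 s s0S _ (dc i)) (H2 s s0S _ (dc i)); lra.
  have H r : 0 <= r <= S -> c i (u_ n r) - c i (u r) @[n --> \oo] --> 0.
    move=> r0S; rewrite -(subrr (c i (u r))); apply: cvgB; last exact: cvg_cst.
    by apply: cvg_comp (u_u _ r0S) _; exact: (dc i).2.
  by rewrite -[X in _ --> X](subrr 0); apply: cvgB; exact: H.
have := @weakstar_primitive _ S (K + K) k S0 (addr_gt0 K0 K0) mk kK k0 psi ipsi.
have Sle : 0 <= S <= S by rewrite lexx ltW.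
have -> : (fun n => Rintegral mu `]0, S[ (fun x => psi x * k n x)) =
    (fun n => Rintegral mu `]0, S[ (fun x => psi x * c i (du_ n x)) -
              Rintegral mu `]0, S[ (fun x => psi x * c i (du x))).
  apply/funext => n; rewrite -RintegralB//.
  - by apply: eq_Rintegral => x _; rewrite mulrBr.
  - exact: integrable_oo_mulr ipsi (md_ n i) (dK_ n i).
  - exact: integrable_oo_mulr ipsi (md i) (dK i).
by move=> /subr_cvg0.
Qed.

Lemma weakstar_W1infty_lipschitz (S L : R) (u_ : nat -> R -> Y) (u : R -> Y) (a : Y) :
  0 < S -> 0 < L -> (forall n, u_ n 0 = a) ->
  (forall n x y, 0 <= x <= S -> 0 <= y <= S -> `|u_ n x - u_ n y| <= L * `|x - y|) ->
  (forall s, 0 <= s <= S -> u_ n s @[n --> \oo] --> u s) ->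
  weakstar_W1infty S u_ u.
Proof.
move=> S0 L0 u0 uL u_u; have [dc _ _] := ec.
have S00 : 0 <= (0 : R) <= S by rewrite lexx ltW.
have uL' x y : 0 <= x <= S -> 0 <= y <= S -> `|u x - u y| <= L * `|x - y|.
  move=> xS yS; apply: (cvgr_to_le (cvg_norm (cvgB (u_u _ xS) (u_u _ yS)))).
  by apply: nearW => n; exact: uL.
have H n := cid (W1infty_lipschitz S0 L0 (uL n)).
have [du [Wdu mdu duL]] := W1infty_lipschitz S0 L0 uL'.
exists (fun n => sval (H n)), du; split => //.
- by move=> n; case: (H n) => /= ? [].
- apply: (@weakstar_of_pointwise _ (`|a| + L * S)) => [n i|n x xS|x xS].
  + have [Wn _ _] := svalP (H n); case: Wn => lu _ _.
    exact: Linfty_dual_measurable lu (dc i).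
  + have {}xS : 0 <= x <= S by case/andP: xS => x0 xS; rewrite !ltW.
    rewrite -[u_ n x](subrK (u_ n 0)) addrC u0 (le_trans (ler_normD _ _))// lerD2l.
    rewrite -(u0 n) (le_trans (uL n _ _ xS S00))// subr0 ler_pM2l//.
    by case/andP: xS => x0 xS; rewrite ger0_norm.
  + by apply: u_u; case/andP: xS => x0 xS; rewrite !ltW.
- apply: (@weakstar_of_primitive _ (C * L) u_ _ u) => //.
  + by rewrite mulr_gt0.
  + by move=> n i; apply: measurable_funTS; case: (H n) => /= ? [].
  + by move=> i; apply: measurable_funTS; exact: mdu.
  + by move=> n i x _; case: (H n) => /= ? [].
  + by move=> n; case: (H n) => /= ? [].
Qed.

End FiniteDimensionalTarget.

Section WeakStarPointwise.
Context {R : realType} {Y : normedModType R}.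
Local Notation mu := (@lebesgue_measure R).

(** Convergence of the derivatives only gives convergence of the increments from 0. The initial
    value of the limit is recovered from the weak star convergence of the functions themselves: the
    integral of [l (u_ n)] over ]0, S[ has two limits, which differ by [(l a - l (u 0)) * S]. *)
Lemma weakstar_W1infty_pointwise (S K : R) (u_ : nat -> R -> Y) (u : R -> Y) (a : Y)
    (l : Y -> R) : 0 < S -> in_dual l -> (forall n, u_ n 0 = a) ->
  (forall n x, 0 < x < S -> `|u_ n x| <= K) -> weakstar_W1infty S u_ u ->
  forall s, 0 <= s <= S -> l (u_ n s) @[n --> \oo] --> l (u s).
Proof.
move=> S0 hl u0 uK [du_ [du [Wu_ Wu wu wdu]]].
have [C C0 lC] := in_dual_bounded hl.
have SS : 0 <= S <= S by rewrite lexx ltW.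
have cvg_diff s : 0 <= s <= S -> l (u_ n s) @[n --> \oo] --> l a + (l (u s) - l (u 0)).
  move=> sS; have := wdu _ (itv_test_L1_dual S s hl).
  rewrite (Rintegral_itv_test _ _ sS); under eq_fun do rewrite (Rintegral_itv_test _ _ sS).
  have -> : (fun n => Rintegral mu `]0, s[ (fun r => l (du_ n r))) =
      (fun n => l (u_ n s) - l a).
    by apply/funext => n; have [_ _ ->] := Wu_ n; rewrite // u0 addrC addKr.
  have -> : Rintegral mu `]0, s[ (fun r => l (du r)) = l (u s) - l (u 0).
    by have [_ _ ->] := Wu; rewrite // addrC addKr.
  move=> H; have -> : (fun n => l (u_ n s)) = (fun n => l a + (l (u_ n s) - l a)).
    by apply/funext => n; rewrite addrC subrK.
  by apply: cvgD; [exact: cvg_cst|exact: H].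
suff E : l a = l (u 0).
  move=> s /cvg_diff; rewrite -E (_ : l a + (l (u s) - l a) = l (u s))//.
  by rewrite addrC subrK.
have iu : mu.-integrable `]0, S[ (EFin \o (l \o u)).
  by have [lu _ _] := Wu; exact: Linfty_dual_integrable lu hl.
have H1 := wu _ (itv_test_L1_dual S S hl).
rewrite (Rintegral_itv_test _ _ SS) in H1; move: H1.
under eq_fun do rewrite (Rintegral_itv_test _ _ SS); move=> H1.
have H2 : Rintegral mu `]0, S[ (fun r => l (u_ n r)) @[n --> \oo] -->
    Rintegral mu `]0, S[ (fun r => (l a - l (u 0)) + l (u r)).
  apply: (Rintegral_oo_dominated (h := fun=> C * K)).
  - by move=> n; have [lu _ _] := Wu_ n; exact: Linfty_dual_measurable lu hl.
  - exact: integrable_oo_cst.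
  - by move=> n x xS; rewrite (le_trans (lC _))// ler_pM2l// uK.
  - move=> x /andP[x0 xS]; rewrite addrAC -addrA.
    by apply: cvg_diff; rewrite !ltW.
have E : Rintegral mu `]0, S[ (fun r => l (u r)) =
    Rintegral mu `]0, S[ (fun r => (l a - l (u 0)) + l (u r)).
  by apply: cvg_unique H1 H2; exact: norm_hausdorff.
move: E; rewrite [RHS]RintegralD//; last exact: (integrable_oo_cst 0 S).
rewrite Rintegral_oo_cst ?ltW// subr0 => E.
have /eqP : (l a - l (u 0)) * S = 0 by lra.
by rewrite mulf_eq0 (gt_eqF S0) orbF subr_eq0 => /eqP.
Qed.

End WeakStarPointwise.

(** * Finite-dimensionality of the state space *)

Section OrthonormalBasis.
Import finmap.
Context {R : realType} {V : normedModType R}.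
Variable B : V -> V -> R.
Hypothesis BD : forall u, in_dual (B u).
Hypothesis BC : forall u v, B u v = B v u.
Variables (a M : R).
Hypothesis a_gt0 : 0 < a.
Hypothesis Bcoer : forall u, a * `|u| ^+ 2 <= B u u.
Hypothesis M_gt0 : 0 < M.
Hypothesis Bbnd : forall u, B u u <= M * `|u| ^+ 2.

Definition orthonormal_family n (e : 'I_n -> V) := forall i j, B (e i) (e j) = (i == j)%:R.

Let BDl u v w : B (u + v) w = B u w + B v w.
Proof. by rewrite BC in_dualD// BC (BC w). Qed.

Let BZl k u w : B (k *: u) w = k * B u w.
Proof. by rewrite BC in_dualZ// BC. Qed.

Let BBl u v w : B (u - v) w = B u w - B v w.
Proof. by rewrite BC in_dualB// BC (BC w). Qed.

Let Bsuml n (F : 'I_n -> V) w : B (\sum_i F i) w = \sum_i B (F i) w.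
Proof. by rewrite BC in_dual_sum//; apply: eq_bigr => i _; rewrite BC. Qed.

Lemma orthonormal_coef n (e : 'I_n -> V) (x : 'I_n -> R) i :
  orthonormal_family e -> B (\sum_j x j *: e j) (e i) = x i.
Proof.
move=> oe; rewrite Bsuml (bigD1 i)//= BZl oe eqxx mulr1 big1 ?addr0// => j ji.
by rewrite BZl oe (negbTE ji) mulr0.
Qed.

(** One Gram-Schmidt step: the residual of v after projection is nonzero, and normalizing it gives
    the new vector. *)
Lemma orthonormal_extend n (e : 'I_n -> V) (v : V) : orthonormal_family e ->
  v != \sum_i B v (e i) *: e i -> exists e' : 'I_n.+1 -> V, orthonormal_family e'.
Proof.
move=> oe ve; pose w := v - \sum_i B v (e i) *: e i.
have w0 : w != 0 by rewrite subr_eq0.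
have we i : B w (e i) = 0.
  by rewrite /w BDl -scaleN1r BZl (orthonormal_coef _ _ oe) mulN1r subrr.
have Bw0 : 0 < B w w.
  by apply: lt_le_trans (Bcoer w); rewrite mulr_gt0// exprn_gt0// normr_gt0.
pose w' := (Num.sqrt (B w w))^-1 *: w.
have w'w' : B w' w' = 1.
  rewrite /w' BZl in_dualZ// mulrA -invfM -expr2 sqr_sqrtr; last exact: ltW.
  by rewrite mulVf// gt_eqF.
have w'e i : B w' (e i) = 0 by rewrite /w' BZl we mulr0.
exists (fun i => if unlift ord_max i is Some j then e j else w') => i j.
case: (unliftP ord_max i) => [i'|] ->; case: (unliftP ord_max j) => [j'|] ->.
- by rewrite oe (inj_eq (@lift_inj _ _)).
- by rewrite BC w'e eq_sym (negbTE (neq_lift _ _)).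
- by rewrite w'e (negbTE (neq_lift _ _)).
- by rewrite w'w' eqxx.
Qed.

(* Small multiples of the vectors of an orthonormal family, moved to x0, lie in K and are
   uniformly separated, whereas finitely many small balls cover K. *)
Lemma orthonormal_bounded (K : set V) (x0 : V) (r : R) : compact K -> 0 < r ->
  ball x0 r `<=` K ->
  exists m, forall n (e : 'I_n -> V), orthonormal_family e -> (n <= m)%N.
Proof.
move=> cK r0 rK.
have sa : 0 < Num.sqrt a by rewrite sqrtr_gt0.
have sM : 0 < Num.sqrt M by rewrite sqrtr_gt0.
(* Coercivity gives [|e i|] <= 1 / sqrt a, so [rho *: e i] has norm at most r / 2. Since the form
   takes the value 2 at [e i - e j], the norm of this difference exceeds 1 / sqrt M, and the moved
   points are more than 2 [eps] apart. *)
pose rho := r / 2 * Num.sqrt a.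
have rho0 : 0 < rho by rewrite mulr_gt0// divr_gt0.
pose eps := rho / (2 * Num.sqrt M).
have eps0 : 0 < eps by rewrite divr_gt0// mulr_gt0.
have := cK; rewrite compact_cover => /(_ V K (fun x => ball x eps)) [].
- by move=> x _; exact: ball_open.
- by move=> x Kx; exists x => //; exact: ballxx.
move=> D DK Kcov; exists #|{: D}|; move=> n e oe.
have e1 i : Num.sqrt a * `|e i| <= 1.
  rewrite -(@ler_pXn2r _ 2)// ?nnegrE ?mulr_ge0 ?sqrtr_ge0//.
  rewrite exprMn sqr_sqrtr; last exact: ltW.
  by rewrite expr1n (le_trans (Bcoer _))// oe eqxx.
pose p i := x0 + rho *: e i.
have pK i : K (p i).
  apply: rK; rewrite -ball_normE /ball_/= /p opprD addrA subrr add0r normrN normrZ gtr0_norm//.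
  rewrite /rho -(mulrA (r / 2)) (@le_lt_trans _ _ (r / 2))//; last by rewrite ltr_pdivrMr// ltr_pMr// ltr1n.
  by rewrite ler_piMr// ltW// divr_gt0.
have pe i j : i != j -> 2 * eps < `|p i - p j|.
  move=> ij; rewrite /p opprD addrACA subrr add0r -scalerBr normrZ gtr0_norm//.
  have -> : 2 * eps = rho * (Num.sqrt M)^-1.
    by rewrite /eps; field; rewrite gt_eqF.
  rewrite ltr_pM2l//.
  have : B (e i - e j) (e i - e j) = 2.
    rewrite in_dualB// !BBl !oe !eqxx (negbTE ij) eq_sym (negbTE ij) /=.
    by rewrite subr0 sub0r opprK.
  move=> H; have := Bbnd (e i - e j); rewrite H => Hb.
  rewrite -(@ltr_pXn2r _ 2)// ?nnegrE ?invr_ge0 ?sqrtr_ge0//.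
  rewrite exprVn sqr_sqrtr; last exact: ltW.
  rewrite -(ltr_pM2l M_gt0) divff ?gt_eqF//.
  by apply: lt_le_trans Hb; rewrite ltr1n.
have H i : exists x : D, ball (val x) eps (p i).
  have [x /= xD px] := Kcov _ (pK i).
  by exists (FSetSub xD).
have [f fp] := choice H.
rewrite -(card_ord n); apply: (@leq_card _ _ f) => i j fij.
apply/eqP; apply: contraT => /pe; rewrite ltNge => /negP; case.
have := fp i; have := fp j; rewrite -fij -ball_normE /ball_/= => h1 h2.
rewrite (le_trans (ler_distD (val (f i)) _ _))// mulr2n mulrDl mul1r.
by rewrite lerD// ltW// distrC.
Qed.

(** An orthonormal family of maximal size spans, since otherwise it could be extended. *)
Lemma orthonormal_basis (K : set V) (x0 : V) (r : R) : compact K -> 0 < r ->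
  ball x0 r `<=` K ->
  exists n (e : 'I_n -> V), orthonormal_family e /\
    forall v, v = \sum_i B v (e i) *: e i.
Proof.
move=> cK r0 rK; have [m mP] := orthonormal_bounded cK r0 rK.
pose Q n := `[< exists e : 'I_n -> V, orthonormal_family e >].
have Q0 : exists n, Q n.
  by exists 0%N; apply/asboolP; exists (fun=> 0) => -[].
have Qm n : Q n -> (n <= m)%N by move=> /asboolP[e /mP].
case: (ex_maxnP Q0 Qm) => n /asboolP[e oe] nmax.
exists n, e; split => // v; apply/eqP; apply: contraT => ve.
have /asboolP/nmax := orthonormal_extend oe ve.
by rewrite ltnn.
Qed.

End OrthonormalBasis.

Section BaireBall.
Context {R : realType} {V : completeNormedModType R}.

Lemma compact_scale (K : set V) (k : R) : compact K -> compact ((fun v => k *: v) @` K).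
Proof.
move=> cK; apply: continuous_compact => //; apply: continuous_subspaceT => v.
by apply: cvgZ; [exact: cvg_cst|exact: cvg_id].
Qed.

(* The compact sets n K cover V: by Baire, one of them has an interior point. *)
Lemma compact_absorbing_ball (K : set V) : compact K ->
  (forall v, exists (n : nat) k, K k /\ v = n%:R *: k) ->
  exists (K' : set V) x0 r, [/\ compact K', 0 < r & ball x0 r `<=` K'].
Proof.
move=> cK abs.
pose Kn n := (fun v : V => n%:R *: v) @` K.
have cKn n : compact (Kn n) by exact: compact_scale.
have [[n nd]|H] := pselect (exists n, ~ dense (~` Kn n)); last first.
  have dK n : dense (~` Kn n) by apply: contrapT => h; apply: H; exists n.
  have oK n : open (~` Kn n).
    by apply: closed_openC; apply: compact_closed => //; exact: norm_hausdorff.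
  have T0 : [set: V] !=set0 by exists 0.
  have [v [_ Kv]] := @Baire R V (fun n => ~` Kn n) (fun n => conj (oK n) (dK n)) setT T0 openT.
  have [n [k [Kk vE]]] := abs v.
  by exfalso; apply: (Kv n I); exists k.
move: nd => /existsNP[U /not_implyP[[x Ux] /not_implyP[oU HU]]].
have /nbhs_ballP[/= r r0 rU] : nbhs x U by exact: open_nbhs_nbhs.
exists (Kn n), x, r; split => // y /rU Uy; apply: contrapT => Ky.
by apply: HU; exists y.
Qed.
End BaireBall.

(** * The norm given by [VV] and a common basis of Z and V *)

Section FiniteDimension.
Context {R : realType} {Z W V X : completeNormedModType R}.
Variable P : ris_data Z W V X.
Hypothesis hP : assumptions P.
Hypothesis hZV : Z_eq_V P.

Let hsp := as_space hP.

Lemma iZVD u v : iZV P (u + v) = iZV P u + iZV P v.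
Proof. by rewrite /iZV !raddfD. Qed.

Lemma iZVZ k u : iZV P (k *: u) = k *: iZV P u.
Proof. by rewrite /iZV !linearZ. Qed.

Lemma iZVN u : iZV P (- u) = - iZV P u.
Proof. by rewrite /iZV !raddfN. Qed.

Lemma iZVB u v : iZV P (u - v) = iZV P u - iZV P v.
Proof. by rewrite iZVD iZVN. Qed.

Lemma iZV_sum n (F : 'I_n -> Z) : iZV P (\sum_i F i) = \sum_i iZV P (F i).
Proof. by rewrite /iZV !raddf_sum. Qed.

Lemma iZV_inj : injective (iZV P).
Proof. by move=> u v /(sp_injWV hsp)/(sp_injZW hsp). Qed.

Lemma iZV_continuous : continuous (iZV P).
Proof.
by move=> z; apply: (@continuous_comp _ _ _ (iZW P) (iWV P));
  [exact: sp_contZW|exact: sp_contWV].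
Qed.

Lemma VV_dual u : in_dual (VV P u).
Proof. by have [] := sp_VVop hsp. Qed.

Lemma VV_sym u v : VV P u v = VV P v u.
Proof. exact: (sp_VVsym hsp). Qed.

Lemma VVDl u v w : VV P (u + v) w = VV P u w + VV P v w.
Proof. by rewrite VV_sym in_dualD ?(VV_sym w)//; exact: VV_dual. Qed.

Lemma VVZl k u w : VV P (k *: u) w = k * VV P u w.
Proof. by rewrite VV_sym in_dualZ ?(VV_sym w)//; exact: VV_dual. Qed.

Lemma VVBl u v w : VV P (u - v) w = VV P u w - VV P v w.
Proof. by rewrite VV_sym in_dualB ?(VV_sym w)//; exact: VV_dual. Qed.

Lemma VV_lower : exists2 a, 0 < a & forall u, a * `|u| ^+ 2 <= VV P u u.
Proof. exact: (sp_VVcoer hsp). Qed.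

Lemma VV_upper : exists2 M, 0 < M & forall u, VV P u u <= M * `|u| ^+ 2.
Proof.
have [_ _ [M MP]] := sp_VVop hsp; exists (`|M| + 1); first by rewrite ltr_wpDl.
move=> u; rewrite (le_trans (ler_norm _))// (le_trans (MP _ _))//.
rewrite -mulrA -expr2 ler_wpM2r ?exprn_ge0//.
by rewrite (le_trans (ler_norm _))// lerDl.
Qed.

Lemma VV_ge0 u : 0 <= VV P u u.
Proof.
have [a a0 H] := VV_lower; apply: le_trans (H u).
by rewrite mulr_ge0 ?exprn_ge0// ltW.
Qed.

Lemma VV_eq0 u : VV P u u = 0 -> u = 0.
Proof.
have [a a0 H] := VV_lower; move=> uu; have := H u; rewrite uu => h.
have : a * `|u| ^+ 2 == 0 by rewrite eq_le h mulr_ge0 ?exprn_ge0// ltW.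
by rewrite mulf_eq0 gt_eqF//= expf_eq0/= normr_eq0 => /eqP.
Qed.

Lemma normV_sqr v : normV P v ^+ 2 = VV P v v.
Proof. by rewrite /normV sqr_sqrtr// VV_ge0. Qed.

Lemma normV_ge0 v : 0 <= normV P v.
Proof. exact: sqrtr_ge0. Qed.

Lemma normVZ k v : normV P (k *: v) = `|k| * normV P v.
Proof.
rewrite /normV VVZl (in_dualZ _ _ (VV_dual v)).
by rewrite mulrA -expr2 sqrtrM ?sqr_ge0// sqrtr_sqr.
Qed.

Lemma VV_CauchySchwarz u v : `|VV P u v| <= normV P u * normV P v.
Proof.
have [vv|vv] := eqVneq (VV P v v) 0.
  by rewrite (VV_eq0 vv) (in_dual0 (VV_dual _)) normr0 mulr_ge0 ?normV_ge0.
have p0 : 0 < VV P v v by rewrite lt_neqAle eq_sym vv VV_ge0.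
set p := VV P v v in p0; set q := VV P u v.
have : 0 <= VV P (p *: u - q *: v) (p *: u - q *: v) by exact: VV_ge0.
rewrite (in_dualB _ _ (VV_dual _)).
rewrite !VVBl !VVZl !(in_dualZ _ _ (VV_dual _)) (VV_sym v u) -/p -/q => H.
have {}H : q ^+ 2 <= VV P u u * p.
  rewrite -subr_ge0 -(pmulr_rge0 _ p0); move: H; rewrite expr2.
  by congr (_ <= _); ring.
rewrite -(@ler_pXn2r _ 2)// ?nnegrE ?mulr_ge0 ?normV_ge0//.
by rewrite exprMn !normV_sqr real_normK ?num_real.
Qed.

Lemma normV_le_add u v : normV P (u + v) <= normV P u + normV P v.
Proof.
rewrite -(@ler_pXn2r _ 2)// ?nnegrE ?addr_ge0 ?normV_ge0//.
rewrite normV_sqr (in_dualD _ _ (VV_dual _)).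
rewrite !VVDl sqrrD !normV_sqr (VV_sym v u).
by have := le_trans (ler_norm _) (VV_CauchySchwarz u v); rewrite mulr2n; lra.
Qed.

(** The norm of the scheme, read on Z; speed, arc length and the distance function are all measured
    with it. *)
Definition nv (z : Z) := normV P (iZV P z).

Lemma nvE z : nv z = normV P (iZV P z). Proof. by []. Qed.
Lemma nv_ge0 z : 0 <= nv z. Proof. exact: normV_ge0. Qed.
Lemma nvZ k z : nv (k *: z) = `|k| * nv z. Proof. by rewrite /nv iZVZ normVZ. Qed.
Lemma nvD u v : nv (u + v) <= nv u + nv v.
Proof. by rewrite /nv iZVD normV_le_add. Qed.
Lemma nv0 : nv 0 = 0. Proof. by rewrite -(scale0r 0) nvZ normr0 mul0r. Qed.
Lemma nvN z : nv (- z) = nv z. Proof. by rewrite -scaleN1r nvZ normrN1 mul1r. Qed.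

(** Every v comes from some z, and z / n lies in the unit ball of Z once n > [|z|]. The image in V
    of the relatively compact unit ball is therefore absorbing. *)
Lemma absorbing v : exists (n : nat) k,
  (iWV P @` closure (iZW P @` [set z | `|z| <= 1])) k /\ v = n%:R *: k.
Proof.
have [z <-] := hZV v.
pose n := (Num.truncn `|z|).+1; have n0 : 0 < n%:R :> R by rewrite ltr0n.
exists n, (iZV P (n%:R^-1 *: z)); split; last first.
  by rewrite -iZVZ scalerA divff ?gt_eqF// scale1r.
exists (iZW P (n%:R^-1 *: z)) => //; apply: subset_closure; exists (n%:R^-1 *: z) => //=.
by rewrite normrZ gtr0_norm ?invr_gt0// mulrC ler_pdivrMr// mul1r ltW// truncnS_gt.
Qed.

(** The preimages [b] of the orthonormal basis [e] form a basis of Z with the same coordinate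
    functionals, which later transports maps from V back to Z. The compact set with an interior ball
    is returned too, since compactness of the balls of Z is deduced from it. *)
Lemma finite_dimension : exists (n : nat) (e : 'I_n -> V) (b : 'I_n -> Z) (K : set V) x0 r,
  [/\ orthonormal_family (VV P) e, forall i, iZV P (b i) = e i,
      fin_coord e (fun i v => VV P v (e i)),
      fin_coord b (fun i z => VV P (iZV P z) (e i))
    & [/\ compact K, 0 < r & ball x0 r `<=` K]].
Proof.
have cK : compact (iWV P @` closure (iZW P @` [set z | `|z| <= 1])).
  apply: continuous_compact; last exact: (sp_compactZW hsp).
  by apply: continuous_subspaceT; exact: (sp_contWV hsp).
have [K [x0 [r [cK' r0 rK]]]] := compact_absorbing_ball cK absorbing.
have [a a0 lo] := VV_lower; have [M M0 up] := VV_upper.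
have [n [e [oe ex]]] := orthonormal_basis VV_dual VV_sym a0 lo M0 up cK' r0 rK.
have [b be] := choice (fun i => hZV (e i)).
have VVe i : in_dual (fun v => VV P v (e i)).
  have E : (fun v => VV P v (e i)) = VV P (e i) by apply/funext => v; exact: VV_sym.
  by rewrite E; exact: VV_dual.
exists n, e, b, K, x0, r; split => //.
- split; [exact: VVe|exact: ex|move=> i x].
  exact: (orthonormal_coef VV_dual VV_sym _ _ oe).
- split.
  + move=> i; split.
      by move=> k u v; rewrite iZVD iZVZ VVDl VVZl.
    move=> z; apply: (@continuous_comp _ _ _ (iZV P) (fun v => VV P v (e i))).
      exact: iZV_continuous.
    exact: (VVe i).2.
  + move=> z; apply: iZV_inj; rewrite iZV_sum [LHS]ex.
    by apply: eq_bigr => i _; rewrite iZVZ be.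
  + move=> i x; rewrite iZV_sum; under eq_bigr do rewrite iZVZ be.
    exact: (orthonormal_coef VV_dual VV_sym _ _ oe).
Qed.

End FiniteDimension.

(** * The dissipation and the distance to the stable set *)

Section Dissipation.
Context {R : realType} {Z W V X : completeNormedModType R}.
Variable P : ris_data Z W V X.
Hypothesis hP : assumptions P.
Hypothesis hZV : Z_eq_V P.

Let hsp := as_space hP.
Let hds := as_dis hP.
Local Notation nv := (nv P).

Lemma nv_equiv : exists2 C, 0 < C & forall z, `|z| <= C * nv z /\ nv z <= C * `|z|.
Proof.
have [n [e [b [K [x0 [r [oe be fe fb _]]]]]]] := finite_dimension hP hZV.
have [C C0 cC] := coord_unif_bounded fb.
have [_ ez _] := fb.
have ne i : normV P (e i) = 1.
  by rewrite /normV oe eqxx sqrtr1.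
have ci z i : `|VV P (iZV P z) (e i)| <= nv z.
  by rewrite (le_trans (VV_CauchySchwarz hP _ _))// ne mulr1.
exists (1 + C * n%:R + \sum_i `|b i|).
  by rewrite ltr_pwDl ?sumr_ge0// ltr_pwDl// mulr_ge0// ltW.
move=> z; split.
  rewrite {1}(ez z) (le_trans (ler_norm_sum _ _ _))//.
  apply: (@le_trans _ _ (\sum_i `|b i| * nv z)).
    by apply: ler_sum => i _; rewrite normrZ mulrC ler_wpM2l.
  rewrite -mulr_suml ler_wpM2r ?nv_ge0// lerDr addr_ge0// mulr_ge0//; exact: ltW.
have nb i : nv (b i) = 1 by rewrite /nv be ne.
have nvs (F : 'I_n -> Z) : nv (\sum_i F i) <= \sum_i nv (F i).
  elim/big_ind2 : _ => [||//]; first by rewrite nv0.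
  by move=> x1 x2 y1 y2 h1 h2; rewrite (le_trans (nvD hP _ _))// lerD.
rewrite {1}(ez z) (le_trans (nvs _))//.
apply: (@le_trans _ _ (\sum_(i < n) C * `|z|)).
  by apply: ler_sum => i _; rewrite nvZ// nb mulr1 cC.
rewrite sumr_const card_ord -[X in X <= _]mulr_natr [leLHS]mulrAC ler_wpM2r//.
by rewrite addrAC lerDr addr_ge0// sumr_ge0.
Qed.

Lemma nv_lipschitz u v : `|nv u - nv v| <= nv (u - v).
Proof.
suff H (x y : Z) : nv x <= nv y + nv (x - y).
  by rewrite ler_norml lerBlDl H andbT lerNl opprB lerBlDl -(nvN hP (u - v)) opprB H.
by have := nvD hP y (x - y); rewrite addrC subrK.
Qed.

Lemma continuous_of_nv (f : Z -> R) (C : R) :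
  (forall u v, `|f u - f v| <= C * nv (u - v)) -> continuous f.
Proof.
move=> fC; have [D D0 DP] := nv_equiv.
move=> u; apply/cvgrPdist_le => eps eps0.
have C1 : 0 < (`|C| + 1) * D by rewrite mulr_gt0// ltr_wpDl.
near=> v; rewrite (le_trans (fC _ _))//.
apply: (@le_trans _ _ ((`|C| + 1) * D * `|u - v|)).
  rewrite -mulrA (@le_trans _ _ ((`|C| + 1) * nv (u - v)))//.
    by rewrite ler_wpM2r ?nv_ge0// (le_trans (ler_norm _))// lerDl.
  by rewrite ler_wpM2l ?addr_ge0//; have [] := DP (u - v).
rewrite mulrC -ler_pdivlMr//; near: v.
by apply: cvgr_dist_le; [exact: cvg_id|exact: divr_gt0].
Unshelve. all: by end_near. Qed.

Lemma nv_continuous : continuous nv.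
Proof. by apply: (@continuous_of_nv _ 1) => u v; rewrite mul1r nv_lipschitz. Qed.

(** The map [j] inflates [K] around x0 by the factor [k] and reads the result in Z through
    coordinates. The factor is chosen with r k = 2 ([|rho|] + 1) / sqrt a, larger than the V-norm of
    any point of the ball, so the image of [K] contains the ball as a closed subset. *)
Lemma compact_nv_ball rho : compact [set z : Z | nv z <= rho].
Proof.
have [n [e [b [K [x0 [r [oe be fe fb [cK r0 rK]]]]]]]] := finite_dimension hP hZV.
have [a a0 lo] := VV_lower hP.
have sa : 0 < Num.sqrt a by rewrite sqrtr_gt0.
have lo' v : `|v| <= normV P v / Num.sqrt a.
  rewrite ler_pdivlMr// -(@ler_pXn2r _ 2)// ?nnegrE ?mulr_ge0 ?sqrtr_ge0//.
  by rewrite exprMn sqr_sqrtr ?(ltW a0)// (normV_sqr hP) mulrC.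
pose k := (`|rho| + 1) / Num.sqrt a / (r / 2).
have k0 : 0 < k by rewrite /k !divr_gt0// ltr_wpDl.
pose j (v : V) : Z := \sum_i VV P (k *: (v - x0)) (e i) *: b i.
have jc : continuous j.
  move=> v; rewrite /j; apply: cvg_sumr => i; apply: cvgZ; last exact: cvg_cst.
  apply: (@continuous_comp _ _ _ (fun v => k *: (v - x0)) (fun v => VV P v (e i))).
    by apply: cvgZ; [exact: cvg_cst|apply: cvgB; [exact: cvg_id|exact: cvg_cst]].
  have [dc _ _] := fe; exact: (dc i).2.
apply: (@subclosed_compact _ _ (j @` K)).
- rewrite (_ : [set z | _] = nv @^-1` [set x | x <= rho])//.
  by apply: closed_comp; [move=> ? _; exact: nv_continuous|exact: closed_le].
- by apply: continuous_compact => //; exact: continuous_subspaceT.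
- move=> z /= zrho; exists (x0 + k^-1 *: iZV P z).
    apply: rK; rewrite -ball_normE /ball_/= opprD addrA subrr add0r normrN normrZ.
    rewrite gtr0_norm ?invr_gt0// mulrC ltr_pdivrMr//.
    apply: (le_lt_trans (lo' _)).
    have -> : r * k = 2 * ((`|rho| + 1) / Num.sqrt a).
      by rewrite /k; field; rewrite !gt_eqF.
    rewrite mulrA ltr_pM2r ?invr_gt0// (le_lt_trans zrho)//.
    by rewrite (le_lt_trans (ler_norm _))//; have := normr_ge0 rho; lra.
  have E : k *: (x0 + k^-1 *: iZV P z - x0) = iZV P z.
    by rewrite addrAC subrr add0r scalerA divff ?gt_eqF// scale1r.
  by rewrite /j E; have [_ <- _] := fb.
Qed.

Definition Rd (z : Z) := dis P (iZX P z).

Lemma iZXD u v : iZX P (u + v) = iZX P u + iZX P v.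
Proof. by rewrite /iZX iZVD raddfD. Qed.

Lemma iZXZ k u : iZX P (k *: u) = k *: iZX P u.
Proof. by rewrite /iZX iZVZ linearZ. Qed.

Lemma Rd_ge0 z : 0 <= Rd z. Proof. exact: (dis_ge0 hds). Qed.

Lemma Rd0 : Rd 0 = 0.
Proof.
have := dis_hom hds (iZX P 0) (ltr0Sn R 1); rewrite -iZXZ scaler0 -/(Rd 0).
lra.
Qed.

Lemma RdZ k z : 0 <= k -> Rd (k *: z) = k * Rd z.
Proof.
rewrite le_eqVlt => /predU1P[<-|k0]; first by rewrite scale0r mul0r Rd0.
by rewrite /Rd iZXZ (dis_hom hds).
Qed.

Lemma RdD u v : Rd (u + v) <= Rd u + Rd v.
Proof.
have h2 : 0 <= (2^-1 : R) <= 1 by rewrite invr_ge0 ler0n invf_le1// ler1n.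
have := dis_convex hds (iZX P u) (iZX P v) h2.
rewrite (_ : 1 - 2^-1 = 2^-1 :> R); last by lra.
rewrite -scalerDr (dis_hom hds) ?invr_gt0// -mulrDr ler_pM2l ?invr_gt0//.
by rewrite -iZXD.
Qed.

Lemma Rd_upper : exists2 C, 0 < C & forall z, Rd z <= C * nv z.
Proof.
have [c [C [c0 C0 H]]] := dis_bounds hds; have [a a0 lo] := VV_lower hP.
have sa : 0 < Num.sqrt a by rewrite sqrtr_gt0.
exists (C / Num.sqrt a); first by rewrite divr_gt0.
move=> z; have /andP[_] := H (iZV P z); move=> /le_trans; apply.
rewrite -mulrA ler_pM2l// mulrC ler_pdivlMr//.
rewrite -(@ler_pXn2r _ 2)// ?nnegrE ?mulr_ge0 ?sqrtr_ge0// ?nv_ge0//.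
by rewrite exprMn sqr_sqrtr ?(ltW a0)// (normV_sqr hP) mulrC.
Qed.

Lemma Rd_continuous : continuous Rd.
Proof.
have [C C0 RC] := Rd_upper.
have H u v : Rd u - Rd v <= C * nv (u - v).
  by rewrite lerBlDl (le_trans _ (lerD (lexx _) (RC _)))// -{1}(subrK v u) addrC RdD.
apply: (@continuous_of_nv _ C) => u v; rewrite ler_norml H andbT.
by rewrite lerNl opprB -(nvN hP (u - v)) opprB.
Qed.

Lemma nv_eq0 z : nv z = 0 -> z = 0.
Proof.
have [C C0 H] := nv_equiv; move=> z0; have [+ _] := H z.
by rewrite z0 mulr0 normr_le0 => /eqP.
Qed.

(** The minimum of the dissipation on the compact unit sphere is positive: the lower bound by the
    norm of X vanishes only at 0, by injectivity of the embedding. This is what bounds the arc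
    length of a run by its dissipation. *)
Lemma Rd_lower : exists2 C, 0 < C & forall z, nv z <= C * Rd z.
Proof.
pose B := [set z : Z | nv z = 1].
have cB : compact B.
  apply: (@subclosed_compact _ _ [set z : Z | nv z <= 1]).
  - rewrite (_ : B = nv @^-1` [set 1])//.
    by apply: closed_comp; [move=> ? _; exact: nv_continuous|exact: closed_eq].
  - exact: compact_nv_ball.
  - by move=> z /= ->.
have norm1 z : z != 0 -> B ((nv z)^-1 *: z).
  move=> z0; rewrite /B/= (nvZ hP) normfV ger0_norm ?nv_ge0// mulVf//.
  by apply: contra_neq z0; exact: nv_eq0.
(* If the unit sphere is empty, then Z = 0 and any constant will do. *)
have [B0|/set0P B0] := eqVneq B set0.
  exists 1 => // z; have [->|z0] := eqVneq z 0; first by rewrite (nv0 hP) Rd0 mulr0.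
  by have := norm1 _ z0; rewrite B0.
have [u] := compact_EVT_min B0 cB (continuous_subspaceT Rd_continuous).
rewrite inE => Bu umin.
have Ru : 0 < Rd u.
  have [c [C [c0 C0 H]]] := dis_bounds hds.
  have /andP[+ _] := H (iZV P u); apply: lt_le_trans; rewrite mulr_gt0// normr_gt0.
  apply/eqP => E.
  have : iZV P u = 0 by apply: (sp_injVX hsp); rewrite E raddf0.
  move=> E'; have := Bu; rewrite /B/= nvE E' /normV (in_dual0 (VV_dual hP 0)) sqrtr0.
  by move/esym/eqP; rewrite oner_eq0.
exists (Rd u)^-1; first by rewrite invr_gt0.
move=> z; have [->|z0] := eqVneq z 0; first by rewrite (nv0 hP) Rd0 mulr0.
have nz0 : 0 < nv z.
  by rewrite lt_neqAle nv_ge0 andbT eq_sym; apply: contra_neq z0; exact: nv_eq0.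
have := umin ((nv z)^-1 *: z); rewrite inE => /(_ (norm1 _ z0)).
rewrite RdZ; last by rewrite invr_ge0 ltW.
by rewrite mulrC ler_pdivlMr// => h; rewrite mulrC ler_pdivlMr// mulrC.
Qed.

End Dissipation.

(** * The distance to the stable set as a maximum over the unit ball *)

Section Distance.
Context {R : realType} {Z W V X : completeNormedModType R}.
Variable P : ris_data Z W V X.
Hypothesis hP : assumptions P.
Hypothesis hZV : Z_eq_V P.
Local Notation nv := (nv P).
Local Notation Rd := (Rd P).

(** [VVinv] is defined by choice, so a preimage has to be exhibited: the Riesz representative,
    written in the orthonormal basis. *)
Lemma VV_Riesz (w : V -> R) : in_dual w -> VV P (VVinv P w) = w.
Proof.
move=> hw; have [n [e [b [K [x0 [r [oe be [_ ev _] fb _]]]]]]] := finite_dimension hP hZV.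
apply: (@xgetPex _ 0 [set v | VV P v = w]).
exists (\sum_i w (e i) *: e i); apply/funext => v.
rewrite (VV_sym hP) (in_dual_sum _ _ (VV_dual hP v)) [in RHS](ev v) (in_dual_sum _ _ hw).
by apply: eq_bigr => i _; rewrite (in_dualZ _ _ (VV_dual hP v)) (in_dualZ _ _ hw) mulrC.
Qed.

Lemma normVinvE (w : V -> R) : in_dual w -> normVinv P w = normV P (VVinv P w).
Proof. by move=> hw; rewrite /normVinv /normV (VV_Riesz hw). Qed.

Lemma normVinv_bound (w : V -> R) v : in_dual w -> `|w v| <= normVinv P w * normV P v.
Proof.
move=> hw; rewrite normVinvE// -{1}(VV_Riesz hw).
exact: VV_CauchySchwarz.
Qed.

Lemma normVinv_VV u k : normVinv P (fun v => k * VV P u v) = `|k| * normV P u.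
Proof.
have hw : in_dual (fun v => k * VV P u v) by apply: in_dualZf; exact: VV_dual.
rewrite normVinvE//.
suff -> : VVinv P (fun v => k * VV P u v) = k *: u by rewrite (normVZ hP).
apply/eqP; rewrite -subr_eq0; apply/eqP; apply: (VV_eq0 hP).
by rewrite (VVBl hP) (VV_Riesz hw) (VVZl hP) subrr.
Qed.

(* The distance is the maximum of [eta v - R v] over the unit ball: if it is
   positive and attained at v, then [eta - D * VV v] is a subgradient at 0 by the
   first order optimality condition at v. *)
Lemma distV_attained (eta : Z -> R) : in_dual eta ->
  exists D, [/\ 0 <= D, distV P eta = D%:E, forall v, eta v <= Rd v + D * nv v
    & exists v, [/\ nv v <= 1, D * nv v = D & eta v = Rd v + D]].
Proof.
move=> heta.
pose f z := eta z - Rd z.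
have cf : continuous f.
  by move=> z; apply: cvgB; [exact: heta.2|exact: Rd_continuous].
have B0 : [set z | nv z <= 1] !=set0 by exists 0; rewrite /= (nv0 hP).
have [v0] := @compact_EVT_max _ _ f [set z | nv z <= 1]
  B0 (@compact_nv_ball _ _ _ _ _ P hP hZV 1)
  (continuous_subspaceT cf).
rewrite inE/= => nv01 fmax.
set D := f v0 in fmax.
have f0 : f 0 = 0 by rewrite /f (in_dual0 heta) Rd0 ?subr0.
have D0 : 0 <= D by rewrite -f0; apply: fmax; rewrite inE/= (nv0 hP).
have fD v : f v <= D * nv v.
  have [->|v_neq0] := eqVneq v 0; first by rewrite f0 (nv0 hP) mulr0.
  have nv_gt0 : 0 < nv v.
    rewrite lt_neqAle nv_ge0 andbT eq_sym; apply: contra_neq v_neq0.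
    exact: nv_eq0.
  have := fmax ((nv v)^-1 *: v); rewrite inE/= (nvZ hP) normfV gtr0_norm// mulVf ?gt_eqF//.
  move=> /(_ (lexx _)); rewrite /f (in_dualZ _ _ heta) (RdZ hP); last by rewrite invr_ge0 ltW.
  by rewrite -mulrBr mulrC ler_pdivrMr.
have etaD v : eta v <= Rd v + D * nv v by have := fD v; rewrite /f; lra.
have Dnv0 : D * nv v0 = D.
  apply/eqP; rewrite eq_le ler_piMr//=.
  exact: fD.
exists D; split => //; last first.
  by exists v0; split => //; rewrite /D /f addrC subrK.
have subD : subdiff_dis0 P (fun v => - D * VV P (iZV P v0) (iZV P v) + eta v).
  split.
    split => [a u v|v].
      rewrite (iZVD P) (iZVZ P) (VV_dual hP _).1 heta.1; ring.
    apply: cvgD; last exact: heta.2.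
    apply: cvgM; first exact: cvg_cst.
    apply: (@continuous_comp _ _ _ (iZV P) (VV P (iZV P v0))); first exact: iZV_continuous.
    exact: (VV_dual hP _).2.
  move=> v; rewrite -/(Rd v).
  have [D00|D_neq0] := eqVneq D 0.
    by have := etaD v; rewrite D00 oppr0 !mul0r add0r addr0.
  have nv1 : nv v0 = 1 by apply: (mulfI D_neq0); rewrite mulr1.
  have DP : 0 < D by rewrite lt_neqAle eq_sym D_neq0.
  set q := VV P (iZV P v0) (iZV P v); set Q := VV P (iZV P v) (iZV P v).
  have VV1 : VV P (iZV P v0) (iZV P v0) = 1 by rewrite -(normV_sqr hP) -/(nv v0) nv1 expr1n.
  (* Variation of the maximizer in direction v. The norm of [v0 + t *: v] is bounded by (1 + its
     square) / 2, which agrees with it to first order because [nv v0 = 1], so the inequality is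
     polynomial in t before t tends to 0. *)
  have H (t : R) : 0 < t -> eta v - Rd v <= D * q + t * (D * Q / 2).
    move=> t0; have h1 := etaD (v0 + t *: v).
    have h2 := RdD hP v0 (t *: v); rewrite (RdZ hP) ?(ltW t0)// in h2.
    rewrite (in_dualD _ _ heta) (in_dualZ _ _ heta) in h1.
    have h3 : nv (v0 + t *: v) <= 1 + t * q + t * t * Q / 2.
      have nn2 : nv (v0 + t *: v) ^+ 2 = 1 + 2 * (t * q) + t * t * Q.
        rewrite nvE (normV_sqr hP) (iZVD P) (iZVZ P) (in_dualD _ _ (VV_dual hP _)).
        rewrite (in_dualZ _ _ (VV_dual hP _)) !(VVDl hP) !(VVZl hP) VV1.
        by rewrite (VV_sym hP (iZV P v) (iZV P v0)) -/q -/Q; ring.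
      have := sqr_ge0 (nv (v0 + t *: v) - 1); rewrite sqrrB1 nn2; lra.
    have h4 : eta v0 = Rd v0 + D by rewrite /D /f addrC subrK.
    have h5 := ler_wpM2l D0 h3.
    rewrite -(ler_pM2l t0).
    have -> : t * (D * q + t * (D * Q / 2)) = D * (1 + t * q + t * t * Q / 2) - D by field.
    rewrite mulrBr; lra.
  rewrite mulNr addrC lerBlDr -lerBlDl.
  apply/ler_addgt0Pr => eps eps0.
  have Q0 : 0 <= D * Q / 2 by rewrite divr_ge0// mulr_ge0// VV_ge0.
  pose t := eps / (D * Q / 2 + 1).
  have t0 : 0 < t by rewrite divr_gt0// ltr_wpDl.
  rewrite (le_trans (H t t0))// lerD2l /t mulrAC ler_pdivrMr ?ltr_wpDl//.
  by rewrite ler_wpM2l ?(ltW eps0)// lerDl.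
apply/eqP; rewrite eq_le; apply/andP; split.
  apply: ereal_inf_lbound; exists (fun v => - D * VV P (iZV P v0) v).
    by split => //; apply: in_dualZf; exact: VV_dual.
  by rewrite normVinv_VV normrN ger0_norm// -/(nv v0) Dnv0.
(* Conversely, any admissible w tested with the maximizer satisfies D <= - w v0, and v0 lies in the
   unit ball. *)
apply: le_ereal_inf_tmp => _ [w [hw [_ hsub]] <-]; rewrite lee_fin.
have := hsub v0; rewrite -/(Rd v0) => h.
have h2 := normVinv_bound (iZV P v0) hw; rewrite -/(nv v0) in h2.
have h3 : D <= normVinv P w * nv v0.
  rewrite (le_trans _ h2)// -normrN (le_trans _ (ler_norm _))//.
  by have : eta v0 = Rd v0 + D by [rewrite /D /f addrC subrK]; lra.
rewrite (le_trans h3)// ler_piMr// /normVinv sqrtr_ge0//.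
Qed.

End Distance.

(** * The energy *)

Section Frechet.
Context {R : realType} {Y : normedModType R}.

(** An alias carrying the proof of linearity, so that a plain function in the dual receives the
    linear structure required by [diff_unique]. *)
Definition dual_fun (l : Y -> R) (hl : in_dual l) : Y -> R^o := l.

Lemma dual_fun_linear (l : Y -> R) (hl : in_dual l) : linear (dual_fun hl).
Proof. by move=> a u v; rewrite /dual_fun hl.1. Qed.

HB.instance Definition _ (l : Y -> R) (hl : in_dual l) :=
  GRing.isLinear.Build R Y R^o *:%R (dual_fun hl) (dual_fun_linear hl).

Lemma frechet_estimate (f : Y -> R) (z : Y) : differentiable (f : Y -> R^o) z ->
  forall e : R, 0 < e -> \forall h \near (0 : Y),
    `|f (z + h) - f z - 'd (f : Y -> R^o) z h| <= e * `|h|.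
Proof.
move=> /diff_locally /eqaddoP H e e0; have := H e e0.
apply: filterS => h /=; suff -> : f (z + h) - f z - 'd (f : Y -> R^o) z h =
  f (h + z) - (f z + 'd (f : Y -> R^o) z h) by [].
by rewrite (addrC z h) opprD addrA.
Qed.

Lemma diff_of_estimate (f l : Y -> R) (z : Y) : in_dual l ->
  (forall e : R, 0 < e -> \forall h \near (0 : Y), `|f (z + h) - f z - l h| <= e * `|h|) ->
  'd (f : Y -> R^o) z = l :> (Y -> R).
Proof.
move=> hl H; have := @diff_unique R Y R^o f (dual_fun hl) z.
apply; first exact: hl.2.
apply/eqaddoP => e e0; have := H e e0; apply: filterS => h /=.
suff -> : f (z + h) - f z - l h = f (h + z) - (f z + l h) by [].
by rewrite (addrC z h) opprD addrA.
Qed.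

Lemma diff_in_dual (f : Y -> R) (z : Y) : differentiable (f : Y -> R^o) z ->
  in_dual ('d (f : Y -> R^o) z).
Proof.
move=> df; split; last exact: diff_continuous.
by move=> a u v; rewrite linearP.
Qed.

Lemma is_deriveE (f : R -> Y) (r : R) (d : Y) :
  (h^-1 *: (f (h + r) - f r) @[h --> 0^'] --> d) <-> is_derive r 1 f d.
Proof.
have E : (fun h : R => h^-1 *: (f (h + r) - f r)) =
    (fun h : R => h^-1 *: ((f \o shift r) (h *: 1) - f r)).
  by apply/funext => h /=; rewrite /GRing.scale/= mulr1.
split.
  rewrite E => H; apply: DeriveDef; first by apply/cvg_ex; exists d.
  exact: cvg_lim H.
by move=> [/cvg_ex[/= d' hd]] <-; rewrite E /derive (cvg_lim _ hd).
Qed.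

Lemma is_derive_cvg (f : R -> Y) (r : R) (d : Y) : is_derive r 1 f d ->
  f (h + r) @[h --> 0^'] --> f r.
Proof.
move=> /is_deriveE H; rewrite -[X in _ --> X]add0r -[X in _ --> X + _](scale0r d).
have H0 : h *: (h^-1 *: (f (h + r) - f r)) + f r @[h --> 0^'] --> 0 *: d + f r.
  apply: cvgD; last exact: cvg_cst.
  by apply: cvgZ H; exact: nbhs_dnbhs.
apply: cvg_trans H0; apply: near_eq_cvg; near=> h.
have h0 : h != 0 by near: h; exact: nbhs_dnbhs_neq.
by rewrite scalerA divff// scale1r subrK.
Unshelve. all: by end_near. Qed.

End Frechet.

Section SegmentDerive.
Context {R : realType} {Y : normedModType R}.

(** Stated with a first-order estimate for a homogeneous l, so that it applies both to the energy
    and to a dual-valued derivative evaluated at a fixed vector. *)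
Lemma segment_derive (G l : Y -> R) (z dl : Y) (s : R) :
  (forall a k, l (a *: k) = a * l k) ->
  (forall e : R, 0 < e -> \forall k \near (0 : Y),
    `|G (z + s *: dl + k) - G (z + s *: dl) - l k| <= e * `|k|) ->
  is_derive s 1 (fun s => G (z + s *: dl)) (l dl).
Proof.
move=> lZ H.
have := (@is_deriveE R R^o (fun s => G (z + s *: dl)) s (l dl)).1; apply.
apply/cvgrPdist_le => e e0.
have e1 : 0 < e / (`|dl| + 1) by rewrite divr_gt0// ltr_wpDl.
have c : h *: dl @[h --> (0 : R)^'] --> (0 : Y).
  by rewrite -(scale0r dl); apply: cvgZ; [exact: nbhs_dnbhs|exact: cvg_cst].
near=> h.
have h0 : h != 0 by near: h; exact: nbhs_dnbhs_neq.
have hh : 0 < `|h| by rewrite normr_gt0.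
have : `|G (z + s *: dl + h *: dl) - G (z + s *: dl) - l (h *: dl)| <=
    e / (`|dl| + 1) * `|h *: dl|.
  by near: h; exact: (c _ (H _ e1)).
rewrite lZ normrZ -(addrA z) -scalerDl (addrC s) => h1.
rewrite distrC /GRing.scale/= -(@ler_pM2l _ `|h|)// -normrM mulrBr mulVKf//.
rewrite (le_trans h1)// mulrCA ler_wpM2l// mulrAC ler_pdivrMr ?ltr_wpDl//.
by rewrite ler_wpM2l ?(ltW e0)// lerDl.
Unshelve. all: by end_near. Qed.

Lemma mvt_segment (g dg : R -> R) (K : R) :
  (forall s : R, 0 <= s <= 1 -> is_derive s 1 g (dg s) /\ `|dg s| <= K) ->
  `|g 1 - g 0| <= K.
Proof.
move=> H; have [||c] := @MVT_segment _ g dg 0 1 ler01.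
- move=> x; rewrite in_itv/= => /andP[x0 x1].
  by apply: (H x _).1; rewrite !ltW.
- apply: derivable_within_continuous => x; rewrite in_itv/= => /H[dx _].
  exact: ex_derive.
by rewrite in_itv/= => /H[_ cK] ->; rewrite subr0 mulr1.
Qed.

End SegmentDerive.

Lemma norm_sum3_le {R : realFieldType} (A' A0 Al F' F0 Fl f' f0 fl ft e x y : R) :
  `|A' - A0 - Al| <= e * y -> `|F' - F0 - Fl| <= e * y ->
  `|f' - f0 - ft - fl| <= e * (x + y) -> 0 <= e * x ->
  `|A' + F' - f' - (A0 + F0 - f0) - (- ft + (Al + Fl - fl))| <= 3 * (e * (x + y)).
Proof.
rewrite mulrDr; move: (e * x) (e * y) => u v.
rewrite !ler_norml; lra.
Qed.

Lemma norm_diff3_le {R : realFieldType} (a1 a2 b1 b2 c1 c2 x y z : R) :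
  `|a1 - a2| <= x -> `|b1 - b2| <= y -> `|c1 - c2| <= z ->
  `|a1 + b1 - c1 - (a2 + b2 - c2)| <= x + y + z.
Proof. rewrite !ler_norml; lra. Qed.

Lemma min_lipschitz {R : realFieldType} (t1 t2 T : R) :
  `|Num.min t1 T - Num.min t2 T| <= `|t1 - t2|.
Proof.
rewrite /Num.min; have := ler_norm (t1 - t2); have := ler_norm (- (t1 - t2)).
by rewrite normrN ler_norml; do 2 case: ifPn; lra.
Qed.

Lemma segment_norm_le {R : realType} {Y : normedModType R} (z1 z2 : Y) (s M : R) :
  0 <= s <= 1 -> `|z1| <= M -> `|z2| <= M -> `|z2 + s *: (z1 - z2)| <= M.
Proof.
move=> /andP[s0 s1] z1M z2M.
have -> : z2 + s *: (z1 - z2) = s *: z1 + (1 - s) *: z2.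
  by rewrite scalerBr scalerBl scale1r addrC addrAC addrA.
have s1' : 0 <= 1 - s by rewrite subr_ge0.
rewrite (le_trans (ler_normD _ _))// !normrZ (ger0_norm s0) (ger0_norm s1').
rewrite (le_trans (lerD (ler_wpM2l s0 z1M) (ler_wpM2l s1' z2M)))//.
by rewrite -mulrDl (addrC s) subrK mul1r.
Qed.

Section Energy.
Context {R : realType} {Z W V X : completeNormedModType R}.
Variable P : ris_data Z W V X.
Hypothesis hP : assumptions P.
Hypothesis hZV : Z_eq_V P.
Local Notation T := (Tend P).
Local Notation en := (energy P).

Let hF := as_F hP.
Let hf := as_f hP.
Let hA := as_A hP.

Lemma T_gt0 : 0 < T. Proof. exact: (sp_T (as_space hP)). Qed.

Lemma minT_itv t : 0 <= t -> 0 <= Num.min t T <= T.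
Proof. by move=> t0; rewrite le_min t0 (ltW T_gt0)/= ge_min lexx orbT. Qed.

Lemma energy_min t : en (Num.min t T) = en t.
Proof. by apply/funext => z; rewrite /energy -minA minxx. Qed.

Lemma A_dual z : in_dual (Aop P z). Proof. by have [] := A_op hA. Qed.

Lemma A_linl a u w v : Aop P (a *: u + w) v = a * Aop P u v + Aop P w v.
Proof. by have [_ -> _] := A_op hA. Qed.

Lemma ADl u w v : Aop P (u + w) v = Aop P u v + Aop P w v.
Proof. by have := A_linl 1 u w v; rewrite scale1r mul1r. Qed.

Lemma A_upper : exists2 M, 0 < M & forall u v, `|Aop P u v| <= M * `|u| * `|v|.
Proof.
have [_ _ [M MP]] := A_op hA; exists (`|M| + 1); first by rewrite ltr_wpDl.
move=> u v; rewrite (le_trans (MP _ _))// ler_wpM2r// ler_wpM2r//.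
by rewrite (le_trans (ler_norm _))// lerDl.
Qed.

(** The explicit form of [DzE]. The two agree for t >= 0, the range in which the truncated time lies
    in [0, T]. *)
Definition DE (t : R) (z v : Z) : R := Aop P z v + DzF P z v - Dzf P (Num.min t T) z v.

Lemma DzF_dual z : in_dual (DzF P z).
Proof. exact: diff_in_dual (F_diff hF z). Qed.

Lemma Dzf_dual t z : 0 <= t <= T -> in_dual (Dzf P t z).
Proof. by move=> t0; exact: diff_in_dual (f_diffz (f_isC1 hf) z t0). Qed.

Lemma DE_dual t z : 0 <= t -> in_dual (DE t z).
Proof.
move=> t0; apply: in_dualBf; last exact: (Dzf_dual _ (minT_itv t0)).
split => [a u v|v]; first by rewrite (A_dual z).1 (DzF_dual z).1; ring.
by apply: cvgD; [exact: (A_dual z).2|exact: (DzF_dual z).2].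
Qed.

Lemma quad_estimate (z : Z) (e : R) : 0 < e -> \forall y \near z,
  `|2^-1 * Aop P y y - 2^-1 * Aop P z z - Aop P z (y - z)| <= e * `|y - z|.
Proof.
move=> e0; have [M M0 AM] := A_upper.
near=> y.
have -> : 2^-1 * Aop P y y - 2^-1 * Aop P z z - Aop P z (y - z) =
    2^-1 * Aop P (y - z) (y - z).
  have : Aop P y z = Aop P z y by exact: (A_sym hA).
  rewrite !(in_dualB _ _ (A_dual _)).
  have AB u w v : Aop P (u - w) v = Aop P u v - Aop P w v.
    by have := A_linl (-1) w u v; rewrite scaleN1r mulN1r addrC (addrC (- _)).
  by rewrite !AB => ->; lra.
rewrite normrM gtr0_norm ?invr_gt0//.
apply: (@le_trans _ _ (M * `|y - z| * `|y - z|)).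
  rewrite (le_trans _ (AM _ _))// ler_piMl// invf_le1// ler1n//.
rewrite ler_wpM2r// mulrC -ler_pdivlMr// distrC.
by near: y; apply: cvgr_dist_le; [exact: cvg_id|exact: divr_gt0].
Unshelve. all: by end_near. Qed.

Lemma F_estimate (z : Z) (e : R) : 0 < e -> \forall y \near z,
  `|Fnl P y - Fnl P z - DzF P z (y - z)| <= e * `|y - z|.
Proof.
move=> e0; have H := frechet_estimate (F_diff hF z) e0.
apply/nbhs0P; apply: filterS H => h.
by have -> : z + h - z = h by rewrite addrAC subrr add0r.
Qed.

Let DT := [set p : R * Z | 0 <= p.1 <= T].

Lemma energy_estimate (t : R) (z : Z) (e : R) : 0 <= t <= T -> 0 < e ->
  \forall p \near within DT (nbhs (t, z)),
    `|en p.1 p.2 - en t z - (- load_t P t z * (p.1 - t) + DE t z (p.2 - z))|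
      <= e * (`|p.1 - t| + `|p.2 - z|).
Proof.
move=> tT e0.
have e3 : 0 < e / 3 by rewrite divr_gt0.
have h1 := f_diff (f_isC1 hf) z tT e3.
have h2 : \forall p \near within DT (nbhs (t, z)),
    `|2^-1 * Aop P p.2 p.2 - 2^-1 * Aop P z z - Aop P z (p.2 - z)| <= e / 3 * `|p.2 - z|.
  by apply: cvg_within; exact: (cvg_snd (quad_estimate z e3)).
have h3 : \forall p \near within DT (nbhs (t, z)),
    `|Fnl P p.2 - Fnl P z - DzF P z (p.2 - z)| <= e / 3 * `|p.2 - z|.
  by apply: cvg_within; exact: (cvg_snd (F_estimate z e3)).
have h4 : \forall p \near within DT (nbhs (t, z)), DT p by exact: withinT.
near=> p.
have pT : 0 <= p.1 <= T by near: p.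
have [pT2 tT2] : p.1 <= T /\ t <= T by split; [case/andP: pT|case/andP: tT].
rewrite /energy /DE !min_l//.
have g1 : `|load P p.1 p.2 - load P t z - load_t P t z * (p.1 - t)
          - Dzf P t z (p.2 - z)| <= e / 3 * (`|p.1 - t| + `|p.2 - z|) by near: p.
have g2 : `|2^-1 * Aop P p.2 p.2 - 2^-1 * Aop P z z - Aop P z (p.2 - z)| <= e / 3 * `|p.2 - z|.
  by near: p.
have g3 : `|Fnl P p.2 - Fnl P z - DzF P z (p.2 - z)| <= e / 3 * `|p.2 - z| by near: p.
have -> : e * (`|p.1 - t| + `|p.2 - z|) = 3 * (e / 3 * (`|p.1 - t| + `|p.2 - z|)).
  by rewrite !mulrA [3 * e]mulrC mulfK.
by rewrite mulNr; apply: norm_sum3_le g2 g3 g1 _; rewrite mulr_ge0// ltW.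
Unshelve. all: by end_near. Qed.

Lemma energy_frechet t z (e : R) : 0 <= t -> 0 < e ->
  \forall h \near (0 : Z), `|en t (z + h) - en t z - DE t z h| <= e * `|h|.
Proof.
move=> t0 e0; rewrite -energy_min.
have H := energy_estimate z (minT_itv t0) e0.
set t' := Num.min t T in H *.
have c : (t', y) @[y --> z] --> (t', z) by exact: (cvg_pair (cvg_cst t') (@cvg_id _ (nbhs z))).
have /nbhs0P := c _ H; apply: filterS => h /= /(_ (minT_itv t0)).
rewrite subrr mulr0 add0r normr0 add0r.
have -> : z + h - z = h by rewrite addrAC subrr add0r.
by rewrite /DE /t' -minA minxx.
Qed.

Lemma DzE_E t z : 0 <= t -> DzE P t z = DE t z.
Proof.
move=> t0; rewrite /DzE; apply: diff_of_estimate; first exact: DE_dual.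
by move=> e; exact: energy_frechet.
Qed.

(** The joint estimate on [0, T] x Z is composed with the curve. For small h the difference
    quotients are bounded by [|t'| + 1] and [|z'| + 1], whose sum [K] scales the tolerance of that
    estimate. *)
Lemma energy_curve_derive (t : R -> R) (z : R -> Z) (r t' : R) (z' : Z) :
  is_derive r 1 t t' -> is_derive r 1 z z' -> (\forall s \near r, 0 <= t s <= T) ->
  is_derive r 1 (fun s => en (t s) (z s)) (- load_t P (t r) (z r) * t' + DE (t r) (z r) z').
Proof.
move=> dt dz tT.
have trT : 0 <= t r <= T := nbhs_singleton tT.
have hD : in_dual (DE (t r) (z r)) by apply: DE_dual; case/andP: trT.
have ct : t (h + r) @[h --> 0^'] --> t r := is_derive_cvg (Y := R^o) dt.
have cz := is_derive_cvg dz.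
have qt := (@is_deriveE R R^o t r t').2 dt.
have qz := (is_deriveE z r z').2 dz.
have := (@is_deriveE R R^o (fun s => en (t s) (z s)) r
  (- load_t P (t r) (z r) * t' + DE (t r) (z r) z')).1; apply.
pose phi h := - load_t P (t r) (z r) * (h^-1 * (t (h + r) - t r)) +
  DE (t r) (z r) (h^-1 *: (z (h + r) - z r)).
have cphi : phi h @[h --> 0^'] --> - load_t P (t r) (z r) * t' + DE (t r) (z r) z'.
  apply: cvgD; first by apply: cvgM; [exact: cvg_cst|exact: qt].
  exact: cvg_comp qz (hD.2 z').
apply/cvgrPdist_le => e e0.
have e2 : 0 < e / 2 by rewrite divr_gt0.
pose K := `|t'| + 1 + (`|z'| + 1).
have K0 : 0 < K by rewrite addr_gt0// ltr_wpDl.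
have eK : 0 < e / 2 / K by rewrite divr_gt0.
have H := energy_estimate (z r) trT eK.
have c : (t (h + r), z (h + r)) @[h --> 0^'] --> (t r, z r) by exact: (cvg_pair ct cz).
have tT' : \forall h \near (0 : R)^', 0 <= t (h + r) <= T.
  have c' : h + r @[h --> (0 : R)^'] --> r.
    by rewrite -[X in _ --> X]add0r; apply: cvgD; [exact: nbhs_dnbhs|exact: cvg_cst].
  exact: (c' _ tT).
near=> h.
have h0 : h != 0 by near: h; exact: nbhs_dnbhs_neq.
have hh : 0 < `|h| by rewrite normr_gt0.
have h1 : `|en (t (h + r)) (z (h + r)) - en (t r) (z r) -
   (- load_t P (t r) (z r) * (t (h + r) - t r) + DE (t r) (z r) (z (h + r) - z r))|
   <= e / 2 / K * (`|t (h + r) - t r| + `|z (h + r) - z r|).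
  have hT : 0 <= t (h + r) <= T by near: h.
  by move: hT; near: h; exact: (c _ H).
have h2 : `|- load_t P (t r) (z r) * t' + DE (t r) (z r) z' - phi h| <= e / 2.
  by near: h; apply: cvgr_dist_le.
have h3 : `|h^-1 * (t (h + r) - t r)| <= `|t'| + 1.
  by near: h; apply: (cvgr_norm_le _ qt); rewrite ltrDl.
have h4 : `|h^-1 *: (z (h + r) - z r)| <= `|z'| + 1.
  by near: h; apply: (cvgr_norm_le _ qz); rewrite ltrDl.
rewrite /GRing.scale/= (le_trans (ler_distD (phi h) _ _))// (splitr e) lerD//.
have -> : phi h = h^-1 * (- load_t P (t r) (z r) * (t (h + r) - t r) +
    DE (t r) (z r) (z (h + r) - z r)).
  by rewrite /phi (in_dualZ _ _ hD) [RHS]mulrDr; congr (_ + _); exact: mulrCA.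
rewrite distrC -mulrBr normrM normfV mulrC ler_pdivrMr//.
rewrite (le_trans h1)//.
have h5 : `|t (h + r) - t r| <= (`|t'| + 1) * `|h|.
  by rewrite -ler_pdivrMr// mulrC -normfV -normrM.
have h6 : `|z (h + r) - z r| <= (`|z'| + 1) * `|h|.
  by rewrite -ler_pdivrMr// mulrC -normfV -normrZ.
have -> : e / 2 * `|h| = e / 2 / K * (K * `|h|) by rewrite mulrA divfK ?gt_eqF.
by rewrite ler_wpM2l ?(ltW eK)// /K mulrDl lerD.
Unshelve. all: by end_near. Qed.

Lemma iZV_upper : exists2 C, 0 < C & forall v, `|iZV P v| <= C * `|v|.
Proof.
have [C1 C10 h1] := linear_lipschitz (sp_contZW (as_space hP)).
have [C2 C20 h2] := linear_lipschitz (sp_contWV (as_space hP)).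
exists (C2 * C1) => [|v]; first by rewrite mulr_gt0.
by rewrite /iZV (le_trans (h2 _))// -mulrA ler_pM2l.
Qed.

(** The mean value theorem on the segment from z2 to z1, after evaluation at the fixed vector
    [iZV P v]; the growth bound on the second derivative is uniform on balls. *)
Lemma DzF_lipschitz M : exists2 L, 0 < L & forall z1 z2 v, `|z1| <= M -> `|z2| <= M ->
  `|DzF P z1 v - DzF P z2 v| <= L * `|z1 - z2| * `|v|.
Proof.
have [DF [D2F [hr [_ hb he _] [C [q [C0 q1 D2]]]]]] := F_DC1 hF.
have [Ci Ci0 iC] := iZV_upper.
have Mq : 0 < 1 + `|M| `^ q by rewrite ltr_wpDr// powR_ge0.
exists (C * (1 + `|M| `^ q) * Ci); first by rewrite !mulr_gt0.
move=> z1 z2 v z1M z2M.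
rewrite !(hr _).2.
set w := iZV P v; pose dl := z1 - z2; rewrite -/dl.
pose g (s : R) := DF (z2 + s *: dl) w.
have E1 : DF z1 w = g 1 by rewrite /g scale1r /dl addrC subrK.
have E0 : DF z2 w = g 0 by rewrite /g scale0r addr0.
rewrite E1 E0.
apply: (@mvt_segment _ _ (fun s => D2F (z2 + s *: dl) dl w)) => s s01; split.
  apply: (@segment_derive _ _ (fun z => DF z w) (fun k => D2F (z2 + s *: dl) k w)).
    move=> a k; have [_ lin _] := hb (z2 + s *: dl).
    have := lin a k 0 w; rewrite addr0 => ->.
    have := lin 1 0 0 w; rewrite scale1r addr0 mul1r => h.
    by rewrite [X in _ + X](_ : _ = 0) ?addr0//; lra.
  move=> e e0; have ew : 0 < e / (`|w| + 1) by rewrite divr_gt0// ltr_wpDl.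
  have := he (z2 + s *: dl) _ ew; apply: filterS => k /(_ w) /le_trans; apply.
  rewrite -!mulrA ler_wpM2l ?(ltW e0)// mulrCA ler_piMr// ler_pdivrMl ?ltr_wpDl//.
  by rewrite mulr1 lerDl.
rewrite (le_trans (D2 _ _ _))//.
have h1 : `|z2 + s *: dl| <= `|M|.
  by apply: segment_norm_le => //; rewrite (le_trans _ (ler_norm M)).
apply: (@le_trans _ _ (C * (1 + `|M| `^ q) * `|dl| * (Ci * `|v|))).
  rewrite ler_pM ?mulr_ge0 ?addr_ge0 ?powR_ge0 ?(ltW C0)//; last exact: iC.
  rewrite ler_wpM2r// ler_wpM2l ?(ltW C0)// lerD2l.
  by apply: ge0_ler_powR; rewrite ?nnegrE//; lra.
by rewrite -!mulrA (mulrCA `|dl|).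
Qed.

(** Completing the square, (c + 1) y <= a y^2 / 2 + (c + 1)^2 / (2 a), lets the coercive quadratic
    part absorb the load. The left side [|z| + 1] is the growth factor of the power, as the Gronwall
    argument requires. *)
Lemma energy_lower : exists b, forall t z, 0 <= t <= T -> `|z| + 1 <= en t z + b.
Proof.
have [c c0 fc] := f_growth hf; have [a a0 Aa] := A_coer hA.
exists (c + 1 + (c + 1) ^+ 2 / (2 * a)) => t z tT.
have := fc t z tT; have := F_ge0 hF z; have := Aa z.
rewrite /energy min_l; last by case/andP: tT.
move: (Aop P z z) (Fnl P z) (load P t z) `|z| => A F f y hA0 hF0 hf0.
suff : (c + 1) * y <= 2^-1 * (a * y ^+ 2) + (c + 1) ^+ 2 / (2 * a) by lra.
rewrite -subr_ge0; have -> : 2^-1 * (a * y ^+ 2) + (c + 1) ^+ 2 / (2 * a) - (c + 1) * y =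
    (a * y - (c + 1)) ^+ 2 / (2 * a) by field; rewrite gt_eqF.
by rewrite divr_ge0 ?sqr_ge0// mulr_ge0// ltW.
Qed.

Lemma DE_lipschitz M : exists2 L, 0 < L & forall t1 t2 z1 z2 v, 0 <= t1 -> 0 <= t2 ->
  `|z1| <= M -> `|z2| <= M ->
  `|DE t1 z1 v - DE t2 z2 v| <= L * (`|t1 - t2| + `|z1 - z2|) * `|v|.
Proof.
have [MA MA0 AM] := A_upper; have [LF LF0 FL] := DzF_lipschitz M.
have [nu nu0 fnu] := f_Dz_lip hf.
have [Ci Ci0 iC] := iZV_upper.
have [C1 C10 h1] := linear_lipschitz (sp_contZW (as_space hP)).
pose Kf := nu * (1 + C1) * Ci.
have Kf0 : 0 < Kf by rewrite !mulr_gt0// addr_gt0.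
exists (MA + LF + Kf); first by rewrite !addr_gt0.
move=> t1 t2 z1 z2 v t10 t20 z1M z2M.
have a1 : `|Aop P z1 v - Aop P z2 v| <= MA * `|z1 - z2| * `|v|.
  have -> : Aop P z1 v - Aop P z2 v = Aop P (z1 - z2) v.
    by rewrite -[in LHS](subrK z2 z1) ADl addrK.
  exact: AM.
have a2 := FL z1 z2 v z1M z2M.
have a3 : `|Dzf P (Num.min t1 T) z1 v - Dzf P (Num.min t2 T) z2 v| <=
    Kf * (`|t1 - t2| + `|z1 - z2|) * `|v|.
  have [w [hw wE] wb] := fnu _ _ z1 z2 (minT_itv t10) (minT_itv t20).
  rewrite wE (le_trans (wb _))//.
  apply: (@le_trans _ _ (nu * ((1 + C1) * (`|t1 - t2| + `|z1 - z2|)) * (Ci * `|v|))).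
    apply: ler_pM => //; first by rewrite mulr_ge0 ?addr_ge0// ltW.
    rewrite ler_pM2l// mulrDr lerD//.
      by rewrite (le_trans (min_lipschitz _ _ _))// ler_peMl// lerDl ltW.
    by rewrite -raddfB (le_trans (h1 _))// ler_wpM2r// lerDr ler01.
  rewrite /Kf; move: (`|t1 - t2| + `|z1 - z2|) `|v| => x y.
  by rewrite (_ : nu * ((1 + C1) * x) * (Ci * y) = nu * (1 + C1) * Ci * x * y)//; ring.
rewrite /DE; apply: le_trans (norm_diff3_le a1 a2 a3) _.
rewrite -!mulrDl ler_wpM2r// [leRHS]mulrDl lerD2r ler_wpM2l ?lerDr//.
by rewrite ltW// addr_gt0.
Qed.

Lemma DE_bounded M : exists2 K, 0 < K & forall t z v, 0 <= t <= T -> `|z| <= M ->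
  `|DE t z v| <= K * `|v|.
Proof.
have [L L0 LP] := DE_lipschitz `|M|.
have [C C0 CP] := in_dual_bounded (DE_dual 0 (lexx 0)).
exists (C + L * (T + `|M|)); first by rewrite ltr_pwDl// mulr_ge0 ?(ltW L0)// addr_ge0// ltW ?T_gt0.
move=> t z v /andP[t0 tT] zM.
rewrite -(subrK (DE 0 0 v) (DE t z v)) addrC mulrDl (le_trans (ler_normD _ _))// lerD//.
have zM' : `|z| <= `|M| by rewrite (le_trans zM) ?ler_norm.
rewrite (le_trans (LP _ _ _ _ _ t0 (lexx 0) zM' _)) ?normr0// !subr0.
by rewrite ler_wpM2r// ler_pM2l// lerD// ger0_norm.
Qed.

Lemma energy_lipschitz_z M : exists2 K, 0 < K & forall t z1 z2, 0 <= t <= T ->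
  `|z1| <= M -> `|z2| <= M -> `|en t z1 - en t z2| <= K * `|z1 - z2|.
Proof.
have [K K0 KP] := DE_bounded M; exists K => // t z1 z2 tT z1M z2M.
have t0 : 0 <= t by case/andP: tT.
pose dl := z1 - z2; pose g (s : R) := en t (z2 + s *: dl).
have E1 : en t z1 = g 1 by rewrite /g scale1r /dl addrC subrK.
have E0 : en t z2 = g 0 by rewrite /g scale0r addr0.
rewrite E1 E0.
apply: (@mvt_segment _ _ (fun s => DE t (z2 + s *: dl) dl)) => s s01; split.
  apply: (@segment_derive _ _ (en t) (DE t (z2 + s *: dl))).
    by move=> a k; rewrite (in_dualZ _ _ (DE_dual _ t0)).
  by move=> e; exact: energy_frechet.
apply: KP => //; rewrite /dl.
by rewrite segment_norm_le.
Qed.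

(** The mean value theorem in time. Differentiability is assumed relative to [0, T] only, so
    two-sided derivatives are taken in the open interval, and continuity at its ends comes from
    one-sided estimates. *)
Lemma load_lipschitz : exists2 m, 0 < m & forall t1 t2 z, 0 <= t1 <= T -> 0 <= t2 <= T ->
  `|load P t1 z - load P t2 z| <= m * (`|z| + 1) * `|t1 - t2|.
Proof.
have [m m0 mP] := f_ft_growth hf; exists m => // t1 t2 z.
wlog t12 : t1 t2 / t1 <= t2.
  move=> H; have [/H//|/ltW t21 h1 h2] := leP t1 t2.
  by rewrite distrC (distrC t1); exact: H.
move=> /andP[t10 t1T] /andP[t20 t2T].
have est (t e : R) : 0 <= t <= T -> 0 < e -> \forall s \near t, 0 <= s <= T ->
    `|load P s z - load P t z - load_t P t z * (s - t)| <= e * `|s - t|.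
  move=> tT e0; have H := f_diff (f_isC1 hf) z tT e0.
  have c : (s, z) @[s --> t] --> (t, z) by exact: (cvg_pair (@cvg_id _ (nbhs t)) (cvg_cst z)).
  have Hc : \forall s \near t, 0 <= s <= T ->
      `|load P s z - load P t z - load_t P t z * (s - t) - Dzf P t z (z - z)|
        <= e * (`|s - t| + `|z - z|) := c _ H.
  apply: filterS Hc => s h sT; have := h sT.
  by rewrite (subrr z) (in_dual0 (Dzf_dual z tT)) subr0 normr0 addr0.
have der (t : R) : t1 < t < t2 -> is_derive t 1 (load P ^~ z) (load_t P t z).
  move=> /andP[h1 h2].
  have := (@is_deriveE R R^o (load P ^~ z) t (load_t P t z)).1; apply.
  apply/cvgrPdist_le => e e0.
  have tT : 0 <= t <= T by lra.
  have c : h + t @[h --> (0 : R)^'] --> t.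
    by rewrite -[X in _ --> X]add0r; apply: cvgD; [exact: nbhs_dnbhs|exact: cvg_cst].
  have near0T : \forall s \near t, 0 <= s <= T.
    near=> s; have : t1 < s by near: s; exact: lt_nbhsr.
    by have : s < t2 by [near: s; exact: lt_nbhsl]; lra.
  near=> h.
  have h0 : h != 0 by near: h; exact: nbhs_dnbhs_neq.
  have hh : 0 < `|h| by rewrite normr_gt0.
  have hT : 0 <= h + t <= T by near: h; exact: (c _ near0T).
  have h3 : `|load P (h + t) z - load P t z - load_t P t z * (h + t - t)| <= e * `|h + t - t|.
    by move: hT; near: h; exact: (c _ (est _ _ tT e0)).
  move: h3; rewrite addrK => h3.
  rewrite distrC /GRing.scale/= -(@ler_pM2l _ `|h|)// -normrM mulrBr mulVKf//.
  by rewrite (mulrC h) (mulrC `|h|).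
have ltc (t e : R) : 0 <= t <= T -> 0 < e ->
    \forall s \near t, 0 <= s <= T -> `|load P t z - load P s z| <= e.
  move=> tT e0; pose C := `|load_t P t z| + 1.
  have C0 : 0 < C by rewrite ltr_wpDl.
  have H := est t 1 tT ltr01.
  near=> s => sT.
  have h1 : `|load P s z - load P t z - load_t P t z * (s - t)| <= 1 * `|s - t|.
    by move: sT; near: s; exact: H.
  have h2 : `|s - t| <= e / C.
    by rewrite distrC; near: s; apply: cvgr_dist_le; [exact: cvg_id|exact: divr_gt0].
  rewrite distrC -(subrK (load_t P t z * (s - t)) (_ - load P t z)).
  rewrite (le_trans (ler_normD _ _))// (le_trans (lerD h1 (lexx _)))// normrM -mulrDl addrC.
  by rewrite -ler_pdivlMl// mulrC.
have cont : {within `[t1, t2], continuous (load P ^~ z)}.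
  move: t12; rewrite le_eqVlt => /predU1P[->|t12].
    by rewrite set_itv1; exact: continuous_subspace1.
  apply/continuous_within_itvP => //; split.
  - move=> x; rewrite in_itv/= => /der dx.
    by apply/differentiable_continuous/derivable1_diffP; exact: ex_derive.
  - apply/cvgrPdist_le => e e0.
    have H : \forall s \near t1^'+, 0 <= s <= T -> `|load P t1 z - load P s z| <= e.
      by apply: cvg_within; apply: ltc => //; rewrite t10.
    near=> s; have : 0 <= s <= T; last by near: s.
    apply/andP; split.
      by rewrite (le_trans t10)//; near: s; exact: nbhs_right_ge.
    by rewrite (le_trans _ t2T)//; near: s; exact: nbhs_right_le.
  - apply/cvgrPdist_le => e e0.
    have H : \forall s \near t2^'-, 0 <= s <= T -> `|load P t2 z - load P s z| <= e.
      by apply: cvg_within; apply: ltc => //; rewrite t20.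
    near=> s; have : 0 <= s <= T; last by near: s.
    apply/andP; split.
      by rewrite (le_trans t10)//; near: s; exact: nbhs_left_ge.
    by rewrite (le_trans _ t2T)//; near: s; exact: nbhs_left_le.
rewrite distrC (distrC t1).
have der' (x : R) : x \in `]t1, t2[ -> is_derive x 1 (load P ^~ z) (load_t P x z).
  by rewrite in_itv/=; exact: der.
have [c cI ->] := MVT_segment t12 der' cont.
rewrite normrM ler_wpM2r// mP//.
by move: cI; rewrite in_itv/= => /andP[h1 h2]; rewrite (le_trans t10)// (le_trans h2).
Unshelve. all: by end_near. Qed.

End Energy.

Lemma step_optimality_arith {R : realFieldType} (a b c d : R) : d + (c - - (a + b)) <= a -> b <= - c - d.
Proof. lra. Qed.

(** * One step of the scheme *)

Section Step.
Context {R : realType} {Z W V X : completeNormedModType R}.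
Variable P : ris_data Z W V X.
Hypothesis hP : assumptions P.
Hypothesis hZV : Z_eq_V P.
Local Notation T := (Tend P).
Local Notation en := (energy P).
Local Notation nv := (nv P).
Local Notation Rd := (Rd P).
Local Notation DE := (DE P).
Local Notation mu := (@lebesgue_measure R).

(** The function G of the overview. For t >= 0 the distance is finite, so [fine] loses nothing. *)
Definition Gd (t : R) (z : Z) : R := fine (dist_DE P t z).

Lemma GdP t z : 0 <= t ->
  [/\ 0 <= Gd t z, dist_DE P t z = (Gd t z)%:E,
      forall v, - DE t z v <= Rd v + Gd t z * nv v
    & exists v, nv v <= 1 /\ - DE t z v = Rd v + Gd t z].
Proof.
move=> t0.
have heta : in_dual (fun v => - DzE P t z v).
  rewrite DzE_E//.
  have -> : (fun v => - DE t z v) = (fun v => -1 * DE t z v).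
    by apply/funext => v; rewrite mulN1r.
  by apply: in_dualZf; exact: DE_dual.
have [D [D0 DE1 D2 [v [v1 v2 v3]]]] := distV_attained hP hZV heta.
have E : Gd t z = D by rewrite /Gd /dist_DE DE1.
rewrite DzE_E// in D2 v3.
by split; rewrite ?E//; exists v.
Qed.

(** G is a maximum over the unit ball of quantities affine in [DE], and a maximizer for the first
    point is a competitor for the second. *)
Lemma Gd_le t1 t2 z1 z2 d : 0 <= t1 -> 0 <= t2 -> 0 <= d ->
  (forall v, `|DE t1 z1 v - DE t2 z2 v| <= d * nv v) -> Gd t1 z1 <= Gd t2 z2 + d.
Proof.
move=> t10 t20 d0 H; have [g1 _ _ [v [v1 vE]]] := GdP z1 t10.
have [g2 _ /(_ v) h2 _] := GdP z2 t20.
have h3 : - DE t1 z1 v <= - DE t2 z2 v + d * nv v.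
  by rewrite -lerBlDl opprK addrC (le_trans (ler_norm _))// distrC; exact: H.
have -> : Gd t1 z1 = - DE t1 z1 v - Rd v by rewrite vE addrC addKr.
rewrite lerBlDl addrA (le_trans h3)// lerD//; last by rewrite ler_piMr.
by rewrite (le_trans h2)// lerD2l ler_piMr.
Qed.

Lemma Gd_lipschitz M : exists2 L, 0 < L & forall t1 t2 z1 z2, 0 <= t1 -> 0 <= t2 ->
  `|z1| <= M -> `|z2| <= M -> `|Gd t1 z1 - Gd t2 z2| <= L * (`|t1 - t2| + `|z1 - z2|).
Proof.
have [L L0 LP] := DE_lipschitz hP M; have [C C0 CP] := nv_equiv hP hZV.
exists (L * C); first by rewrite mulr_gt0.
suff H t1 t2 z1 z2 : 0 <= t1 -> 0 <= t2 -> `|z1| <= M -> `|z2| <= M ->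
    Gd t1 z1 <= Gd t2 z2 + L * C * (`|t1 - t2| + `|z1 - z2|).
  move=> t1 t2 z1 z2 t10 t20 z1M z2M; rewrite ler_norml lerBlDl H// andbT.
  by rewrite lerNl opprB lerBlDl (distrC t1) (distrC z1) H.
move=> t10 t20 z1M z2M; apply: Gd_le => //.
  by rewrite !mulr_ge0 ?addr_ge0// ltW.
move=> v; rewrite (le_trans (LP _ _ _ _ _ t10 t20 z1M z2M))//.
rewrite [leRHS](_ : _ = L * (`|t1 - t2| + `|z1 - z2|) * (C * nv v)); last first.
  by rewrite mulrACA -!mulrA; congr (_ * _); rewrite mulrCA.
rewrite ler_wpM2l; [by []|by rewrite mulr_ge0 ?addr_ge0// ltW|exact: (CP v).1].
Qed.

Lemma energy_lipschitz M : exists2 K, 0 < K & forall t1 t2 z1 z2, 0 <= t1 <= T -> 0 <= t2 <= T ->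
  `|z1| <= M -> `|z2| <= M -> `|en t1 z1 - en t2 z2| <= K * (`|t1 - t2| + `|z1 - z2|).
Proof.
have [K K0 KP] := energy_lipschitz_z hP M; have [m m0 mP] := load_lipschitz hP.
exists (K + m * (`|M| + 1)); first by rewrite addr_gt0// mulr_gt0// ltr_wpDl.
move=> t1 t2 z1 z2 t1T t2T z1M z2M.
rewrite (le_trans (ler_distD (en t1 z2) _ _))// mulrDr addrC lerD//.
  have -> : en t1 z2 - en t2 z2 = - (load P t1 z2 - load P t2 z2).
    rewrite /energy !min_l; [|by case/andP: t2T|by case/andP: t1T].
    by rewrite !opprB addrC addrA subrK.
  rewrite normrN (le_trans (mP _ _ _ t1T t2T))// ler_wpM2r//.
  rewrite (@le_trans _ _ (m * (`|M| + 1)))// ?lerDr ?(ltW K0)//.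
  by rewrite ler_pM2l// lerD2r (le_trans z2M)// ler_norm.
rewrite (le_trans (KP _ _ _ t1T z1M z2M))// ler_wpM2r// lerDl.
by rewrite mulr_ge0 ?(ltW m0)// addr_ge0.
Qed.

Variable x : @step R Z.
Hypothesis vx : valid_step P x.
Hypothesis tx : 0 <= st_t x.

Local Notation t0 := (st_t x).
Local Notation s0 := (st_s x).
Local Notation tau := (st_tau x).
Local Notation zn := (st_znew x).
Local Notation Dl := (st_znew x - st_z x).
Local Notation that := (st_that P x).
Local Notation zhat := (st_zhat x).
Local Notation dz := (st_dz x).
Local Notation dt := (st_dt P x).

Lemma tau_gt0 : 0 < tau. Proof. by have [] := vx. Qed.

(** The inclusion is tested with [tau *: v], where v realizes the maximum defining G at the new
    state. This bounds tau G by the power minus the dissipation of the increment, while the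
    definition of G bounds the latter by [nv Dl] times G. Since [nv Dl <= tau], equality holds
    throughout; hence time advances only when G vanishes at the new state and the old time. *)
Lemma step_optimality : [/\ nv Dl <= tau, - DE t0 zn Dl = Rd Dl + nv Dl * Gd t0 zn
  & (tau - nv Dl) * Gd t0 zn = 0].
Proof.
have t00 := tau_gt0; have [_ [xi [hxi fin sub] xiE] _] := vx.
have nvt : nv Dl <= tau.
  by move: fin; rewrite /indicator -/(nv Dl); case: ifP => //; rewrite addey// ltxx.
have hD := DE_dual hP zn tx.
have xiD v : xi v = - DE t0 zn v.
  by apply/eqP; rewrite -addr_eq0 -(DzE_E hP)// -xiE.
have opt v : nv v <= tau -> Rd Dl - DE t0 zn (v - Dl) <= Rd v.
  move=> vt; have := sub v; rewrite /indicator -!/(nv _) nvt vt !adde0 -EFinD lee_fin.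
  by rewrite xiD.
have [g0 _ gle [v [v1 vE]]] := GdP zn tx.
have h1 : tau * Gd t0 zn <= - DE t0 zn Dl - Rd Dl.
  have := opt (tau *: v); rewrite (nvZ hP) gtr0_norm// ler_piMr ?(ltW t00)//.
  rewrite (in_dualB _ _ hD) (in_dualZ _ _ hD) (RdZ hP) ?(ltW t00)//.
  have -> : DE t0 zn v = - (Rd v + Gd t0 zn) by rewrite -vE opprK.
  rewrite mulrN mulrDr opprB; move=> /(_ isT).
  by move: (tau * Rd v) (tau * Gd _ _) (DE _ _ _) (Rd _); exact: step_optimality_arith.
have h2 := gle Dl.
have h3 : nv Dl * Gd t0 zn <= tau * Gd t0 zn by rewrite ler_wpM2r.
rewrite (mulrC (Gd _ _)) in h2.
split => //.
  apply/eqP; rewrite eq_le h2/= -lerBrDl.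
  exact: le_trans h3 h1.
apply/eqP; rewrite mulrBl subr_eq0 eq_le h3 andbT (le_trans h1)// lerBlDl.
exact: h2.
Qed.

Lemma dzE : dz = tau^-1 *: Dl. Proof. by []. Qed.

Lemma dtE : dt = (tau - nv Dl) / tau.
Proof.
rewrite /st_dt /st_tnew -/(nv Dl); congr (_ / _).
by rewrite addrAC (addrAC t0) subrr add0r.
Qed.

Lemma dt_ge0 : 0 <= dt.
Proof. by rewrite dtE divr_ge0 ?(ltW tau_gt0)// subr_ge0; have [] := step_optimality. Qed.

Lemma dt_dz : dt + nv dz = 1.
Proof.
have t0 := tau_gt0; rewrite dtE dzE (nvZ hP) gtr0_norm ?invr_gt0//.
by rewrite mulrC -mulrDr subrK mulVf// gt_eqF.
Qed.

Lemma nv_dz_le1 : nv dz <= 1.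
Proof. by have := dt_dz; have := dt_ge0; lra. Qed.

Lemma dt_le1 : dt <= 1.
Proof. by have := dt_dz; have := nv_ge0 P dz; lra. Qed.

Lemma thatE s : that s = t0 + (s - s0) * dt.
Proof. by rewrite /st_that /st_dt mulrA [in LHS]mulrAC. Qed.

Lemma zhatE s : zhat s = st_z x + (s - s0) *: dz.
Proof. by rewrite /st_zhat /st_dz scalerA. Qed.

End Step.

Section StepArithmetic.
Variable R : realFieldType.
Implicit Types a b c d e : R.

Lemma step_i2_bar_arith a b c e : a + (b + c) + (e - c) = a + b + e.
Proof. ring. Qed.

Lemma step_i2_diff_arith a b c d e : a + b + c - (d + b + e) = a - d + (c - e).
Proof. ring. Qed.

Lemma step_i2_bound_arith a b c : a * (1 + b) * (1 + b) * c =
  a * ((1 + b) * c) * b + a * ((1 + b) * c).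
Proof. ring. Qed.

End StepArithmetic.

(** * The error indicators of one step *)

Section StepIntegral.
Context {R : realType} {Z W V X : completeNormedModType R}.
Variable P : ris_data Z W V X.
Hypothesis hP : assumptions P.
Hypothesis hZV : Z_eq_V P.
Local Notation T := (Tend P).
Local Notation en := (energy P).
Local Notation nv := (nv P).
Local Notation Rd := (Rd P).
Local Notation DE := (DE P).
Local Notation Gd := (Gd P).
Local Notation mu := (@lebesgue_measure R).

Variables (M L C : R).
Hypothesis L_gt0 : 0 < L.
Hypothesis C_gt0 : 0 < C.
Hypothesis DEL : forall t1 t2 z1 z2 v, 0 <= t1 -> 0 <= t2 -> `|z1| <= M -> `|z2| <= M ->
  `|DE t1 z1 v - DE t2 z2 v| <= L * (`|t1 - t2| + `|z1 - z2|) * `|v|.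
Hypothesis GdL : forall t1 t2 z1 z2, 0 <= t1 -> 0 <= t2 -> `|z1| <= M -> `|z2| <= M ->
  `|Gd t1 z1 - Gd t2 z2| <= L * (`|t1 - t2| + `|z1 - z2|).
Hypothesis nvC : forall v, `|v| <= C * nv v.

Variable x : @step R Z.
Hypothesis vx : valid_step P x.
Hypothesis tx : 0 <= st_t x.
Hypothesis zM : `|st_z x| <= M.
Hypothesis znM : `|st_znew x| <= M.

Local Notation t0 := (st_t x).
Local Notation s0 := (st_s x).
Local Notation s1 := (st_snew x).
Local Notation tau := (st_tau x).
Local Notation zn := (st_znew x).
Local Notation Dl := (st_znew x - st_z x).
Local Notation that := (st_that P x).
Local Notation zhat := (st_zhat x).
Local Notation dz := (st_dz x).
Local Notation dt := (st_dt P x).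

Let tau0 := tau_gt0 vx.
Let dt0 := dt_ge0 hP hZV vx tx.

Definition step_i1 (s : R) : R := dt * Gd (that s) (zhat s).
(** The integrand of [st_I2] after the terms at the old time and new state have cancelled by the
    optimality condition [DE_bar_dz]. What remains is a duality gap, nonnegative by the definition
    of [Gd]. *)
Definition step_i2 (s : R) : R :=
  DE (that s) (zhat s) dz + Rd dz + nv dz * Gd (that s) (zhat s).

Lemma that_ge0 s : s0 <= s -> 0 <= that s.
Proof. by move=> h; rewrite thatE addr_ge0// mulr_ge0// subr_ge0. Qed.

Lemma thatB a b : that b - that a = (b - a) * dt.
Proof. by rewrite !thatE; ring. Qed.

Lemma zhatB a b : zhat b - zhat a = (b - a) *: dz.
Proof. by rewrite !zhatE opprD addrACA subrr add0r -scalerBl opprB addrA subrK. Qed.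

Lemma zhatM s : s0 <= s <= s1 -> `|zhat s| <= M.
Proof.
move=> /andP[h1 h2]; rewrite /st_zhat; apply: segment_norm_le => //.
rewrite divr_ge0 ?subr_ge0 ?(ltW tau0)//= ler_pdivrMr// mul1r lerBlDl.
exact: h2.
Qed.

Lemma norm_dz : `|dz| <= C.
Proof.
rewrite (le_trans (nvC _))// ler_piMr ?(ltW C_gt0)//.
exact: nv_dz_le1 vx tx.
Qed.

Lemma DE_bar_dz : - DE t0 zn dz = Rd dz + nv dz * Gd t0 zn.
Proof.
have [_ h _] := step_optimality hP hZV vx tx.
have ti : 0 <= tau^-1 by rewrite invr_ge0 ltW.
rewrite dzE (in_dualZ _ _ (DE_dual hP _ tx)) (RdZ hP)// (nvZ hP) ger0_norm//.
by rewrite -mulrN h mulrDr mulrA.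
Qed.

Lemma dt_bar : dt * Gd t0 zn = 0.
Proof.
have [_ _ h] := step_optimality hP hZV vx tx.
by rewrite dtE mulrAC h mul0r.
Qed.

Lemma st_i2E s : s0 <= s -> ((st_r P x s)%:E + (nv dz)%:E *
  (dist_DE P (that s) (zhat s) - dist_DE P t0 zn))%E = (step_i2 s)%:E.
Proof.
move=> hs; have ts := that_ge0 hs.
have [_ -> _ _] := GdP hP hZV (zhat s) ts; have [_ -> _ _] := GdP hP hZV zn tx.
rewrite -EFinB -EFinM -EFinD /st_r !(DzE_E hP)//; congr EFin.
rewrite DE_bar_dz mulrBr /step_i2.
exact: step_i2_bar_arith.
Qed.

Lemma st_i1E s : s0 <= s -> (dt%:E * dist_DE P (that s) (zhat s))%E = (step_i1 s)%:E.
Proof.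
by move=> hs; have [_ -> _ _] := GdP hP hZV (zhat s) (that_ge0 hs); rewrite -EFinM.
Qed.

Lemma step_i1_ge0 s : s0 <= s -> 0 <= step_i1 s.
Proof.
by move=> hs; have [g0 _ _ _] := GdP hP hZV (zhat s) (that_ge0 hs); rewrite mulr_ge0.
Qed.

Lemma step_i2_ge0 s : s0 <= s -> 0 <= step_i2 s.
Proof.
move=> hs; have [_ _ /(_ dz) h _] := GdP hP hZV (zhat s) (that_ge0 hs).
by rewrite /step_i2 -addrA (mulrC (nv dz)) -lerBlDl sub0r.
Qed.

Lemma hat_bar s : s0 <= s <= s1 -> `|that s - t0| + `|zhat s - zn| <= (1 + C) * tau.
Proof.
move=> /andP[h1 h2]; rewrite mulrDl mul1r lerD//.
  have s_ge0 : 0 <= s - s0 by rewrite subr_ge0.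
  have s_le : s - s0 <= tau by rewrite lerBlDl; exact: h2.
  rewrite thatE addrAC subrr add0r ger0_norm; last exact: mulr_ge0 s_ge0 dt0.
  by apply: le_trans s_le; apply: ler_piMr => //; exact: dt_le1.
have -> : zhat s - zn = (s - s1) *: dz.
  rewrite -zhatB; congr (_ - _); rewrite /st_zhat.
  have -> : s1 - s0 = tau by rewrite /st_snew addrAC subrr add0r.
  by rewrite divff ?gt_eqF// scale1r addrC subrK.
have d1 : `|s - s1| <= tau.
  rewrite distrC ger0_norm ?subr_ge0// lerBlDr /st_snew [s0 + tau]addrC lerD2l.
  exact: h1.
by rewrite normrZ mulrC ler_pM// norm_dz.
Qed.

(** By complementarity, [dt_bar], the value of [Gd] at the old time and new state may be subtracted,
    which leaves a difference over a distance at most (1 + C) tau. The second factor 1 + C makes the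
    constant the same as in [step_i2_le]. *)
Lemma step_i1_le s : s0 <= s <= s1 -> step_i1 s <= L * (1 + C) * (1 + C) * tau.
Proof.
move=> hs; have /andP[h1 h2] := hs.
have -> : step_i1 s = dt * (Gd (that s) (zhat s) - Gd t0 zn).
  by rewrite /step_i1 mulrBr [X in _ - X]dt_bar subr0.
have g : Gd (that s) (zhat s) - Gd t0 zn <= L * ((1 + C) * tau).
  rewrite (le_trans (ler_norm _))// (le_trans (GdL (that_ge0 h1) tx (zhatM hs) znM))//.
  by rewrite ler_pM2l// hat_bar.
rewrite (le_trans (ler_wpM2l dt0 g))//.
rewrite (@le_trans _ _ (L * ((1 + C) * tau)))//.
  rewrite ler_piMl//; last exact: dt_le1.
  by rewrite !mulr_ge0 ?(ltW L_gt0) ?(ltW tau0)// addr_ge0// ltW.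
rewrite !mulrA ler_wpM2r ?(ltW tau0)// ler_peMr ?lerDl ?(ltW C_gt0)//.
by rewrite mulr_ge0 ?(ltW L_gt0)// addr_ge0// ltW.
Qed.

Lemma step_i2_le s : s0 <= s <= s1 -> step_i2 s <= L * (1 + C) * (1 + C) * tau.
Proof.
move=> hs; have /andP[h1 h2] := hs.
have -> : step_i2 s = (DE (that s) (zhat s) dz - DE t0 zn dz) +
    nv dz * (Gd (that s) (zhat s) - Gd t0 zn).
  rewrite DE_bar_dz mulrBr /step_i2.
  exact/esym/step_i2_bar_arith.
have hb := hat_bar hs; have ts := that_ge0 h1; have zs := zhatM hs.
have K0 : 0 <= L * ((1 + C) * tau).
  by rewrite !mulr_ge0 ?(ltW L_gt0) ?(ltW tau0)// addr_ge0// ltW.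
have g : Gd (that s) (zhat s) - Gd t0 zn <= L * ((1 + C) * tau).
  by rewrite (le_trans (ler_norm _))// (le_trans (GdL ts tx zs znM))// ler_pM2l.
have d : DE (that s) (zhat s) dz - DE t0 zn dz <= L * ((1 + C) * tau) * C.
  rewrite (le_trans (ler_norm _))// (le_trans (DEL _ ts tx zs znM))//.
  by rewrite ler_pM ?norm_dz// ?ler_pM2l// mulr_ge0 ?(ltW L_gt0)// addr_ge0.
have -> : L * (1 + C) * (1 + C) * tau = L * ((1 + C) * tau) * C + L * ((1 + C) * tau).
  exact: step_i2_bound_arith.
rewrite lerD// (le_trans (ler_wpM2l (nv_ge0 P dz) g))// ler_piMl//.
exact: nv_dz_le1 vx tx.
Qed.

Let st_clamp s := s0 + clamp tau (s - s0).

Let st_clamp_itv s : s0 <= st_clamp s <= s1.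
Proof.
have /andP[h1 h2] := clamp_itv (s - s0) (ltW tau0).
by rewrite /st_clamp lerDl h1/= /st_snew lerD2l.
Qed.

Let st_clamp_id s : s0 <= s <= s1 -> st_clamp s = s.
Proof.
move=> /andP[h1 h2]; rewrite /st_clamp clamp_id ?(addrC s0) ?subrK//.
by rewrite subr_ge0 h1 lerBlDl.
Qed.

Let st_clamp_lip s s' : `|st_clamp s - st_clamp s'| <= `|s - s'|.
Proof.
rewrite /st_clamp opprD addrACA subrr add0r.
rewrite (le_trans (clamp_lipschitz _ _ (ltW tau0)))//.
by rewrite opprD addrACA opprK [- s0 + _]addrC subrr addr0.
Qed.

Let hat_lip a b : `|that a - that b| + `|zhat a - zhat b| <= (1 + C) * `|a - b|.
Proof.
rewrite mulrDl mul1r lerD//.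
  rewrite thatB; have := dt0; have := dt_le1 hP vx; move: dt => w w1 w0.
  by rewrite normrM (ger0_norm w0) ler_piMr.
by rewrite zhatB normrZ mulrC ler_wpM2r// norm_dz.
Qed.

Let Gd_hat_lip a b : s0 <= a <= s1 -> s0 <= b <= s1 ->
  `|Gd (that a) (zhat a) - Gd (that b) (zhat b)| <= L * (1 + C) * `|a - b|.
Proof.
move=> ha hb; have [h1 _] := andP ha; have [h2 _] := andP hb.
rewrite (le_trans (GdL (that_ge0 h1) (that_ge0 h2) (zhatM ha) (zhatM hb)))//.
by rewrite -mulrA ler_pM2l// hat_lip.
Qed.

Lemma step_i1_continuous : continuous (step_i1 \o st_clamp).
Proof.
apply: (@lipschitz_continuous _ _ (L * (1 + C))) => a b.
rewrite /step_i1/= -mulrBr; have := dt0; have := dt_le1 hP vx.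
set w := dt; move: (w) => {}w w1 w0; rewrite normrM (ger0_norm w0).
rewrite (@le_trans _ _ (`|Gd (that (st_clamp a)) (zhat (st_clamp a)) -
  Gd (that (st_clamp b)) (zhat (st_clamp b))|))//.
  by apply: ler_piMl.
rewrite (le_trans (Gd_hat_lip (st_clamp_itv a) (st_clamp_itv b)))//.
by rewrite ler_wpM2l ?st_clamp_lip// mulr_ge0 ?(ltW L_gt0)// addr_ge0// ltW.
Qed.

Lemma step_i2_continuous : continuous (step_i2 \o st_clamp).
Proof.
apply: (@lipschitz_continuous _ _ (L * (1 + C) * C + L * (1 + C))) => a b.
have ha := st_clamp_itv a; have hb := st_clamp_itv b.
have [ha1 _] := andP ha; have [hb1 _] := andP hb.
have L1 : 0 <= L * (1 + C) by rewrite mulr_ge0 ?(ltW L_gt0)// addr_ge0// ltW.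
rewrite /step_i2/=.
set a' := st_clamp a; set b' := st_clamp b.
have -> : DE (that a') (zhat a') dz + Rd dz + nv dz * Gd (that a') (zhat a') -
   (DE (that b') (zhat b') dz + Rd dz + nv dz * Gd (that b') (zhat b')) =
   (DE (that a') (zhat a') dz - DE (that b') (zhat b') dz) +
   nv dz * (Gd (that a') (zhat a') - Gd (that b') (zhat b')).
  by rewrite mulrBr; exact: step_i2_diff_arith.
rewrite (le_trans (ler_normD _ _))// mulrDl lerD//.
  rewrite (le_trans (DEL _ (that_ge0 ha1) (that_ge0 hb1) (zhatM ha) (zhatM hb)))//.
  rewrite -[leRHS]mulrAC ler_pM ?norm_dz//.
    by rewrite mulr_ge0 ?(ltW L_gt0)// addr_ge0.
  rewrite -mulrA ler_pM2l// (le_trans (hat_lip _ _))// ler_wpM2l ?st_clamp_lip//.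
  by rewrite addr_ge0// ltW.
rewrite normrM ger0_norm ?nv_ge0//.
rewrite (@le_trans _ _ (`|Gd (that a') (zhat a') - Gd (that b') (zhat b')|))//.
  by rewrite ler_piMl//; exact: nv_dz_le1 vx tx.
by rewrite (le_trans (Gd_hat_lip ha hb))// ler_wpM2l ?st_clamp_lip.
Qed.

(** Nonnegativity passes the bound tol from the whole step to any subinterval, while the pointwise
    bound gives an error proportional to tau and to the length. Composition with [st_clamp] supplies
    measurability. *)
Lemma step_integral_le (i : R -> R) (a b tol : R) :
  continuous (i \o st_clamp) -> (forall s, s0 <= s <= s1 -> 0 <= i s) ->
  (forall s, s0 <= s <= s1 -> i s <= L * (1 + C) * (1 + C) * tau) ->
  s0 <= a -> a <= b -> b <= s1 ->
  (\int[mu]_(s in `]s0, s1[) (i s)%:E < tol%:E)%E ->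
  [/\ mu.-integrable `]a, b[ (EFin \o i), Rintegral mu `]a, b[ i <= tol
    & Rintegral mu `]a, b[ i <= L * (1 + C) * (1 + C) * tau * (b - a)].
Proof.
move=> ic i0 iK sa ab bs itol.
have mi' (D : set R) : measurable_fun D (i \o st_clamp).
  by apply: measurable_funTS; exact: continuous_measurable_fun.
have mi c d : s0 <= c -> d <= s1 -> measurable_fun `]c, d[ i.
  move=> sc ds; apply: (@eq_measurable_fun _ _ _ _ _ (i \o st_clamp)) (mi' _) => s.
  rewrite inE/= in_itv/= => /andP[cs sd]; rewrite /= st_clamp_id//.
  by rewrite (le_trans sc (ltW cs)) (le_trans (ltW sd) ds).
have in_ab s : a < s < b -> s0 <= s <= s1.
  by move=> /andP[h1 h2]; rewrite (le_trans sa (ltW h1)) (le_trans (ltW h2) bs).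
have iab s : a < s < b -> `|i s| <= L * (1 + C) * (1 + C) * tau.
  by move=> /in_ab sab; rewrite ger0_norm ?i0// iK.
have int := bounded_integrable_oo (mi _ _ sa bs) iab.
split => //.
- rewrite -lee_fin fineK; last exact: integrable_fin_num.
  apply: (le_trans _ (ltW itol)).
  apply: ge0_subset_integral => //.
  + by apply/measurable_EFinP; exact: mi.
  + move=> s; rewrite /= in_itv/= => /andP[h1 h2].
    by rewrite lee_fin i0// (ltW h1) (ltW h2).
  + move=> s; rewrite /= !in_itv/= => /andP[h1 h2].
    by rewrite (le_lt_trans sa h1) (lt_le_trans h2 bs).
- rewrite (le_trans (ler_norm _))//.
  exact: (normr_Rintegral_oo_le ab (mi _ _ sa bs) iab).
Qed.

Lemma st_I1_int : st_I1 P x = (\int[mu]_(s in `]s0, s1[) (step_i1 s)%:E)%E.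
Proof.
rewrite /st_I1; apply: eq_integral => s; rewrite inE/= in_itv/= => /andP[h1 _].
by rewrite st_i1E// ltW.
Qed.

Lemma st_I2_int : st_I2 P x = (\int[mu]_(s in `]s0, s1[) (step_i2 s)%:E)%E.
Proof.
rewrite /st_I2; apply: eq_integral => s; rewrite inE/= in_itv/= => /andP[h1 _].
by rewrite st_i2E// ltW.
Qed.

End StepIntegral.

Section WithinContinuity.
Context {R : realType}.

Lemma lipschitz_within (f : R -> R) (K a b : R) :
  (forall x y, a <= x <= b -> a <= y <= b -> `|f x - f y| <= K * `|x - y|) ->
  {within `[a, b], continuous f}.
Proof.
move=> fK; apply/subspace_continuousP => x; rewrite /= in_itv/= => xab.
apply/cvgrPdist_le => e e0.
have K1 : 0 < `|K| + 1 by rewrite ltr_wpDl.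
rewrite near_withinE; near=> y => /=; rewrite in_itv/= => yab.
rewrite (le_trans (fK _ _ xab yab))// (@le_trans _ _ ((`|K| + 1) * `|x - y|))//.
  by rewrite ler_wpM2r// (le_trans (ler_norm _))// lerDl.
rewrite mulrC -ler_pdivlMr//; near: y.
by apply: cvgr_dist_le; [exact: cvg_id|exact: divr_gt0].
Unshelve. all: by end_near. Qed.

Context {Z W V X : completeNormedModType R}.
Variable P : ris_data Z W V X.
Hypothesis hP : assumptions P.

Lemma load_t_within (D : set R) (t : R -> R) (z : R -> Z) (x : R) :
  t @ x --> t x -> z @ x --> z x -> (forall s, D s -> 0 <= t s <= Tend P) -> D x ->
  load_t P (t s) (z s) @[s --> within D (nbhs x)] --> load_t P (t x) (z x).
Proof.
move=> ct cz tT Dx; have /subspace_continuousP H := f_ft_cont (f_isC1 (as_f hP)).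
have {}H := H (t x, z x) (tT _ Dx); apply/cvgrPdist_le => e e0.
have /cvgrPdist_le/(_ e e0) He := H.
have c : (t s, z s) @[s --> x] --> (t x, z x) by exact: (cvg_pair ct cz).
have Hc : \forall s \near x, 0 <= t s <= Tend P ->
    `|load_t P (t x) (z x) - load_t P (t s) (z s)| <= e := c _ He.
by rewrite near_withinE; apply: filterS Hc => s h /tT.
Qed.

End WithinContinuity.

Lemma step_energy_arith {R : realFieldType} (l d r g G D : R) :
  l <= d -> g <= G -> l + D <= d - r - g + (D + r + G).
Proof. lra. Qed.

(** * The energy inequality along one step *)

Section StepEnergy.
Context {R : realType} {Z W V X : completeNormedModType R}.
Variable P : ris_data Z W V X.
Hypothesis hP : assumptions P.
Hypothesis hZV : Z_eq_V P.
Local Notation T := (Tend P).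
Local Notation en := (energy P).
Local Notation nv := (nv P).
Local Notation Rd := (Rd P).
Local Notation DE := (DE P).
Local Notation Gd := (Gd P).
Local Notation mu := (@lebesgue_measure R).
Variable x : @step R Z.
Hypothesis vx : valid_step P x.
Hypothesis tx : 0 <= st_t x.

Local Notation s0 := (st_s x).
Local Notation s1 := (st_snew x).
Local Notation that := (st_that P x).
Local Notation zhat := (st_zhat x).
Local Notation dz := (st_dz x).
Local Notation dt := (st_dt P x).

Lemma that_derive (s : R) : is_derive s 1 that dt.
Proof.
have := (@is_deriveE R R^o that s dt).1; apply.
apply: cvg_near_cst; near=> h.
have h0 : h != 0 by near: h; exact: nbhs_dnbhs_neq.
by rewrite thatB addrK /GRing.scale/= mulKf.
Unshelve. all: by end_near. Qed.

Lemma zhat_derive (s : R) : is_derive s 1 zhat dz.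
Proof.
apply/is_deriveE; apply: cvg_near_cst; near=> h.
have h0 : h != 0 by near: h; exact: nbhs_dnbhs_neq.
by rewrite zhatB addrK scalerA mulVf// scale1r.
Unshelve. all: by end_near. Qed.

Lemma that_continuous (s : R) : that @ s --> that s.
Proof. by apply/differentiable_continuous/derivable1_diffP; exact: (@ex_derive _ _ _ _ _ _ _ (that_derive s)). Qed.

Lemma zhat_continuous (s : R) : zhat @ s --> zhat s.
Proof. by apply/differentiable_continuous/derivable1_diffP; exact: (@ex_derive _ _ _ _ _ _ _ (zhat_derive s)). Qed.

Lemma that_mono a b : a <= b -> that a <= that b.
Proof.
move=> ab; rewrite -subr_ge0 thatB; apply: mulr_ge0; first by rewrite subr_ge0.
exact: (dt_ge0 hP hZV vx tx).
Qed.

(** The derivative of the energy along the step is integrated, its state part being rewritten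
    through [step_i2]. The interpolant is affine, so the dissipation and the norm of its increment
    are exactly the integrals of those of [dz]. *)
Lemma step_energy_le a b g d : s0 <= a -> a <= b -> b <= s1 -> that b <= T ->
  mu.-integrable `]a, b[ (EFin \o step_i2 P x) ->
  (forall s, a <= s <= b -> g <= Gd (that s) (zhat s)) ->
  (forall s, a <= s <= b -> - load_t P (that s) (zhat s) <= d) ->
  en (that b) (zhat b) - en (that a) (zhat a) + Rd (zhat b - zhat a) +
    g * nv (zhat b - zhat a) <= d * (that b - that a) + Rintegral mu `]a, b[ (step_i2 P x).
Proof.
move=> sa; rewrite le_eqVlt => /predU1P[<-|ab].
  move=> _ _ _ _ _; rewrite !subrr (Rd0 hP) (nv0 hP) !mulr0 !add0r.
  rewrite (_ : `]a, a[%classic = set0) ?Rintegral_set0//.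
  by apply/seteqP; split => y //=; rewrite in_itv/=; lra.
move=> bs bT int gG ld.
pose F s := en (that s) (zhat s).
pose f s := - load_t P (that s) (zhat s) * dt + DE (that s) (zhat s) dz.
have ab' := ltW ab.
have tT s : a <= s <= b -> 0 <= that s <= T.
  move=> /andP[h1 h2]; rewrite (that_ge0 hP hZV vx tx (le_trans sa h1))/=.
  by rewrite (le_trans _ bT)// that_mono.
pose M := Num.max `|st_z x| `|st_znew x|.
have zM s : a <= s <= b -> `|zhat s| <= M.
  move=> /andP[h1 h2]; apply: (zhatM vx); rewrite ?/M ?le_max ?lexx ?orbT//.
  by rewrite (le_trans sa h1) (le_trans h2 bs).
have [K K0 KP] := energy_lipschitz hP M.
have [L L0 LP] := DE_lipschitz hP M.
have hl s s' : `|that s - that s'| + `|zhat s - zhat s'| <= (`|dt| + `|dz|) * `|s - s'|.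
  rewrite zhatB thatB; move: dt => w.
  by rewrite normrM normrZ mulrDl (mulrC `|w|) (mulrC `|dz|).
have Fl s s' : a <= s <= b -> a <= s' <= b -> `|F s - F s'| <= K * (`|dt| + `|dz|) * `|s - s'|.
  move=> hs hs'; rewrite (le_trans (KP _ _ _ _ (tT _ hs) (tT _ hs') (zM _ hs) (zM _ hs')))//.
  by rewrite -mulrA ler_pM2l.
have Dl s s' : a <= s <= b -> a <= s' <= b ->
    `|DE (that s) (zhat s) dz - DE (that s') (zhat s') dz| <= L * (`|dt| + `|dz|) * `|dz| * `|s - s'|.
  move=> hs hs'; have [/andP[h1 _] /andP[h2 _]] := (tT _ hs, tT _ hs').
  rewrite (le_trans (LP _ _ _ _ _ h1 h2 (zM _ hs) (zM _ hs')))// [leRHS]mulrAC.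
  by rewrite ler_wpM2r// -mulrA ler_pM2l.
have Fc : {within `[a, b], continuous F} := lipschitz_within Fl.
have Dc : {within `[a, b], continuous (fun s => DE (that s) (zhat s) dz)} := lipschitz_within Dl.
have fc : {within `[a, b], continuous f}.
  apply/subspace_continuousP => y yab; apply: cvgD; last first.
    by move/subspace_continuousP : Dc; exact.
  apply: cvgM; last exact: cvg_cst.
  apply: cvgN; apply: load_t_within => //.
    exact: that_continuous.
  exact: zhat_continuous.
have Fd s : s \in `]a, b[ -> is_derive s 1 F (f s).
  rewrite in_itv/= => /andP[h1 h2]; apply: energy_curve_derive => //.
  - exact: that_derive.
  - exact: zhat_derive.
  - near=> y; apply: tT; apply/andP; split; apply: ltW.
      by near: y; exact: lt_nbhsr.
    by near: y; exact: lt_nbhsl.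
have FTC : (\int[mu]_(s in `[a, b]) (f s)%:E = (F b)%:E - (F a)%:E)%E.
  apply: continuous_FTC2 => //.
    move/(continuous_within_itvP _ ab) : Fc => [_ h1 h2]; split => //.
    by move=> y /Fd dy; exact: ex_derive.
  by move=> y /Fd dy; rewrite derive1E derive_val.
have intf : mu.-integrable `[a, b] (EFin \o f).
  by apply: continuous_compact_integrable => //; exact: segment_compact.
have intf' : mu.-integrable `]a, b[ (EFin \o f).
  by apply: integrableS intf => //; exact: subset_itv_oo_cc.
have intf2 : mu.-integrable `]a, b] (EFin \o f).
  by apply: integrableS intf => //; exact: subset_itv_oc_cc.
have FE : F b - F a = Rintegral mu `]a, b[ f.
  by rewrite Rintegral_itv_bndo_bndc// Rintegral_itv_obnd_cbnd// /Rintegral FTC -EFinB.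
pose c := d * dt - Rd dz - g * nv dz.
have fle : Rintegral mu `]a, b[ f <= c * (b - a) + Rintegral mu `]a, b[ (step_i2 P x).
  rewrite -(Rintegral_oo_cst c ab') -RintegralD//; last exact: (integrable_oo_cst a b c).
  apply: le_Rintegral => //.
    by apply: integrable_ooD => //; exact: (integrable_oo_cst a b c).
  move=> s; rewrite /= in_itv/= => /andP[h1 h2].
  have hs : a <= s <= b by rewrite !ltW.
  rewrite /f /c /step_i2; apply: step_energy_arith.
    by rewrite ler_wpM2r ?ld//; exact: (dt_ge0 hP hZV vx tx).
  by rewrite [leRHS]mulrC ler_wpM2r ?gG// nv_ge0.
have ba : 0 <= b - a by rewrite subr_ge0.
rewrite -/(F b) -/(F a) FE zhatB thatB (RdZ hP)// (nvZ hP) (ger0_norm ba).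
rewrite -lerBrDr -lerBrDr (le_trans fle)// /c.
move: (Rintegral _ _ _) (b - a) (Rd dz) (nv dz) dt => i w r n u.
by rewrite le_eqVlt; apply/orP; left; apply/eqP; ring.
Unshelve. all: by end_near. Qed.

End StepEnergy.

(** A number below two nonnegative bounds is below their geometric mean. *)
Lemma sqrt_interpolation {R : rcfType} (K tol tau e : R) : 0 <= K -> 0 <= tol -> 0 <= tau ->
  e <= tol -> e <= K * tau * tau -> e <= Num.sqrt (K * tol) * tau.
Proof.
move=> K0 tol0 tau0 e1 e2.
have r0 : 0 <= Num.sqrt (K * tol) * tau by rewrite mulr_ge0// sqrtr_ge0.
have [e0|e0] := leP e 0; first exact: le_trans r0.
rewrite -(@ler_pXn2r _ 2)// ?nnegrE ?(ltW e0)//.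
rewrite exprMn sqr_sqrtr ?mulr_ge0// [leRHS](_ : _ = tol * (K * tau * tau)); last first.
  by rewrite expr2; ring.
by rewrite expr2 ler_pM// ltW.
Qed.

(** * Runs of the adaptive algorithm *)

Section Chain.
Context {R : realType}.
Variables (s : nat -> R) (N : nat).
Hypothesis s0 : s 0%N = 0.
Hypothesis s_lt : forall k, (k < N)%N -> s k < s k.+1.

Lemma chain_le j k : (j <= k)%N -> (k <= N)%N -> s j <= s k.
Proof.
elim: k => [|k IH]; first by rewrite leqn0 => /eqP ->.
rewrite leq_eqVlt => /predU1P[->//|jk] kN.
by rewrite (le_trans (IH jk (ltnW kN)))// ltW// s_lt.
Qed.

Lemma chain_cell x : (0 < N)%N -> 0 <= x -> x <= s N ->
  exists2 k, (k < N)%N & s k <= x <= s k.+1.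
Proof.
move=> N0 x0; move: {-2}N (leqnn N) N0; elim=> [//|k IH] kN _ xs.
have [kx|xk] := leP (s k) x; first by exists k => //; rewrite kx.
have [k0|k0] := posnP k; first by move: xk; rewrite k0 s0 ltNge x0.
by have [j jk jx] := IH (ltnW kN) k0 (ltW xk); exists j => //; exact: ltnW.
Qed.

Lemma chain_find x k : (k < N)%N -> s k <= x < s k.+1 ->
  find (fun k => x < s k.+1) (iota 0 N) = k.
Proof.
move=> kN /andP[kx xk]; set p := fun k => _; set i := find p _.
have hp : has p (iota 0 N).
  by apply/hasP; exists k; rewrite ?mem_iota//= add0n.
have iN : (i < N)%N by move: (hp); rewrite has_find size_iota.
have pi : x < s i.+1 by have := nth_find 0%N hp; rewrite -/i nth_iota.
have [ik|ki|//] := ltngtP i k.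
  by move: (lt_le_trans pi (chain_le ik (ltnW kN))); rewrite ltNge kx.
by have := before_find 0%N ki; rewrite nth_iota// add0n /p xk.
Qed.

Lemma chain_find_end x : s N <= x -> find (fun k => x < s k.+1) (iota 0 N) = N.
Proof.
move=> Nx; rewrite -[RHS](size_iota 0 N); apply: hasNfind.
apply/hasPn => k; rewrite mem_iota/= add0n => kN.
by rewrite -leNgt (le_trans _ Nx)// chain_le.
Qed.

Variables (Q : R -> R -> R -> Prop) (tol c : R).
Hypothesis tol0 : 0 <= tol.
Hypothesis c0 : 0 <= c.
Hypothesis Qrefl : forall a, Q a a 0.
Hypothesis Qtrans : forall a b d e e', a <= b -> b <= d ->
  Q a b e -> Q b d e' -> Q a d (e + e').
Hypothesis Qcell : forall k a b, (k < N)%N -> s k <= a -> a <= b -> b <= s k.+1 -> Q a b tol.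
Hypothesis Qfull : forall k, (k.+1 < N)%N -> Q (s k) (s k.+1) (c * (s k.+1 - s k)).

(** At most two cells are met partially, at a cost of tol each; the full cells between them cost c
    times their length and all precede the last one. The length is therefore measured up to
    [s N.-1], where time has not yet reached T in a run, rather than up to [s N], which may
    overshoot. *)
Lemma chain_ind a b : (0 < N)%N -> 0 <= a -> a <= b -> b <= s N ->
  exists2 e, e <= tol + tol + c * s N.-1 & Q a b e.
Proof.
move=> N0 a0 ab bN; have [k kN /andP[ka ak]] := chain_cell N0 a0 (le_trans ab bN).
have [l lN /andP[lb bl]] := chain_cell N0 (le_trans a0 ab) bN.
have s_ge0 j : (j <= N)%N -> 0 <= s j by rewrite -s0; exact: chain_le.
have [bk|kb] := leP b (s k.+1).
  exists tol; last exact: Qcell kN ka ab bk.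
  by rewrite -addrA lerDl addr_ge0// mulr_ge0// s_ge0// leq_pred.
have kl : (k < l)%N.
  by rewrite ltnNge; apply/negP => lk; move: (lt_le_trans kb bl); rewrite ltNge chain_le.
have node j : (k < j)%N -> (j <= l)%N -> Q (s k.+1) (s j) (c * (s j - s k.+1)).
  elim: j => [//|j IH]; rewrite ltnS leq_eqVlt => /predU1P[<- _|kj jl].
    by rewrite subrr mulr0.
  have jN : (j < N)%N by rewrite (leq_trans jl)// ltnW.
  rewrite [X in Q _ _ X](_ : _ = c * (s j - s k.+1) + c * (s j.+1 - s j)); last by ring.
  apply: Qtrans (IH kj (ltnW jl)) _; [exact: chain_le kj (ltnW jN)|exact: ltW (s_lt jN)|].
  by apply: Qfull; exact: leq_ltn_trans jl lN.
exists (tol + (c * (s l - s k.+1) + tol)).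
  rewrite (addrC _ tol) addrA lerD2l ler_wpM2l// (@le_trans _ _ (s l))//.
    by rewrite lerBlDl lerDr s_ge0.
  by rewrite chain_le ?leq_pred// -ltnS prednK.
apply: (Qtrans ak (ltW kb)); first exact: Qcell kN ka ak (lexx _).
apply: (Qtrans _ lb); [exact: chain_le kl (ltnW lN)|exact: node kl (leqnn _)|].
exact: Qcell lN (lexx _) lb bl.
Qed.

End Chain.

Section Run.
Context {R : realType} {Z W V X : completeNormedModType R}.
Variable P : ris_data Z W V X.
Hypothesis hP : assumptions P.
Hypothesis hZV : Z_eq_V P.
Local Notation T := (Tend P).
Local Notation en := (energy P).
Local Notation nv := (nv P).
Local Notation Rd := (Rd P).

Lemma iteration_accepted tol s t z sigma tau znew :
  iteration P tol s t z sigma tau znew ->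
  valid_step P (Step s t z tau znew) /\ below P tol (Step s t z tau znew).
Proof. by elim. Qed.

Section Curve.
Variables (tol tau1 : R) (tau : nat -> R) (z : nat -> Z) (N : nat).
Hypothesis hrun : adaptive_run P tol tau1 tau z N.
Local Notation x := (step_of P tau z).
Local Notation s := (sseq tau).
Local Notation t := (tseq P tau z).
Local Notation that := (that P tau z N).
Local Notation zhat := (zhat P tau z N).

Lemma sseq0 : s 0%N = 0.
Proof. by rewrite /sseq big_geq. Qed.

Lemma sseqS k : s k.+1 = s k + tau k.+1.
Proof. by rewrite /sseq big_nat_recr. Qed.

Lemma run_step k : (k < N)%N -> valid_step P (x k) /\ below P tol (x k).
Proof. by case: hrun => _ /(_ k) + _ => /[apply] -[_ /iteration_accepted]. Qed.

Lemma run_t_lt k : (k < N)%N -> t k < T.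
Proof. by case: hrun => _ /(_ k) + _ => /[apply] -[]. Qed.

Lemma run_z0 : z 0%N = z0 P. Proof. by case: hrun. Qed.

Lemma run_end : T <= t N. Proof. by case: hrun. Qed.

Lemma run_t_ge0 k : (k <= N)%N -> 0 <= t k.
Proof.
elim: k => [//|k IH] kN; have tk := IH (ltnW kN).
have [vx _] := run_step kN; have [h _ _] := step_optimality hP hZV vx tk.
by rewrite /= -addrA addr_ge0// subr_ge0.
Qed.

Lemma run_t_le k : (k < N)%N -> t k <= t k.+1.
Proof.
move=> kN; have [vx _] := run_step kN.
have [h _ _] := step_optimality hP hZV vx (run_t_ge0 (ltnW kN)).
by rewrite /= -addrA lerDl subr_ge0.
Qed.

Lemma run_N_gt0 : (0 < N)%N.
Proof.
rewrite lt0n; apply/eqP => N0; have := run_end; rewrite N0 /= leNgt.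
by rewrite (T_gt0 hP).
Qed.

Lemma run_s_lt k : (k < N)%N -> s k < s k.+1.
Proof. by move=> kN; rewrite sseqS ltrDl; have [/tau_gt0] := run_step kN. Qed.

Lemma hat_cell k r : (k < N)%N -> s k <= r < s k.+1 ->
  that r = st_that P (x k) r /\ zhat r = st_zhat (x k) r.
Proof.
move=> kN kr; rewrite /Defs.that /Defs.zhat.
have -> : cell tau N r = k by exact: (chain_find run_s_lt).
by rewrite kN.
Qed.

Lemma hat_end r : s N <= r -> that r = t N /\ zhat r = z N.
Proof.
move=> Nr; rewrite /Defs.that /Defs.zhat.
have -> : cell tau N r = N by exact: (chain_find_end run_s_lt).
by rewrite ltnn.
Qed.

(** At the right end of a cell the interpolants are evaluated by the next step, or by the constant
    extension after the last one; both agree with the formula of the cell, so estimates may use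
    closed cells. *)
Lemma hat_step k r : (k < N)%N -> s k <= r <= s k.+1 ->
  that r = st_that P (x k) r /\ zhat r = st_zhat (x k) r.
Proof.
move=> kN /andP[kr]; rewrite le_eqVlt => /predU1P[->|rk]; last first.
  by apply: hat_cell; rewrite ?kr.
have [/tau_gt0 /= tau0 _] := run_step kN.
have -> : st_that P (x k) (s k.+1) = t k.+1.
  by rewrite /st_that /st_tnew /= sseqS addrAC subrr add0r divff ?gt_eqF// mul1r addrC subrK.
have -> : st_zhat (x k) (s k.+1) = z k.+1.
  by rewrite /st_zhat /= sseqS addrAC subrr add0r divff ?gt_eqF// scale1r addrC subrK.
have [kN1|] := ltnP k.+1 N.
  have ks : s k.+1 <= s k.+1 < s k.+2 by rewrite lexx run_s_lt.
  have [-> ->] := hat_cell kN1 ks.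
  by rewrite /st_that /st_zhat /= subrr !mul0r scale0r !addr0.
move=> Nk; have -> : k.+1 = N by apply/eqP; rewrite eqn_leq kN.
exact: hat_end (lexx _).
Qed.

Lemma hat0 : that 0 = 0 /\ zhat 0 = z0 P.
Proof.
have s01 : s 0%N <= 0 < s 1%N by rewrite -[X in _ <= X < _]sseq0 lexx run_s_lt// run_N_gt0.
have [-> ->] := hat_cell run_N_gt0 s01.
by rewrite /st_that /st_zhat /= sseq0 subrr !mul0r scale0r !addr0 run_z0.
Qed.

End Curve.
End Run.

Lemma gronwall_arith {R : realFieldType} (e S d f X : R) :
  0 <= f -> f + d <= e -> 0 <= S -> 0 <= d -> 1 <= X -> f * X + (S + d) <= X * (e + S).
Proof. nra. Qed.

(** * Uniform bounds for runs and the approximate energy inequality *)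

Section Apriori.
Context {R : realType} {Z W V X : completeNormedModType R}.
Variable P : ris_data Z W V X.
Hypothesis hP : assumptions P.
Hypothesis hZV : Z_eq_V P.
Local Notation T := (Tend P).
Local Notation en := (energy P).
Local Notation nv := (nv P).
Local Notation Rd := (Rd P).

Lemma energy_time t1 t2 z : t1 <= T -> t2 <= T ->
  en t1 z - en t2 z = load P t2 z - load P t1 z.
Proof. by move=> h1 h2; rewrite /energy !min_l// opprB addrC addrA subrK. Qed.

(* Discrete Gronwall argument for the shifted energy, which dominates |z| + 1. *)
Lemma run_bounds : exists2 M, 0 < M & forall tol tau1 tau z N,
  adaptive_run P tol tau1 tau z N -> forall k, (k <= N)%N ->
  `|z k| <= M /\ \sum_(i < k) Rd (z i.+1 - z i) <= M.
Proof.
have [b bP] := energy_lower hP; have [m m0 mP] := load_lipschitz hP.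
have T0 := T_gt0 hP.
pose E0 := en 0 (z0 P) + b.
have E0_ge1 : 1 <= E0.
  by rewrite (le_trans _ (bP 0 (z0 P) _)) ?lexx ?(ltW T0)// lerDr.
have E0_gt0 : 0 < E0 := lt_le_trans ltr01 E0_ge1.
exists (expR (m * T) * E0); first by rewrite mulr_gt0// expR_gt0.
move=> tol tau1 tau z N hrun.
pose t k := tseq P tau z k; pose S k := \sum_(i < k) Rd (z i.+1 - z i).
have t0 k : (k <= N)%N -> 0 <= t k := run_t_ge0 hP hZV hrun (k := k).
have S0 k : 0 <= S k by apply: sumr_ge0 => i _; exact: Rd_ge0.
have bt k : (k <= N)%N -> `|z k| + 1 <= en (t k) (z k) + b.
  by move=> kN; rewrite -energy_min; apply: bP; apply: minT_itv => //; exact: t0.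
(* The accumulated dissipation is carried along with the energy, which bounds both at once. Time is
   truncated because the final [t N] may exceed T. *)
have inv k : (k <= N)%N -> en (t k) (z k) + b + S k <= expR (m * Num.min (t k) T) * E0.
  elim: k => [_|k IH kN].
    by rewrite /S big_ord0 addr0 /t /= min_l ?(ltW T0)// mulr0 expR0 mul1r (run_z0 hrun).
  have tkT : t k < T := run_t_lt hrun kN.
  have {IH} := IH (ltnW kN); rewrite (min_l (ltW tkT)) => IH.
  have [vx _] := run_step hrun kN; have [_ _ /= sE] := vx.
  have tk0 := t0 _ (ltnW kN); have tk1 := t0 _ kN.
  set t' := Num.min (t k.+1) T.
  have t'T : 0 <= t' <= T by exact: minT_itv.
  have tt' : t k <= t' by rewrite le_min (run_t_le hP hZV hrun kN) ltW.
  have tkT' : 0 <= t k <= T by rewrite tk0 ltW.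
  (* The step inequality controls the new state at the old time; the passage to the new time is then
     paid by the Lipschitz bound on the load, which is a multiple of [f] itself. *)
  pose f := en (t k) (z k.+1) + b.
  have zf : `|z k.+1| + 1 <= f by exact: bP.
  have f0 : 0 <= f by rewrite (le_trans _ zf)// addr_ge0.
  have fE : f + Rd (z k.+1 - z k) <= en (t k) (z k) + b.
    by rewrite /f addrAC lerD2r; exact: sE.
  have e1 : en (t k.+1) (z k.+1) + b <= f * expR (m * (t' - t k)).
    rewrite (@le_trans _ _ (f * (1 + m * (t' - t k))))//; last first.
      by rewrite ler_wpM2l// expR_ge1Dx.
    rewrite -[energy P (t k.+1)]energy_min mulrDr mulr1 -/t' -lerBlDl.
    have -> : en t' (z k.+1) + b - f = load P (t k) (z k.+1) - load P t' (z k.+1).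
      rewrite -energy_time ?(ltW tkT)//; last by case/andP: t'T.
      by rewrite /f opprD addrACA subrr addr0.
    rewrite (le_trans (ler_norm _))// (le_trans (mP _ _ _ tkT' t'T))//.
    rewrite distrC ger0_norm ?subr_ge0// mulrA ler_wpM2r ?subr_ge0//.
    by rewrite mulrC ler_wpM2r// ltW.
  have X1 : 1 <= expR (m * (t' - t k)).
    by rewrite -expR0 ler_expR mulr_ge0 ?(ltW m0)// subr_ge0.
  rewrite {1}/S big_ord_recr/= -/(S k).
  have -> : expR (m * t') * E0 = expR (m * (t' - t k)) * (expR (m * t k) * E0).
    by rewrite mulrA -expRD -mulrDr subrK.
  rewrite (@le_trans _ _ (expR (m * (t' - t k)) * (en (t k) (z k) + b + S k)))//.
    rewrite (le_trans (lerD e1 (lexx _)))//; apply: gronwall_arith => //.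
    exact: Rd_ge0.
  by rewrite ler_wpM2l// expR_ge0.
move=> k kN; have {}inv := inv _ kN; have {}bt := bt _ kN.
have EM : expR (m * Num.min (t k) T) * E0 <= expR (m * T) * E0.
  by rewrite ler_wpM2r ?(ltW E0_gt0)// ler_expR ler_pM2l// ge_min lexx orbT.
have z1 : `|z k| <= `|z k| + 1 by rewrite lerDl.
have z2 : 0 <= en (t k) (z k) + b by rewrite (le_trans _ bt)// addr_ge0.
split.
  by rewrite (le_trans z1)// (le_trans bt)// (le_trans _ EM)// (le_trans _ inv)// lerDl.
by rewrite -/(S k) (le_trans _ EM)// (le_trans _ inv)// lerDr.
Qed.

Section ApproxCurve.
Variables (M eps S : R) (t : R -> R) (z : R -> Z).

(** All that the passage to the limit retains of a run: initial and terminal values, a bound, the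
    arc-length constraint, and the inequality in g and d with error [eps]. Its second part is the
    approximate form of complementarity between the time speed and G. *)
Definition approx_curve : Prop :=
  [/\ [/\ t 0 = 0, z 0 = z0 P & t S = T],
      forall r, 0 <= r -> `|z r| <= M,
      forall a b, 0 <= a -> a <= b ->
        0 <= t b - t a /\ t b - t a + nv (z b - z a) <= b - a
    & forall a b g d, 0 <= a -> a <= b -> b <= S -> 0 <= g ->
        (forall r, a <= r <= b -> g <= Gd P (t r) (z r)) ->
        (forall r, a <= r <= b -> - load_t P (t r) (z r) <= d) ->
        en (t b) (z b) - en (t a) (z a) + Rd (z b - z a) + g * nv (z b - z a)
          <= d * (t b - t a) + eps /\ g * (t b - t a) <= eps].

End ApproxCurve.

(** A single error, the larger of the integrals of [step_i1] and [step_i2], serves both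
    inequalities, and it obeys the two bounds that [sqrt_interpolation] combines. *)
Lemma step_approx M : exists2 K, 0 < K & forall tol (x : @step R Z), valid_step P x ->
  below P tol x -> 0 <= st_t x -> `|st_z x| <= M -> `|st_znew x| <= M ->
  forall a b g d, st_s x <= a -> a <= b -> b <= st_snew x -> st_that P x b <= T ->
  (forall r, a <= r <= b -> g <= Gd P (st_that P x r) (st_zhat x r)) ->
  (forall r, a <= r <= b -> - load_t P (st_that P x r) (st_zhat x r) <= d) ->
  exists e, [/\ e <= tol, e <= K * st_tau x * (b - a),
    en (st_that P x b) (st_zhat x b) - en (st_that P x a) (st_zhat x a) +
      Rd (st_zhat x b - st_zhat x a) + g * nv (st_zhat x b - st_zhat x a)
      <= d * (st_that P x b - st_that P x a) + e
    & g * (st_that P x b - st_that P x a) <= e].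
Proof.
have [L1 L10 DEL1] := DE_lipschitz hP M; have [L2 L20 GdL2] := Gd_lipschitz hP hZV M.
have [C C0 nvC] := nv_equiv hP hZV.
pose L := L1 + L2.
have L0 : 0 < L by rewrite addr_gt0.
have DEL t1 t2 z1 z2 v : 0 <= t1 -> 0 <= t2 -> `|z1| <= M -> `|z2| <= M ->
    `|DE P t1 z1 v - DE P t2 z2 v| <= L * (`|t1 - t2| + `|z1 - z2|) * `|v|.
  move=> h1 h2 h3 h4; rewrite (le_trans (DEL1 _ _ _ _ _ h1 h2 h3 h4))//.
  by rewrite ler_wpM2r// ler_wpM2r ?addr_ge0// lerDl ltW.
have GdL t1 t2 z1 z2 : 0 <= t1 -> 0 <= t2 -> `|z1| <= M -> `|z2| <= M ->
    `|Gd P t1 z1 - Gd P t2 z2| <= L * (`|t1 - t2| + `|z1 - z2|).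
  move=> h1 h2 h3 h4; rewrite (le_trans (GdL2 _ _ _ _ h1 h2 h3 h4))//.
  by rewrite ler_wpM2r ?addr_ge0// lerDr ltW.
have nvC1 v : `|v| <= C * nv v by have [] := nvC v.
exists (L * (1 + C) * (1 + C)); first by rewrite !mulr_gt0// addr_gt0.
move=> tol x vx /andP[b1 b2] tx zM znM a b g d sa ab bs bT gG ld.
have c1 := @step_i1_continuous _ _ _ _ _ _ hP hZV M L C L0 C0 GdL nvC1 x vx tx zM znM.
have c2 := @step_i2_continuous _ _ _ _ _ _ hP hZV M L C L0 C0 DEL GdL nvC1 x vx tx zM znM.
rewrite (st_I1_int hP hZV vx tx) in b1; rewrite (st_I2_int hP hZV vx tx) in b2.
have p1 r : st_s x <= r <= st_snew x -> 0 <= step_i1 P x r.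
  by move=> /andP[h _]; exact: step_i1_ge0.
have p2 r : st_s x <= r <= st_snew x -> 0 <= step_i2 P x r.
  by move=> /andP[h _]; exact: step_i2_ge0.
have q1 r (hr : st_s x <= r <= st_snew x) :=
  step_i1_le hP hZV L0 C0 GdL nvC1 vx tx zM znM hr.
have q2 r (hr : st_s x <= r <= st_snew x) :=
  step_i2_le hP hZV L0 C0 DEL GdL nvC1 vx tx zM znM hr.
have [int1 i1t i1K] := @step_integral_le R Z L C x (step_i1 P x) a b tol c1 p1 q1 sa ab bs b1.
have [int2 i2t i2K] := @step_integral_le R Z L C x (step_i2 P x) a b tol c2 p2 q2 sa ab bs b2.
pose e1 := Rintegral (@lebesgue_measure R) `]a, b[ (step_i1 P x).
pose e2 := Rintegral (@lebesgue_measure R) `]a, b[ (step_i2 P x).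
exists (Num.max e1 e2); split.
- by rewrite ge_max i1t.
- by rewrite ge_max i1K.
- rewrite (le_trans (step_energy_le hP hZV vx tx sa ab bs bT int2 gG ld))//.
  by rewrite lerD2l le_max lexx orbT.
- rewrite le_max; apply/orP; left; rewrite thatB mulrCA.
  rewrite mulrC -(Rintegral_oo_cst _ ab); apply: le_Rintegral => //.
    exact: (integrable_oo_cst a b).
  move=> r; rewrite /= in_itv/= => /andP[h1 h2]; rewrite /step_i1 mulrC.
  by rewrite ler_wpM2l ?gG ?(ltW h1) ?(ltW h2)//; exact: (dt_ge0 hP hZV vx tx).
Qed.

(** The parameter is elapsed time plus the V-lengths of the increments. While time is at most T, the
    first is at most T and the second at most C M by [Rd_lower], whence B = T + C M. In the error, 2
    tol pays for partial cells and sqrt (K tol) B for full ones. *)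
Lemma adaptive_run_approx : exists M B K, [/\ 0 < M, 0 < B, 0 < K &
  forall tol tau1 tau z N S, 0 < tol -> adaptive_run P tol tau1 tau z N ->
  max_param P (that P tau z N) S ->
  T <= S /\ S <= B /\
  approx_curve M (tol + tol + Num.sqrt (K * tol) * B) S (that P tau z N) (zhat P tau z N)].
Proof.
have [M M0 MP] := run_bounds; have [K K0 KP] := step_approx M.
have [C C0 CP] := Rd_lower hP hZV; have T0 := T_gt0 hP.
exists M, (T + C * M), K; split=> //; first by rewrite addr_gt0// mulr_gt0.
move=> tol tau1 tau z N S tol0 hrun [[S0 tS] Smin].
pose x k := step_of P tau z k; pose s := sseq tau; pose t := tseq P tau z.
set th := that P tau z N in tS Smin *; set zh := zhat P tau z N.
have s0 : s 0%N = 0 := sseq0 tau.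
have s_lt k : (k < N)%N -> s k < s k.+1 := run_s_lt hrun (k := k).
have N0 := run_N_gt0 hP hrun.
have t0 k : (k <= N)%N -> 0 <= t k := run_t_ge0 hP hZV hrun (k := k).
have hstep k r : (k < N)%N -> s k <= r <= s k.+1 ->
  th r = st_that P (x k) r /\ zh r = st_zhat (x k) r := @hat_step _ _ _ _ _ P _ _ _ _ _ hrun k r.
have hend r : s N <= r -> th r = t N /\ zh r = z N := @hat_end _ _ _ _ _ P _ _ _ _ _ hrun r.
have [th0 zh0] : th 0 = 0 /\ zh 0 = z0 P := hat0 hP hrun.
have zM k : (k <= N)%N -> `|z k| <= M by move=> kN; have [] := MP _ _ _ _ _ hrun k kN.
(* Time is constant beyond [s N]; if S lay there, T would already be attained at [s N], against the
   minimality of S. *)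
have SN : S <= s N.
  rewrite leNgt; apply/negP => NS; have [tSN _] := hend _ (ltW NS).
  have [tNN _] := hend _ (lexx (s N)).
  have : S <= s N; last by rewrite leNgt NS.
  by apply: Smin; split; [rewrite -s0; exact: (chain_le s_lt)|rewrite tNN -tSN].
have curve a b : 0 <= a -> a <= b ->
    0 <= th b - th a /\ th b - th a + nv (zh b - zh a) <= b - a.
  (* An exact property, with an ignored error argument so that [chain_ind] can glue the cells. *)
  pose Q a b (_ : R) := 0 <= th b - th a /\ th b - th a + nv (zh b - zh a) <= b - a.
  have Qtrans a' b' d e e' : a' <= b' -> b' <= d -> Q a' b' e -> Q b' d e' -> Q a' d (e + e').
    move=> _ _ [h1 h2] [h3 h4]; split.
      by rewrite -(subrK (th b') (th d)) -addrA addr_ge0.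
    have h5 := nvD hP (zh d - zh b') (zh b' - zh a'); rewrite addrA subrK in h5.
    by move: h2 h4 h5; move: (nv _) (nv _) (nv _) (th _) (th _) (th _) => *; lra.
  have Qrefl a' : Q a' a' 0 by rewrite /Q !subrr (nv0 hP) addr0.
  have Qcell k a' b' : (k < N)%N -> s k <= a' -> a' <= b' -> b' <= s k.+1 -> Q a' b' 0.
    move=> kN ka ab' bk; rewrite /Q.
    have [-> ->] := hstep k b' kN (introT andP (conj (le_trans ka ab') bk)).
    have [-> ->] := hstep k a' kN (introT andP (conj ka (le_trans ab' bk))).
    have [vx _] := run_step hrun kN; have tx := t0 _ (ltnW kN).
    have ba : 0 <= b' - a' by rewrite subr_ge0.
    rewrite thatB zhatB (nvZ hP) (ger0_norm ba) -mulrDr (dt_dz hP vx) mulr1; split=> //.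
    by rewrite mulr_ge0//; exact: (dt_ge0 hP hZV vx tx).
  have Qin a' b' : 0 <= a' -> a' <= b' -> b' <= s N -> Q a' b' 0.
    move=> h1 h2 h3.
    have Qfull k : (k.+1 < N)%N -> Q (s k) (s k.+1) (0 * (s k.+1 - s k)).
      by move=> kN; apply: (Qcell k) (lexx _) (ltW (s_lt _ (ltnW kN))) (lexx _); exact: ltnW.
    by have [] := chain_ind s0 s_lt (lexx 0) (lexx 0) Qrefl Qtrans Qcell Qfull N0 h1 h2 h3.
  move=> a0 ab; have [bN|Nb] := leP b (s N); first exact: Qin.
  have [tb zb] := hend _ (ltW Nb); have [tn zn] := hend _ (lexx (s N)).
  have [aN|Na] := leP a (s N).
    have [h1 h2] := Qin _ _ a0 aN (lexx _); rewrite tb zb -tn -zn; split=> //.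
    by rewrite (le_trans h2)// lerD2r ltW.
  by have [-> ->] := hend _ (ltW Na); rewrite tb zb !subrr (nv0 hP) addr0 subr_ge0.
have sB k r : (k < N)%N -> s k <= r <= s k.+1 -> th r <= T -> r <= T + C * M.
  move=> kN kr rT; have [_ SR] := MP _ _ _ _ _ hrun k.+1 kN.
  have sE j : (j <= k)%N -> s j = t j + \sum_(i < j) nv (z i.+1 - z i).
    elim: j => [_|j IH jk]; first by rewrite s0 big_ord0 addr0.
    rewrite /s sseqS -/s IH ?(ltnW jk)// big_ord_recr/= -/(t j) -/(nv _).
    move: (\sum_(i < j) _) (nv _) (t j) (tau _) => u v w y; ring.
  have h : \sum_(i < k.+1) nv (z i.+1 - z i) <= C * M.
    rewrite (le_trans _ (ler_wpM2l (ltW C0) SR))// mulr_sumr.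
    by apply: ler_sum => i _; exact: CP.
  have [vx _] := run_step hrun kN; have tx := t0 _ (ltnW kN); have tau0 := tau_gt0 vx.
  have [tE _] := hstep _ _ kN kr; case/andP: kr => kr rk.
  have rE : r - s k = (th r - t k) + (r - s k) / tau k.+1 * nv (z k.+1 - z k).
    rewrite tE thatE (dtE _ _) /= -/(nv _) -/(s k) -/(t k).
    by field; rewrite gt_eqF.
  have lam : (r - s k) / tau k.+1 * nv (z k.+1 - z k) <= nv (z k.+1 - z k).
    rewrite ler_piMl ?nv_ge0// ler_pdivrMr// mul1r lerBlDl.
    by move: rk; rewrite /s sseqS.
  have {rE lam} r1 : r - s k <= (th r - t k) + nv (z k.+1 - z k) by rewrite rE lerD2l.
  rewrite big_ord_recr/= in h; rewrite sE// in r1; move: r1 h rT.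
  by move: (nv _) (\sum_(i < k) _) (th r) (t k) (C * M) => u v w y q *; lra.
have SB : S <= T + C * M.
  have [k kN kS] := chain_cell s0 N0 S0 SN.
  by apply: sB kN kS _; rewrite tS.
have TS : T <= S.
  have [_ h] := curve 0 S (lexx _) S0; rewrite th0 tS !subr0 in h.
  by rewrite (le_trans _ h)// lerDl nv_ge0.
do 2!split=> //.
split=> //.
- move=> r r0; have [rN|Nr] := leP r (s N); last first.
    by have [_ ->] := hend _ (ltW Nr); exact: zM.
  have [k kN kr] := chain_cell s0 N0 r0 rN; have [_ ->] := hstep _ _ kN kr.
  have [vx _] := run_step hrun kN.
  by apply: (zhatM vx) => //; [exact: zM (ltnW kN)|exact: zM|rewrite /st_snew /= -sseqS].
- move=> a b g d a0 ab bS g0 gG ld.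
  (* The guards make the property vacuous outside [a, b], where nothing is known about g and d,
     whereas [chain_ind] asks for it on every cell. *)
  pose Q a' b' e := a <= a' -> b' <= b ->
    en (th b') (zh b') - en (th a') (zh a') + Rd (zh b' - zh a') + g * nv (zh b' - zh a')
          <= d * (th b' - th a') + e /\ g * (th b' - th a') <= e.
  have Qtrans a' b' c e e' : a' <= b' -> b' <= c -> Q a' b' e -> Q b' c e' -> Q a' c (e + e').
    move=> ab' bc Q1 Q2 aa cb.
    have [h1 h2] := Q1 aa (le_trans bc cb); have [h3 h4] := Q2 (le_trans aa ab') cb.
    have h5 := RdD hP (zh c - zh b') (zh b' - zh a').
    have h6 := nvD hP (zh c - zh b') (zh b' - zh a').
    rewrite !addrA !subrK in h5 h6; have {}h6 := ler_wpM2l g0 h6; rewrite mulrDr in h6.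
    split.
      move: h1 h3 h5 h6; rewrite !(mulrBr d).
      move: (d * _) (d * _) (d * _) (Rd _) (Rd _) (Rd _) (g * _) (g * _) (g * _) (en _ _) (en _ _) (en _ _).
      by move=> *; lra.
    by move: h2 h4; rewrite !mulrBr; move: (g * _) (g * _) (g * _) => *; lra.
  have Qrefl a' : Q a' a' 0 by rewrite /Q !subrr (nv0 hP) (Rd0 hP) !mulr0 !addr0.
  have Qstep k a' b' : (k < N)%N -> s k <= a' -> a' <= b' -> b' <= s k.+1 ->
      exists e, [/\ e <= tol, e <= K * tau k.+1 * (b' - a') & Q a' b' e].
    move=> kN ka ab' bk.
    have [aa|aa] := leP a a'; last first.
      exists 0; split; [exact: ltW| |by rewrite /Q leNgt aa].
      have [vx _] := run_step hrun kN; rewrite !mulr_ge0 ?subr_ge0 ?(ltW K0)//.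
      exact: ltW (tau_gt0 vx).
    have [bb|bb] := leP b' b; last first.
      exists 0; split; [exact: ltW| |by rewrite /Q (leNgt b') bb].
      have [vx _] := run_step hrun kN; rewrite !mulr_ge0 ?subr_ge0 ?(ltW K0)//.
      exact: ltW (tau_gt0 vx).
    have in_k r : a' <= r <= b' -> s k <= r <= s k.+1.
      by move=> /andP[h1 h2]; rewrite (le_trans ka h1) (le_trans h2 bk).
    have in_ab r : a' <= r <= b' -> a <= r <= b.
      by move=> /andP[h1 h2]; rewrite (le_trans aa h1) (le_trans h2 bb).
    have [vx bx] := run_step hrun kN; have tx := t0 _ (ltnW kN).
    have b'0 : 0 <= b' by rewrite (le_trans a0)// (le_trans aa).
    have b'T : th b' <= T.
      have [h _] := curve b' S b'0 (le_trans bb bS).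
      by rewrite -tS -subr_ge0.
    have hb : a' <= b' <= b' by rewrite ab' lexx.
    have ha : a' <= a' <= b' by rewrite ab' lexx.
    have [tb zb] := hstep _ _ kN (in_k _ hb); have [ta za] := hstep _ _ kN (in_k _ ha).
    have [||||e [e1 e2 e3 e4]] := @KP tol (x k) vx bx tx (zM _ (ltnW kN)) (zM _ kN) a' b' g d ka ab'.
    - by rewrite /st_snew /= -sseqS.
    - by rewrite -tb.
    - by move=> r hr; have [<- <-] := hstep _ _ kN (in_k _ hr); apply: gG; exact: in_ab.
    - by move=> r hr; have [<- <-] := hstep _ _ kN (in_k _ hr); apply: ld; exact: in_ab.
    by exists e; split=> // _ _; rewrite ta tb za zb.
  have Qmono a' b' e e' : e <= e' -> Q a' b' e -> Q a' b' e'.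
    move=> ee Qe h1 h2; have [h3 h4] := Qe h1 h2.
    by rewrite (le_trans h3) ?lerD2l//; split=> //; exact: le_trans h4 ee.
  pose c := Num.sqrt (K * tol).
  have c0 : 0 <= c by rewrite sqrtr_ge0.
  have Qcell k a' b' : (k < N)%N -> s k <= a' -> a' <= b' -> b' <= s k.+1 -> Q a' b' tol.
    by move=> kN h1 h2 h3; have [e [h _ /(Qmono _ _ _ _ h)]] := Qstep _ _ _ kN h1 h2 h3.
  have Qfull k : (k.+1 < N)%N -> Q (s k) (s k.+1) (c * (s k.+1 - s k)).
    move=> kN; have kN' := ltnW kN.
    have [e [h1 h2]] := Qstep k _ _ kN' (lexx _) (ltW (s_lt _ kN')) (lexx _).
    have [vx _] := run_step hrun kN'.
    have sE : s k.+1 - s k = tau k.+1 by rewrite /s sseqS addrAC subrr add0r.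
    apply: Qmono; rewrite sE in h2 *; apply: sqrt_interpolation => //; try exact: ltW.
    exact: ltW (tau_gt0 vx).
  have [e he Qe] := @chain_ind R s N s0 s_lt Q tol c (ltW tol0) c0 Qrefl Qtrans Qcell Qfull
    a b N0 a0 ab (le_trans bS SN).
  apply: (Qmono _ _ e) (lexx _) (lexx _) => //; rewrite (le_trans he)// lerD2l ler_wpM2l//.
  have N1 : (N.-1 < N)%N by rewrite prednK.
  apply: (sB _ _ N1); first by rewrite lexx ltW ?s_lt.
  have h : s N.-1 <= s N.-1 <= s N.-1.+1 by rewrite lexx ltW ?s_lt.
  have [-> _] := hstep _ _ N1 h.
  by rewrite /st_that subrr !mul0r addr0 ltW// (run_t_lt hrun).
Qed.

End Apriori.

Lemma cvg_of_dist {R : realType} (Y : normedModType R) (T : Type) (F : set_system T)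
    (FF : Filter F) (f : T -> Y) (l : Y) (u : T -> R) :
  u x @[x --> F] --> 0 -> (\forall x \near F, `|l - f x| <= u x) -> f x @[x --> F] --> l.
Proof.
move=> u0 fu; apply/cvgrPdist_le => e e0.
have ue : \forall x \near F, u x <= e by apply: cvgr_le u0 _ e0.
by apply: filterS2 fu ue => x; exact: le_trans.
Qed.

Lemma cvg_dist0 {R : realType} (Y : normedModType R) (T : Type) (F : set_system T)
    (FF : Filter F) (f : T -> Y) (l : Y) :
  f x @[x --> F] --> l -> `|l - f x| @[x --> F] --> (0 : R).
Proof.
move=> fl; have h : (l - f x) @[x --> F] --> l - l by apply: cvgB => //; exact: cvg_cst.
by rewrite -(normr0 Y) -(subrr l); exact: cvg_norm h.
Qed.

Lemma cvg_dnbhs_right {R : realType} (Y : topologicalType) (f : R -> Y) (l : Y) :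
  f h @[h --> 0^'] --> l -> f h @[h --> 0^'+] --> l.
Proof.
move=> fl A hA; have H : \forall h \near 0^', A (f h) := fl A hA.
suff : \forall h \near 0^'+, A (f h) by [].
move: H; rewrite !near_withinE; apply: filterS => h H h0; apply: H.
by rewrite gt_eqF.
Qed.

Lemma energy_balance_arith {R : realFieldType} (l t d rr g n e G : R) :
  0 <= n -> n <= 1 -> t <= 1 -> 0 <= e -> G - e <= g ->
  - l * t + d + rr + g * n <= (- l + e) * t -> d + rr + n * G <= e + e.
Proof. nra. Qed.

(** * Passage to the limit *)

Section LimitCurve.
Context {R : realType} {Z W V X : completeNormedModType R}.
Variable P : ris_data Z W V X.
Hypothesis hP : assumptions P.
Hypothesis hZV : Z_eq_V P.
Local Notation T := (Tend P).
Local Notation en := (energy P).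
Local Notation nv := (nv P).
Local Notation Rd := (Rd P).
Local Notation DE := (DE P).
Local Notation Gd := (Gd P).
Local Notation mu := (@lebesgue_measure R).

Variables (M S : R) (eps Sn : nat -> R) (tn : nat -> R -> R) (zn : nat -> R -> Z).
Variables (t : R -> R) (z : R -> Z).
Hypothesis hap : forall n, approx_curve P M (eps n) (Sn n) (tn n) (zn n).
Hypothesis hT : forall n, T <= Sn n.
Hypothesis eps0 : eps n @[n --> \oo] --> 0.
Hypothesis SnS : Sn n @[n --> \oo] --> S.
Hypothesis tnt : forall s, 0 <= s <= S -> tn n s @[n --> \oo] --> t s.
Hypothesis znz : forall s, 0 <= s <= S -> zn n s @[n --> \oo] --> z s.

Lemma limit_T_le : T <= S.
Proof. by apply: cvgr_to_ge SnS _; near=> n. Unshelve. all: by end_near. Qed.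

Let cnv : continuous nv := nv_continuous hP hZV.
Let cRd : continuous Rd := Rd_continuous hP hZV.
Let S_gt0 : 0 < S := lt_le_trans (T_gt0 hP) limit_T_le.
Let S00 : 0 <= (0 : R) <= S. Proof. by rewrite lexx ltW. Qed.
Let S0S : 0 <= S <= S. Proof. by rewrite lexx ltW. Qed.

Lemma approx_lip n a b : 0 <= a -> 0 <= b ->
  `|tn n a - tn n b| <= `|a - b| /\ nv (zn n a - zn n b) <= `|a - b|.
Proof.
have [_ _ H _] := hap n.
wlog ab : a b / a <= b.
  move=> W' a0 b0; have [ab|/ltW ba] := leP a b; first exact: W'.
  by rewrite distrC (distrC a) -(nvN hP) opprB; exact: W'.
move=> a0 b0; have [h1 h2] := H a b a0 ab.
have h3 := nv_ge0 P (zn n b - zn n a).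
rewrite distrC (distrC a) -(nvN hP) opprB (ger0_norm h1) ger0_norm ?subr_ge0//.
by split; move: h1 h2 h3; move: (nv _) (tn _ _) (tn _ _) => *; lra.
Qed.

Lemma limit_t0 : t 0 = 0.
Proof.
apply: (cvg_unique _ (tnt S00)) => //.
by apply: cvg_near_cst; near=> n; have [[]] := hap n.
Unshelve. all: by end_near. Qed.

Lemma limit_z0 : z 0 = z0 P.
Proof.
apply: (cvg_unique (@norm_hausdorff _ Z) (znz S00)).
by apply: cvg_near_cst; near=> n; have [[]] := hap n.
Unshelve. all: by end_near. Qed.

Lemma limit_tS : t S = T.
Proof.
apply: (cvg_unique (@norm_hausdorff _ R^o) (tnt S0S)).
(* The n-th curve reaches T at [Sn n] and not at S; being 1-Lipschitz, it differs from T at S by at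
   most [|S - Sn n|]. *)
apply: (@cvg_of_dist _ R^o _ _ _ _ _ (fun n => `|S - Sn n|)).
  exact: (@cvg_dist0 _ R^o).
near=> n; have [[_ _ <-] _ _ _] := hap n; rewrite distrC.
have [|//] := @approx_lip n S (Sn n) (ltW S_gt0).
exact: le_trans (ltW (T_gt0 hP)) (hT n).
Unshelve. all: by end_near. Qed.

Lemma limit_curve a b : 0 <= a -> a <= b -> b <= S ->
  0 <= t b - t a /\ t b - t a + nv (z b - z a) <= b - a.
Proof.
move=> a0 ab bS.
have ha : 0 <= a <= S by rewrite a0 (le_trans ab).
have hb : 0 <= b <= S by rewrite (le_trans a0 ab).
have ct : tn n b - tn n a @[n --> \oo] --> t b - t a by apply: cvgB; exact: tnt.
have cz : nv (zn n b - zn n a) @[n --> \oo] --> nv (z b - z a).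
  have cz0 : zn n b - zn n a @[n --> \oo] --> z b - z a by apply: cvgB; exact: znz.
  exact: (cvg_comp _ _ cz0 (@cnv _)).
split.
  apply: cvgr_to_ge ct _; near=> n; have [_ _ H _] := hap n.
  by have [] := H a b a0 ab.
apply: cvgr_to_le (cvgD ct cz) _; near=> n; have [_ _ H _] := hap n.
by have [] := H a b a0 ab.
Unshelve. all: by end_near. Qed.

Lemma limit_t_itv s : 0 <= s <= S -> 0 <= t s <= T.
Proof.
move=> /andP[s0 sS]; have [h1 _] := limit_curve (lexx _) s0 sS.
have [h2 _] := limit_curve s0 sS (lexx _).
by move: h1 h2; rewrite limit_t0 limit_tS !subr_ge0 => -> ->.
Qed.

Lemma limit_lip a b : 0 <= a <= S -> 0 <= b <= S ->
  `|t a - t b| <= `|a - b| /\ nv (z a - z b) <= `|a - b|.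
Proof.
wlog ab : a b / a <= b.
  move=> W' ha hb; have [ab|/ltW ba] := leP a b; first exact: W'.
  by rewrite distrC (distrC a) -(nvN hP) opprB; exact: W'.
move=> /andP[a0 _] /andP[_ bS]; have [h1 h2] := limit_curve a0 ab bS.
have h3 := nv_ge0 P (z b - z a).
rewrite distrC (distrC a) -(nvN hP) opprB (ger0_norm h1) ger0_norm ?subr_ge0//.
by split; move: h1 h2 h3; move: (nv _) (t _) (t _) => *; lra.
Qed.

Lemma limit_zM s : 0 <= s <= S -> `|z s| <= M.
Proof.
move=> hs; apply: cvgr_to_le (cvg_norm (znz hs)) _; near=> n.
by have [_ H _ _] := hap n; apply: H; case/andP: hs.
Unshelve. all: by end_near. Qed.

Let tn_itv n s : 0 <= s -> s <= Sn n -> 0 <= tn n s <= T.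
Proof.
move=> s0 sS; have [[t0 _ tS] _ H _] := hap n.
have [h1 _] := H _ _ (lexx 0) s0; have [h2 _] := H _ _ s0 sS.
by move: h1 h2; rewrite t0 tS !subr_ge0 => -> ->.
Qed.

Let Sn_gt s : s < S -> \forall n \near \oo, s <= Sn n.
Proof. by move=> sS; apply: cvgr_ge SnS _ sS. Qed.

(** For s strictly below S, eventually s <= [Sn n], so the approximate times lie in [0, T], where
    the energy is Lipschitz. *)
Lemma limit_energy s : 0 <= s -> s < S ->
  en (tn n s) (zn n s) @[n --> \oo] --> en (t s) (z s).
Proof.
move=> s0 sS; have hs : 0 <= s <= S by rewrite s0 ltW.
have [K K0 KP] := energy_lipschitz hP M.
apply: (@cvg_of_dist _ R^o _ _ _ _ _ (fun n => K * (`|t s - tn n s| + `|z s - zn n s|))).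
  rewrite -(mulr0 K); apply: cvgMl_tmp; rewrite -(addr0 0); apply: cvgD.
    by apply: (@cvg_dist0 _ R^o); exact: tnt.
  by apply: cvg_dist0; exact: znz.
have H := Sn_gt sS; near=> n; apply: KP.
- exact: limit_t_itv.
- by apply: tn_itv => //; near: n.
- exact: limit_zM.
- by have [_ h _ _] := hap n; exact: h.
Unshelve. all: by end_near. Qed.

Lemma limit_inequality a b g d : 0 <= a -> a <= b -> b < S -> 0 <= g ->
  (\forall n \near \oo, forall r, a <= r <= b ->
     g <= Gd (tn n r) (zn n r) /\ - load_t P (tn n r) (zn n r) <= d) ->
  en (t b) (z b) - en (t a) (z a) + Rd (z b - z a) + g * nv (z b - z a)
    <= d * (t b - t a) /\ g * (t b - t a) <= 0.
Proof.
move=> a0 ab bS g0 H; have aS := le_lt_trans ab bS; have b0 := le_trans a0 ab.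
have ha : 0 <= a <= S by rewrite a0 ltW.
have hb : 0 <= b <= S by rewrite b0 ltW.
have ct : tn n b - tn n a @[n --> \oo] --> t b - t a by apply: cvgB; exact: tnt.
have cz : zn n b - zn n a @[n --> \oo] --> z b - z a by apply: cvgB; exact: znz.
have cnvz : nv (zn n b - zn n a) @[n --> \oo] --> nv (z b - z a).
  exact: (cvg_comp _ _ cz (@cnv _)).
have cRdz : Rd (zn n b - zn n a) @[n --> \oo] --> Rd (z b - z a).
  exact: (cvg_comp _ _ cz (@cRd _)).
have SS := Sn_gt bS.
have key : \forall n \near \oo,
    en (tn n b) (zn n b) - en (tn n a) (zn n a) + Rd (zn n b - zn n a) +
      g * nv (zn n b - zn n a) <= d * (tn n b - tn n a) + eps n /\
    g * (tn n b - tn n a) <= eps n.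
  near=> n; have [_ _ _ h] := hap n; apply: h => //.
  - by near: n.
  - by move=> r hr; have [] := (near H n) _ r hr.
  - by move=> r hr; have [] := (near H n) _ r hr.
have cg : g * nv (zn n b - zn n a) @[n --> \oo] --> g * nv (z b - z a) by apply: cvgMl_tmp.
have c1 : en (tn n b) (zn n b) - en (tn n a) (zn n a) + Rd (zn n b - zn n a) +
    g * nv (zn n b - zn n a) @[n --> \oo] -->
    en (t b) (z b) - en (t a) (z a) + Rd (z b - z a) + g * nv (z b - z a).
  by apply: cvgD => //; apply: cvgD => //; apply: cvgB; exact: limit_energy.
have c2 : d * (tn n b - tn n a) + eps n @[n --> \oo] --> d * (t b - t a) + 0.
  by apply: cvgD => //; exact: cvgMl_tmp.
have c3 : g * (tn n b - tn n a) @[n --> \oo] --> g * (t b - t a) by apply: cvgMl_tmp.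
split; last by apply: ler_cvg_to c3 eps0 _; near=> n; exact: (near key n _).2.
rewrite -[leRHS]addr0; apply: ler_cvg_to c1 c2 _.
by near=> n; exact: (near key n _).1.
Unshelve. all: by end_near. Qed.

(** By equicontinuity, all late approximations stay near [(t r, z r)] on a short interval to the
    right of r, uniformly in n. There G and the power differ from their values at r by at most e.
    The truncation at 0 keeps g nonnegative. *)
Lemma limit_local r e : 0 <= r -> r < S -> 0 < e ->
  exists2 h0, 0 < h0 & forall h, 0 < h -> h <= h0 ->
  let g := Num.max 0 (Gd (t r) (z r) - e) in
  [/\ r + h < S,
      en (t (r + h)) (z (r + h)) - en (t r) (z r) + Rd (z (r + h) - z r) +
        g * nv (z (r + h) - z r) <= (- load_t P (t r) (z r) + e) * (t (r + h) - t r)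
    & g * (t (r + h) - t r) <= 0].
Proof.
move=> r0 rS e0; have hr : 0 <= r <= S by rewrite r0 ltW.
have tr := limit_t_itv hr; have [tr0 _] := andP tr.
have [C C0 CP] := nv_equiv hP hZV.
have [L L0 LP] := Gd_lipschitz hP hZV M.
have [D D0 DP] : exists2 D, 0 < D & forall t' z', 0 <= t' <= T -> `|t r - t'| < D ->
    `|z r - z'| < D -> `|load_t P (t r) (z r) - load_t P t' z'| <= e.
  have /subspace_continuousP/(_ (t r, z r) tr)/cvgrPdist_le/(_ e e0) := f_ft_cont (f_isC1 (as_f hP)).
  rewrite /= near_withinE => -[[A B] /= [/nbhs_ballP[d1 d10 H1] /nbhs_ballP[d2 d20 H2]] H].
  exists (Num.min d1 d2); first by rewrite lt_min d10.
  move=> t' z' t'T; rewrite !lt_min => /andP[h1 _] /andP[_ h2].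
  by apply: (H (t', z')) => //; split; [apply: H1|apply: H2]; rewrite -ball_normE.
(* The first bound serves the power, the second gives L (D1 + D1) <= e for G. Half of D1 is spent on
   the distance of the curves at r, the other half on their motion over h, at speed at most 1 in
   time and C in state. *)
pose D1 := Num.min D (e / (2 * L)).
have D10 : 0 < D1 by rewrite lt_min D0 divr_gt0// mulr_gt0.
exists (Num.min (D1 / 2 / (1 + C)) ((S - r) / 2)).
  by rewrite lt_min !divr_gt0 ?subr_gt0// addr_gt0.
move=> h h0; rewrite le_min => /andP[hD hS] g.
have rhS : r + h < S by move: hS rS; lra.
have hD2 : (1 + C) * h <= D1 / 2 by rewrite mulrC -ler_pdivlMr// addr_gt0.
have hD3 : h <= D1 / 2 by rewrite (le_trans _ hD2)// ler_peMl ?(ltW h0)// lerDl ltW.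
have hD4 : C * h <= D1 / 2 by rewrite (le_trans _ hD2)// ler_wpM2r ?(ltW h0)// lerDr.
suff H : \forall n \near \oo, forall s, r <= s <= r + h ->
    g <= Gd (tn n s) (zn n s) /\ - load_t P (tn n s) (zn n s) <= - load_t P (t r) (z r) + e.
  have rh : r <= r + h by rewrite lerDl ltW.
  have g0 : 0 <= g by rewrite le_max lexx.
  by have [h1 h2] := limit_inequality r0 rh rhS g0 H.
have SS := Sn_gt rhS.
have D20 : 0 < D1 / 2 by rewrite divr_gt0.
have nt : \forall n \near \oo, `|t r - tn n r| < D1 / 2.
  by apply: (@cvgr_dist_lt _ R^o) D20; exact: tnt.
have nz : \forall n \near \oo, `|z r - zn n r| < D1 / 2.
  by apply: cvgr_dist_lt D20; exact: znz.
near=> n; move=> s /andP[rs srh].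
have s0 := le_trans r0 rs.
have sh : `|r - s| <= h by rewrite distrC ger0_norm ?subr_ge0// lerBlDl.
have sT : 0 <= tn n s <= T.
  by apply: tn_itv => //; apply: (le_trans srh); near: n.
have [l1 l2] := approx_lip n r0 s0.
have ht : `|t r - tn n s| < D1.
  rewrite (le_lt_trans (ler_distD (tn n r) _ _))// [ltRHS]splitr ltr_leD//; first by near: n.
  by rewrite (le_trans l1)// (le_trans sh).
have hz : `|z r - zn n s| < D1.
  rewrite (le_lt_trans (ler_distD (zn n r) _ _))// [ltRHS]splitr ltr_leD//; first by near: n.
  rewrite (le_trans (CP _).1)// (le_trans _ hD4)// ler_pM2l//.
  exact: le_trans l2 sh.
have [_ zM _ _] := hap n.
have [g1 _ _ _] := GdP hP hZV (zn n s) (proj1 (andP sT)).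
have hG := LP _ _ _ _ tr0 (proj1 (andP sT)) (limit_zM hr) (zM _ s0).
have DD : D1 <= D by rewrite ge_min lexx.
have hL := DP _ _ sT (lt_le_trans ht DD) (lt_le_trans hz DD).
have hG' : L * (`|t r - tn n s| + `|z r - zn n s|) <= e.
  rewrite mulrC -ler_pdivlMr// (le_trans (lerD (ltW ht) (ltW hz)))//.
  have DL : D1 <= e / (2 * L) by rewrite ge_min lexx orbT.
  by rewrite (le_trans (lerD DL DL))// invfM mulrA -mulrDl -splitr.
split.
  by rewrite ge_max g1/= lerBlDr -lerBlDl (le_trans (ler_norm _))// (le_trans hG).
by rewrite lerNl opprD opprK lerBlDr -lerBlDl (le_trans (ler_norm _)).
Unshelve. all: by end_near. Qed.

(** Right difference quotients suffice, and positive homogeneity lets them enter [Rd] and [nv]. The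
    tolerance e is removed last: [nv dz <= 1] and [dt <= 1] keep its contribution at most a multiple
    of e. *)
Lemma limit_derivative r dt dz : 0 < r -> r < S ->
  is_derive r 1 t dt -> is_derive r 1 z dz ->
  [/\ 0 <= dt, dt + nv dz <= 1, dt * Gd (t r) (z r) = 0
    & DE (t r) (z r) dz = - (Rd dz + nv dz * Gd (t r) (z r))].
Proof.
move=> r0 rS td zd; have hr : 0 <= r <= S by rewrite !ltW.
have tT := limit_t_itv hr; have [tr0 _] := andP tT.
have ed : is_derive r 1 (fun s => en (t s) (z s))
    (- load_t P (t r) (z r) * dt + DE (t r) (z r) dz).
  apply: energy_curve_derive => //; near=> s; apply: limit_t_itv.
  apply/andP; split; apply: ltW; first by near: s; exact: lt_nbhsr.
  by near: s; exact: lt_nbhsl.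
pose qt h := h^-1 * (t (h + r) - t r).
pose qz h := h^-1 *: (z (h + r) - z r).
pose qe h := h^-1 * (en (t (h + r)) (z (h + r)) - en (t r) (z r)).
have ct : qt h @[h --> 0^'+] --> dt by apply/cvg_dnbhs_right/(@is_deriveE R R^o).
have cz : qz h @[h --> 0^'+] --> dz by apply/cvg_dnbhs_right/is_deriveE.
have ce : qe h @[h --> 0^'+] --> - load_t P (t r) (z r) * dt + DE (t r) (z r) dz.
  by apply/cvg_dnbhs_right; have := (@is_deriveE R R^o _ _ _).2 ed; apply.
have cn : nv (qz h) @[h --> 0^'+] --> nv dz := cvg_comp _ _ cz (@cnv _).
have cR : Rd (qz h) @[h --> 0^'+] --> Rd dz := cvg_comp _ _ cz (@cRd _).
have hpos : \forall h \near 0^'+, (0 : R) < h by exact: nbhs_right_gt.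
have hS : \forall h \near 0^'+, r + h <= S.
  near=> h; rewrite -lerBrDl; near: h; apply: nbhs_right_le.
  by rewrite subr_gt0.
have qcurve : \forall h \near 0^'+, 0 <= qt h /\ qt h + nv (qz h) <= 1.
  near=> h; have h0 : 0 < h by near: h.
  have h0' : 0 <= h^-1 by rewrite invr_ge0 ltW.
  have [h1 h2] : 0 <= t (h + r) - t r /\ t (h + r) - t r + nv (z (h + r) - z r) <= h.
    have rh : r <= r + h by rewrite lerDl ltW.
    have rhS : r + h <= S by near: h.
    by have := limit_curve (ltW r0) rh rhS; rewrite (addrC r) addrK.
  split; first exact: mulr_ge0.
  by rewrite (nvZ hP) ger0_norm// -mulrDr ler_pdivrMl// mulr1.
have dt0 : 0 <= dt by apply: cvgr_to_ge ct _; apply: filterS qcurve => h [].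
have dtz : dt + nv dz <= 1.
  by apply: cvgr_to_le (cvgD ct cn) _; apply: filterS qcurve => h [].
have [G0 _ /(_ dz) Gdz _] := GdP hP hZV (z r) tr0.
have loc e : 0 < e -> Num.max 0 (Gd (t r) (z r) - e) * dt <= 0 /\
    - load_t P (t r) (z r) * dt + DE (t r) (z r) dz + Rd dz +
      Num.max 0 (Gd (t r) (z r) - e) * nv dz <= (- load_t P (t r) (z r) + e) * dt.
  move=> e0; have [h0 h00 H] := limit_local (ltW r0) rS e0.
  set g := Num.max _ _; set d := - load_t P _ _ + e.
  have Hq : \forall h \near 0^'+, g * qt h <= 0 /\
      qe h + Rd (qz h) + g * nv (qz h) <= d * qt h.
    near=> h; have hp : 0 < h by near: h.
    have hh : h <= h0 by near: h; exact: nbhs_right_le.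
    have [_ h1 h2] := H h hp hh; rewrite (addrC r) in h1 h2.
    have h0' : 0 <= h^-1 by rewrite invr_ge0 ltW.
    rewrite (RdZ hP)// (nvZ hP) (ger0_norm h0') /qt /qe !(mulrCA _ h^-1) -!mulrDr.
    split; first by rewrite pmulr_rle0 ?invr_gt0.
    by rewrite ler_wpM2l.
  have c1 : g * qt h @[h --> 0^'+] --> g * dt by apply: cvgMl_tmp.
  have c2 : d * qt h @[h --> 0^'+] --> d * dt by apply: cvgMl_tmp.
  have c3 : qe h + Rd (qz h) + g * nv (qz h) @[h --> 0^'+] -->
      - load_t P (t r) (z r) * dt + DE (t r) (z r) dz + Rd dz + g * nv dz.
    by apply: cvgD; [exact: cvgD|exact: cvgMl_tmp].
  split; first by apply: cvgr_to_le c1 _; apply: filterS Hq => h [].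
  by apply: ler_cvg_to c3 c2 _; apply: filterS Hq => h [].
split => //.
  apply/eqP; rewrite eq_le mulr_ge0// andbT leNgt; apply/negP => tG.
  have Gp : 0 < Gd (t r) (z r) by rewrite lt_neqAle G0 andbT; apply: contraTneq tG => <-; rewrite mulr0 ltxx.
  have tp : 0 < dt by rewrite lt_neqAle dt0 andbT; apply: contraTneq tG => <-; rewrite mul0r ltxx.
  have [h _] := loc (Gd (t r) (z r) / 2) (divr_gt0 Gp (ltr0n _ 2)).
  move: h; rewrite leNgt pmulr_lgt0// lt_max [X in _ < X - _](splitr (Gd (t r) (z r))) addrK.
  by rewrite divr_gt0 ?orbT.
apply/eqP; rewrite -addr_eq0 eq_le; apply/andP; split; last first.
  by rewrite -lerBlDl sub0r [nv dz * _]mulrC.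
apply/ler_addgt0Pl => e e0.
have [_ h] := loc (e / 2) (divr_gt0 e0 (ltr0n _ 2)).
have dn := nv_ge0 P dz.
have n1 : nv dz <= 1 by rewrite (le_trans _ dtz)// lerDr.
have t1 : dt <= 1 by rewrite (le_trans _ dtz)// lerDl.
have e2 : 0 <= e / 2 by rewrite divr_ge0// ltW.
have gm : Gd (t r) (z r) - e / 2 <= Num.max 0 (Gd (t r) (z r) - e / 2) by rewrite le_max lexx orbT.
have := energy_balance_arith dn n1 t1 e2 gm h.
by rewrite -splitr addr0 addrA.
Unshelve. all: by end_near. Qed.

End LimitCurve.

Lemma ae_eq_integrable_oo {R : realType} (a b : R) (f g : R -> R) :
  measurable_fun `]a, b[ g -> (@lebesgue_measure R).-integrable `]a, b[ (EFin \o f) ->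
  {ae (@lebesgue_measure R), forall x, `]a, b[%classic x -> f x = g x} ->
  (@lebesgue_measure R).-integrable `]a, b[ (EFin \o g).
Proof.
move=> mg intf fg; have [mf ltf] := integrableP _ _ _ intf.
apply/integrableP; split; first exact/measurable_EFinP.
rewrite (_ : (\int[_]_(x in _) _)%E = (\int[@lebesgue_measure R]_(x in `]a, b[) `|(EFin \o f) x|)%E)//.
apply: ae_eq_integral.
- exact: measurable_itv.
- by apply: measurableT_comp => //; exact/measurable_EFinP.
- by apply: measurableT_comp => //; exact/measurable_EFinP.
- by apply: aeS fg => x fg Dx /=; rewrite fg.
Qed.

(** * From pointwise conditions to a parametrized solution *)

Section BVLimit.
Context {R : realType} {Z W V X : completeNormedModType R}.
Variable P : ris_data Z W V X.
Hypothesis hP : assumptions P.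
Hypothesis hZV : Z_eq_V P.
Local Notation T := (Tend P).
Local Notation en := (energy P).
Local Notation nv := (nv P).
Local Notation Rd := (Rd P).
Local Notation DE := (DE P).
Local Notation Gd := (Gd P).
Local Notation mu := (@lebesgue_measure R).

Variables (M S : R) (t : R -> R) (z : R -> Z) (dt : R -> R) (dz : R -> V).
Hypothesis TS : T <= S.
Hypothesis t0 : t 0 = 0.
Hypothesis z_0 : z 0 = z0 P.
Hypothesis tS : t S = T.
Hypothesis tT : forall s, 0 <= s <= S -> 0 <= t s <= T.
Hypothesis zM : forall s, 0 <= s <= S -> `|z s| <= M.
Hypothesis lip : forall a b, 0 <= a <= S -> 0 <= b <= S ->
  `|t a - t b| <= `|a - b| /\ nv (z a - z b) <= `|a - b|.
Hypothesis der : forall r d v, 0 < r -> r < S -> is_derive r 1 t d -> is_derive r 1 z v ->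
  [/\ 0 <= d, d + nv v <= 1, d * Gd (t r) (z r) = 0
    & DE (t r) (z r) v = - (Rd v + nv v * Gd (t r) (z r))].
Hypothesis Wt : @W1infty R R^o S t dt.
Hypothesis Wz : W1infty S (iZV P \o z) dz.

Let S0 : 0 < S := lt_le_trans (T_gt0 hP) TS.

Let C := s2val (cid2 (nv_equiv hP hZV)).
Let C0 : 0 < C := s2valP (cid2 (nv_equiv hP hZV)).
Let nvC v : `|v| <= C * nv v := proj1 (s2valP' (cid2 (nv_equiv hP hZV)) v).

Let z_lip a b : 0 <= a <= S -> 0 <= b <= S -> `|z a - z b| <= C * `|a - b|.
Proof.
move=> ha hb; rewrite (le_trans (nvC _))// ler_pM2l//.
by have [_] := lip ha hb.
Qed.

Lemma in_dual_id : @in_dual R R^o id.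
Proof. by split => // x; exact: cvg_id. Qed.

Let dt_int : mu.-integrable `]0, S[ (EFin \o dt).
Proof. by have [_ h _] := Wt; have := Linfty_dual_integrable h in_dual_id. Qed.

Let ae_dt : {ae mu, forall r, `]0, S[%classic r -> is_derive r 1 t (dt r)}.
Proof.
apply: ae_is_derive_primitive dt_int _ => s hs.
by have [_ _ /(_ s hs _ in_dual_id)] := Wt.
Qed.

Let clampS s := clamp_itv s (ltW S0).

Let tc_lip a b : `|t (clamp S a) - t (clamp S b)| <= `|a - b|.
Proof.
have [h _] := lip (clampS a) (clampS b); rewrite (le_trans h)//.
exact: clamp_lipschitz _ _ (ltW S0).
Qed.

Let zc_lip a b : `|z (clamp S a) - z (clamp S b)| <= C * `|a - b|.
Proof.
rewrite (le_trans (z_lip (clampS a) (clampS b)))// ler_pM2l//.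
exact: clamp_lipschitz _ _ (ltW S0).
Qed.

Let Gd_measurable : measurable_fun `]0, S[ (fun s => Gd (t s) (z s)).
Proof.
have [L L0 LP] := Gd_lipschitz hP hZV M.
pose f s := Gd (t (clamp S s)) (z (clamp S s)).
apply: (@eq_measurable_fun _ _ _ _ _ f).
  by move=> s; rewrite inE/= in_itv/= => /andP[h1 h2]; rewrite /f clamp_id// !ltW.
apply: measurable_funTS; apply: continuous_measurable_fun.
apply: (@lipschitz_continuous _ _ (L * (1 + C))) => a b.
have [/tT/andP[h1 _] /tT/andP[h2 _]] := (clampS a, clampS b).
rewrite (le_trans (LP _ _ _ _ h1 h2 (zM (clampS a)) (zM (clampS b))))//.
by rewrite -mulrA ler_pM2l// mulrDl mul1r lerD.
Qed.

Let load_measurable : measurable_fun `]0, S[ (fun s => load_t P (t s) (z s)).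
Proof.
pose f s := load_t P (t (clamp S s)) (z (clamp S s)).
apply: (@eq_measurable_fun _ _ _ _ _ f).
  by move=> s; rewrite inE/= in_itv/= => /andP[h1 h2]; rewrite /f clamp_id// !ltW.
apply: measurable_funTS; apply: continuous_measurable_fun => x.
have cd : `|x - y| @[y --> x] --> (0 : R) by apply: (@cvg_dist0 _ R^o); exact: cvg_id.
have ct : t (clamp S y) @[y --> x] --> t (clamp S x).
  by apply: (@cvg_of_dist _ R^o _ _ _ _ _ _ cd); near=> y; exact: tc_lip.
have cz : z (clamp S y) @[y --> x] --> z (clamp S x).
  apply: (@cvg_of_dist _ _ _ _ _ _ _ (fun y => C * `|x - y|)); last by near=> y; exact: zc_lip.
  have h : C * `|x - y| @[y --> x] --> C * 0 by apply: cvgMl_tmp.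
  by move: h; rewrite mulr0.
have tcT s : setT s -> 0 <= (t \o clamp S) s <= T by move=> _; exact: tT.
have H := load_t_within hP ct cz tcT (I : setT x).
move=> A hA; have : \forall s \near within setT (nbhs x), A (f s) := H A hA.
by rewrite near_withinE; apply: filterS => s; exact.
Unshelve. all: by end_near. Qed.

Let load_bounded : exists K, forall s, 0 < s < S -> `|load_t P (t s) (z s)| <= K.
Proof.
have [m m0 mP] := f_ft_growth (as_f hP); exists (m * (M + 1)) => s /andP[h1 h2].
have hs : 0 <= s <= S by rewrite !ltW.
by rewrite (le_trans (mP _ _ (tT hs)))// ler_pM2l// lerD2r zM.
Qed.

(** The given [dt] and [dz] are linked to the curve only by integrals, and [dz] has values in V.
    Differentiating those integrals almost everywhere makes [der] applicable; the energy balance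
    then results from integrating the derivative of the Lipschitz function [Ef]. *)
Lemma BV_of_limit : BV_solution P S t z.
Proof.
split => //; exists dt, dz.
have [n [e [b [_ [_ [_ [_ be ec bc _]]]]]]] := finite_dimension hP hZV.
have [_ Lz Iz] := Wz; have [mz Bz] := Lz.
(* The inverse of the embedding of Z into V, written in coordinates so that its continuity is
   evident. *)
pose J v : Z := \sum_i VV P v (e i) *: b i.
have iJ v : iZV P (J v) = v.
  have [_ vE _] := ec; rewrite [RHS]vE /J iZV_sum; apply: eq_bigr => i _.
  by rewrite iZVZ be.
have cJ : continuous J.
  move=> v; apply: cvg_sumr => i; apply: cvgZr_tmp.
  by have [/(_ i)[_ h] _ _] := ec; exact: h.
have nvJ v : normV P v = nv (J v) by rewrite /nv iJ.
have RdJ v : dis P (iVX P v) = Rd (J v) by rewrite /Rd /iZX iJ.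
have ae_dz : {ae mu, forall r, `]0, S[%classic r -> is_derive r 1 z (J (dz r))}.
  (* Differentiation by coordinates: the exceptional set is a finite union of null sets. *)
  have H i : {ae mu, forall r, `]0, S[%classic r ->
      is_derive r 1 (fun s => VV P (iZV P (z s)) (e i)) (VV P (dz r) (e i))}.
    have [/(_ i) hi _ _] := ec.
    apply: ae_is_derive_primitive; first exact: Linfty_dual_integrable Lz hi.
    by move=> s hs; exact: Iz s hs _ hi.
  have : {ae mu, forall r, forall i, `]0, S[%classic r ->
      is_derive r 1 (fun s => VV P (iZV P (z s)) (e i)) (VV P (dz r) (e i))}.
    exact: filter_forall.
  apply: aeS => r Hr rS; apply/is_deriveE; apply: (coord_cvg bc) => i.
  have /(@is_deriveE R R^o) h := Hr i rS.
  have E : (fun h => VV P (iZV P (h^-1 *: (z (h + r) - z r))) (e i)) =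
      (fun h => h^-1 *: (VV P (iZV P (z (h + r))) (e i) - VV P (iZV P (z r)) (e i) : R^o)).
    by apply/funext => k; rewrite iZVZ (VVZl hP) iZVB (VVBl hP).
  by rewrite E iJ.
pose h1 s := - load_t P (t s) (z s) * dt s.
pose h2 s := Rd (J (dz s)) + nv (J (dz s)) * Gd (t s) (z s).
have ae_all : {ae mu, forall r, `]0, S[%classic r ->
    [/\ is_derive r 1 t (dt r), is_derive r 1 z (J (dz r)), 0 <= dt r,
        dt r + nv (J (dz r)) <= 1
      & dt r * Gd (t r) (z r) = 0 /\
        DE (t r) (z r) (J (dz r)) = - h2 r]}.
  apply: aeS (aeI ae_dt ae_dz) => r [H1 H2] rS.
  have [r0 rS'] : 0 < r /\ r < S by move: rS; rewrite /= in_itv/= => /andP.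
  have d1 := H1 rS; have d2 := H2 rS.
  by have [k1 k2 k3 k4] := der r0 rS' d1 d2; split.
have Gdist r : 0 <= r <= S -> dist_DE P (t r) (z r) = (Gd (t r) (z r))%:E.
  by move=> /tT/andP[tr _]; have [] := GdP hP hZV (z r) tr.
have [K KP] := load_bounded.
have int1 : mu.-integrable `]0, S[ (EFin \o h1).
  have h : mu.-integrable `]0, S[ (EFin \o (fun x => dt x * (- load_t P (t x) (z x)))).
    apply: (integrable_oo_mulr (M := K)) => //; last by move=> s /KP; rewrite normrN.
    exact: measurableT_comp.
  by rewrite (_ : h1 = (fun x => dt x * (- load_t P (t x) (z x))))//; apply/funext => s; rewrite /h1 mulrC.
have m2 : measurable_fun `]0, S[ h2.
  have mo : measurable `]0, S[%classic by exact: measurable_itv.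
  apply: measurable_funD.
    apply: (strongly_measurable_comp (phi := Rd \o J)) mz => //.
    by move=> v; apply: continuous_comp; [exact: cJ|exact: Rd_continuous].
  apply: measurable_funM => //.
  apply: (strongly_measurable_comp (phi := nv \o J)) mz => //.
  by move=> v; apply: continuous_comp; [exact: cJ|exact: nv_continuous].
pose Ef s := en (t s) (z s).
have [KE KE0 KEP] := energy_lipschitz hP M.
have Ef_lip x y : 0 <= x <= S -> 0 <= y <= S -> `|Ef x - Ef y| <= KE * (1 + C) * `|x - y|.
  move=> hx hy; rewrite (le_trans (KEP _ _ _ _ (tT hx) (tT hy) (zM hx) (zM hy)))//.
  rewrite -mulrA ler_pM2l// mulrDl mul1r lerD//; first by have [] := lip hx hy.
  exact: z_lip.
have KC : 0 < KE * (1 + C) by rewrite mulr_gt0// addr_gt0.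
have [g [mg gb gE]] := lipschitz_primitive S0 KC Ef_lip.
have intg : mu.-integrable `]0, S[ (EFin \o g).
  by apply: bounded_integrable_oo (fun x _ => gb x); exact: measurable_funTS.
have gh : {ae mu, forall x, `]0, S[%classic x -> h1 x - g x = h2 x}.
  apply: aeS (aeI ae_all (ae_is_derive_primitive intg gE)) => r [H1 H2] rS.
  have [k1 k2 _ _ [_ k3]] := H1 rS; have {}H2 := H2 rS.
  have [r0 rS'] : 0 < r /\ r < S by move: rS; rewrite /= in_itv/= => /andP.
  have ed : is_derive r 1 Ef (h1 r + DE (t r) (z r) (J (dz r))).
    apply: energy_curve_derive => //; near=> s; apply: tT.
    apply/andP; split; apply: ltW; first by near: s; exact: lt_nbhsr.
    by near: s; exact: lt_nbhsl.
  have -> : g r = h1 r - h2 r.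
    by rewrite -k3 -(@derive_val _ _ _ _ _ _ _ ed) (@derive_val _ _ _ _ _ _ _ H2).
  by rewrite opprB addrC subrK.
(* Integrability of the dissipation density comes from its almost everywhere identity with
   [h1 - g]. *)
have int2 : mu.-integrable `]0, S[ (EFin \o h2).
  by apply: ae_eq_integrable_oo m2 _ gh; exact: integrable_ooB.
split.
- split=> //.
  have [cC cC0 cCP] := coord_unif_bounded bc.
  exact: (Linfty_lipschitz bc cCP cC0 S0 C0 z_lip).
- by [].
- apply: aeS ae_all => r H rS; have [_ _ k1 k2 [k3 _]] := H rS.
  have hr : 0 <= r <= S by move: rS; rewrite /= in_itv/= => /andP[? ?]; rewrite !ltW.
  by split; rewrite ?nvJ// Gdist// -EFinM k3.
- move=> s hs; have /andP[s0 sS] := hs.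
  have int1s := integrable_oo_sub (lexx 0) sS int1.
  have int2s := integrable_oo_sub (lexx 0) sS int2.
  have -> : (\int[mu]_(r in `]0%R, s[) ((dis P (iVX P (dz r)))%:E +
      (normV P (dz r))%:E * dist_DE P (t r) (z r)))%E = (Rintegral mu `]0, s[ h2)%:E.
    rewrite /Rintegral fineK; last exact: integrable_fin_num.
    apply: eq_integral => r; rewrite inE/= in_itv/= => /andP[r0 rs].
    by rewrite Gdist ?(ltW r0) ?(le_trans (ltW rs))// RdJ nvJ -EFinM -EFinD.
  have -> : (\int[mu]_(r in `]0%R, s[) (DtE P (t r) (z r) * dt r)%:E)%E =
      (Rintegral mu `]0, s[ h1)%:E.
    by rewrite /Rintegral fineK; last exact: integrable_fin_num.
  rewrite -!EFinD; congr EFin.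
  have ge := gE s hs; rewrite /Ef t0 z_0 in ge; rewrite ge -addrA; congr (_ + _).
  have -> : Rintegral mu `]0, s[ g = Rintegral mu `]0, s[ (fun x => h1 x - h2 x).
    apply: ae_eq_Rintegral; first exact: measurable_itv.
      by have /integrableP[/measurable_EFinP] := integrable_oo_sub (lexx 0) sS intg.
      by have /integrableP[/measurable_EFinP] := integrable_ooB int1s int2s.
    apply: aeS gh => r H; rewrite /= in_itv/= => /andP[r0 rs].
    by rewrite -H ?opprB ?[h1 r + _]addrC ?subrK//= in_itv/= r0 (lt_le_trans rs).
  have := @RintegralB _ _ _ mu `]0, s[%classic h1 h2.
  by move=> /(_ (measurable_itv _) int1s int2s) ->; rewrite subrK.
Unshelve. all: by end_near. Qed.

End BVLimit.

Lemma ultra_compact_cvg (T : Type) (Y : topologicalType) (U : set_system T) (f : T -> Y)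
    (A : set Y) : UltraFilter U -> compact A -> (forall x, A (f x)) ->
  exists p : Y, f x @[x --> U] --> p.
Proof.
move=> UU cA fA.
have PU : ProperFilter U by exact: ultra_proper.
have UA : U (f @^-1` A) by apply: filterE => x; exact: fA.
have [p [_ clp]] := cA (fmap f U) _ UA.
exists p => N pN; have [//|UN] := in_ultra_setVsetC (f @^-1` N) UU.
have [y [/= yN Ny]] := clp (~` N) N UN pN.
by [].
Qed.

Lemma subsequence_choice (Q : nat -> nat -> Prop) :
  (forall k m, exists2 n, (m < n)%N & Q k n) ->
  exists2 sub : nat -> nat, increasing_seq sub & forall k, Q k (sub k).
Proof.
move=> H; pose f k m := s2val (cid2 (H k m)).
have f1 k m : (m < f k m)%N by exact: (s2valP (cid2 (H k m))).
have f2 k m : Q k (f k m) by exact: (s2valP' (cid2 (H k m))).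
pose sub := fix sub k := if k is k'.+1 then f k (sub k') else f 0%N 0%N.
exists sub; last by case=> [|k]; exact: f2.
by apply/increasing_seqP => n; rewrite ltEnat; exact: f1.
Qed.

Lemma cvg_increasing_seq (sub : nat -> nat) : increasing_seq sub ->
  sub @ \oo --> \oo.
Proof.
move=> si; have h k : (k <= sub k)%N.
  elim: k => [//|k IH]; apply: (leq_ltn_trans IH).
  by move/increasing_seqP : si => /(_ k).
apply/cvgnyPge => A; near=> k; apply: leq_trans (h k).
by near: k; exact: nbhs_infty_ge.
Unshelve. all: by end_near. Qed.

Lemma ler_normD3 {R : numDomainType} {Y : normedZmodType R} (x y w : Y) :
  `|x + y + w| <= `|x| + `|y| + `|w|.
Proof. by rewrite (le_trans (ler_normD _ _))// lerD2r ler_normD. Qed.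

(** * Extraction of a convergent subsequence *)

Section Compactness.
Context {R : realType} {Z W V X : completeNormedModType R}.
Variable P : ris_data Z W V X.
Hypothesis hP : assumptions P.
Hypothesis hZV : Z_eq_V P.
Local Notation T := (Tend P).
Local Notation nv := (nv P).

Variables (M B : R) (eps Sn : nat -> R) (tn : nat -> R -> R) (zn : nat -> R -> Z).
Hypothesis hap : forall n, approx_curve P M (eps n) (Sn n) (tn n) (zn n).
Hypothesis hT : forall n, T <= Sn n <= B.

(* Limits along one ultrafilter give a limit curve at all parameters at once; by
   equicontinuity the subsequence only has to be close to it on finer and finer grids. *)
Lemma approx_subsequence : exists (sub : nat -> nat) (S : R) (t : R -> R) (z : R -> Z),
  [/\ increasing_seq sub, Sn (sub k) @[k --> \oo] --> S,
      forall s, 0 <= s -> tn (sub k) s @[k --> \oo] --> t s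
    & forall s, 0 <= s -> zn (sub k) s @[k --> \oo] --> z s].
Proof.
have [U [UU FU]] := @ultraFilterLemma nat \oo _.
have PU : ProperFilter U by exact: ultra_proper.
have [C C0 CP] := nv_equiv hP hZV.
have [S cS] : exists S : R, Sn n @[n --> U] --> S.
  apply: (@ultra_compact_cvg _ _ _ _ `[T, B] UU (@segment_compact _ _ _)) => n.
  by rewrite /= in_itv/=; exact: hT.
(* Negative parameters are sent to 0, so that a limit exists for every real s and can be chosen as a
   function on the line. *)
have Ht s : exists p : R, tn n (Num.max 0 s) @[n --> U] --> p.
  apply: (@ultra_compact_cvg _ _ _ _ `[- Num.max 0 s, Num.max 0 s] UU (@segment_compact _ _ _)) => n.
  rewrite /= in_itv/= -ler_norml; have [[t0 _ _] _ _ _] := hap n.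
  have h0 : 0 <= Num.max 0 s by rewrite le_max lexx.
  have [+ _] := approx_lip hP hap n h0 (lexx 0).
  by rewrite t0 !subr0 (ger0_norm h0).
have Hz s : exists p : Z, zn n (Num.max 0 s) @[n --> U] --> p.
  apply: (@ultra_compact_cvg _ Z U (fun n => zn n (Num.max 0 s)) _ UU (@compact_nv_ball _ _ _ _ _ _ hP hZV (C * M))) => n.
  have [_ h _ _] := hap n; rewrite /= (le_trans (CP _).2)// ler_pM2l// h//.
  by rewrite le_max lexx.
have [t Pt] := choice Ht; have [z Pz] := choice Hz.
have tP s : 0 <= s -> tn n s @[n --> U] --> t s.
  by move=> s0; have := Pt s; rewrite (max_r s0).
have zP s : 0 <= s -> zn n s @[n --> U] --> z s.
  by move=> s0; have := Pz s; rewrite (max_r s0).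
have t_lip a b : 0 <= a -> 0 <= b -> `|t a - t b| <= `|a - b|.
  move=> a0 b0; have c : tn n a - tn n b @[n --> U] --> t a - t b.
    by apply: cvgB; exact: tP.
  apply: cvgr_to_le (cvg_norm c) _; near=> n.
  by have [] := approx_lip hP hap n a0 b0.
have zn_lip n a b : 0 <= a -> 0 <= b -> `|zn n a - zn n b| <= C * `|a - b|.
  move=> a0 b0; rewrite (le_trans (CP _).1)// ler_pM2l//.
  by have [] := approx_lip hP hap n a0 b0.
have z_lip a b : 0 <= a -> 0 <= b -> `|z a - z b| <= C * `|a - b|.
  move=> a0 b0; have c : zn n a - zn n b @[n --> U] --> z a - z b.
    by apply: cvgB; exact: zP.
  apply: cvgr_to_le (cvg_norm c) _; near=> n.
  exact: zn_lip.
(* The mesh 1 / (k + 1) with (k + 1)^2 cells covers [0, k + 1], so the grids become finer and also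
   exhaust the half-line. *)
pose grid k (i : 'I_((k.+1 ^ 2).+1)) : R := i%:R / k.+1%:R.
have grid0 k i : 0 <= grid k i by rewrite divr_ge0.
pose Q k n := `|S - Sn n| < k.+1%:R^-1 /\ forall i,
  `|t (grid k i) - tn n (grid k i)| < k.+1%:R^-1 /\
  `|z (grid k i) - zn n (grid k i)| < k.+1%:R^-1.
have [|sub si Qsub] := @subsequence_choice Q.
  move=> k m; have k0 : 0 < k.+1%:R^-1 :> R by rewrite invr_gt0.
  have : \forall n \near U, (m < n)%N /\ Q k n.
    have U1 : \forall n \near U, (m < n)%N by apply: FU; exact: nbhs_infty_gt.
    have U2 : \forall n \near U, `|S - Sn n| < k.+1%:R^-1.
      by apply: (@cvgr_dist_lt _ R^o) k0; exact: cS.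
    have U3 : \forall n \near U, forall i,
        `|t (grid k i) - tn n (grid k i)| < k.+1%:R^-1 /\
        `|z (grid k i) - zn n (grid k i)| < k.+1%:R^-1.
      apply: filter_forall => i.
      have h1 : \forall n \near U, `|t (grid k i) - tn n (grid k i)| < k.+1%:R^-1.
        by apply: (@cvgr_dist_lt _ R^o) k0; exact: tP.
      have h2 : \forall n \near U, `|z (grid k i) - zn n (grid k i)| < k.+1%:R^-1.
        by apply: cvgr_dist_lt k0; exact: zP.
      by apply: filterS2 h1 h2.
    by apply: filterS3 U1 U2 U3 => n h1 h2 h3; split.
  by move=> /filter_ex[n [h1 h2]]; exists n.
exists sub, S, t, z.
have harm K : K * harmonic k @[k --> \oo] --> (0 : R).
  have h : K * harmonic k @[k --> \oo] --> K * (0 : R).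
    by apply: cvgMl_tmp; exact: cvg_harmonic.
  by move: h; rewrite mulr0.
have near_grid s : 0 <= s -> \forall k \near \oo, exists i : 'I_((k.+1 ^ 2).+1),
    `|s - grid k i| <= k.+1%:R^-1.
  move=> s0; near=> k.
  have sk : s <= k%:R by near: k; exact: nbhs_infty_ger.
  have k0 : 0 < k.+1%:R :> R by rewrite ltr0n.
  have sk0 : 0 <= s * k.+1%:R by rewrite mulr_ge0.
  have ik : (Num.truncn (s * k.+1%:R) < (k.+1 ^ 2).+1)%N.
    rewrite ltnS -(ler_nat R) (le_trans (proj1 (andP (truncn_itv sk0))))//.
    rewrite -mulnn natrM ler_wpM2r// (le_trans sk)// ler_nat.
    by [].
  exists (Ordinal ik); rewrite /grid /= -[X in _ - X]subr0.
  have /andP[h1 h2] := truncn_itv sk0.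
  by apply: quantization_error; rewrite ?addr0 ?natr1.
split => //.
- apply: (@cvg_of_dist _ R^o _ _ _ _ _ (fun k => 1 * harmonic k)); first exact: harm.
  by near=> k; have [/ltW h _] := Qsub k; rewrite mul1r.
- move=> s s0; apply: (@cvg_of_dist _ R^o _ _ _ _ _ (fun k => 3 * harmonic k)); first exact: harm.
  apply: filterS (near_grid s s0) => k [i hi].
  have [_ /(_ i)[h _]] := Qsub k.
  have h1 := le_trans (t_lip _ _ s0 (grid0 k i)) hi.
  have [h2 _] := approx_lip hP hap (sub k) (grid0 k i) s0.
  rewrite (distrC (grid k i)) in h2; have {}h2 := le_trans h2 hi.
  have -> : t s - tn (sub k) s = (t s - t (grid k i)) +
      (t (grid k i) - tn (sub k) (grid k i)) + (tn (sub k) (grid k i) - tn (sub k) s).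
    by rewrite !addrA !subrK.
  rewrite (le_trans (ler_normD3 _ _ _))//.
  by rewrite -[3]/(1 + 1 + 1)%:R natrD natrD !mulrDl !mul1r !lerD// ltW.
- move=> s s0; apply: (@cvg_of_dist _ _ _ _ _ _ _ (fun k => (C + 1 + C) * harmonic k)).
    exact: harm.
  apply: filterS (near_grid s s0) => k [i hi].
  have [_ /(_ i)[_ h]] := Qsub k.
  have h1 := z_lip _ _ s0 (grid0 k i).
  have h2 := zn_lip (sub k) _ _ (grid0 k i) s0; rewrite (distrC (grid k i)) in h2.
  have hC : C * `|s - grid k i| <= C * harmonic k by rewrite ler_pM2l.
  have -> : z s - zn (sub k) s = (z s - z (grid k i)) +
      (z (grid k i) - zn (sub k) (grid k i)) + (zn (sub k) (grid k i) - zn (sub k) s).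
    by rewrite !addrA !subrK.
  rewrite (le_trans (ler_normD3 _ _ _))// !mulrDl mul1r !lerD//.
  + exact: le_trans h1 hC.
  + exact: ltW.
  + exact: le_trans h2 hC.
Unshelve. all: by end_near. Qed.

End Compactness.

Lemma real_fin_coord {R : realType} : @fin_coord R R^o 1 (fun=> 1) (fun _ v => v).
Proof.
split; first by move=> i; exact: in_dual_id.
- by move=> v; rewrite big_ord1 [v *: 1]mulr1.
- by move=> i x; rewrite big_ord1 (ord1 i) [LHS]mulr1.
Qed.

Section WeakStarCurves.
Context {R : realType} {Z W V X : completeNormedModType R}.
Variable P : ris_data Z W V X.
Hypothesis hP : assumptions P.
Hypothesis hZV : Z_eq_V P.
Local Notation T := (Tend P).

Variables (M S : R) (eps Sn : nat -> R) (tn : nat -> R -> R) (zn : nat -> R -> Z).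
Variables (t : R -> R) (z : R -> Z).
Hypothesis hap : forall n, approx_curve P M (eps n) (Sn n) (tn n) (zn n).
Hypothesis S_gt0 : 0 < S.

(** Weak star convergence concerns the images in V; since the coordinates along [b] in Z are those
    of the image along [e], convergence holds in Z as well. *)
Lemma pointwise_of_weakstar :
  @weakstar_W1infty R R^o S tn t -> weakstar_W1infty S (fun n => iZV P \o zn n) (iZV P \o z) ->
  forall s, 0 <= s <= S -> tn n s @[n --> \oo] --> t s /\ zn n s @[n --> \oo] --> z s.
Proof.
move=> wt wz s hs; split.
  apply: (@weakstar_W1infty_pointwise R R^o S S tn t 0 id S_gt0 in_dual_id) hs => //.
    by move=> n; have [[]] := hap n.
  move=> n x /andP[/ltW x0 /ltW xS]; have [h _] := approx_lip hP hap n x0 (lexx 0).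
  have [[t0 _ _] _ _ _] := hap n; rewrite t0 !subr0 (ger0_norm x0) in h.
  exact: le_trans h xS.
have [n [e [b [_ [_ [_ [_ be ec bc _]]]]]]] := finite_dimension hP hZV.
have [C C0 CP] := iZV_upper hP.
apply: (coord_cvg bc) => i; have [/(_ i) hi _ _] := ec.
apply: (@weakstar_W1infty_pointwise R V S (C * M) (fun n => iZV P \o zn n) (iZV P \o z)
  (iZV P (z0 P)) (fun v => VV P v (e i)) S_gt0 hi _ _ wz s hs).
  by move=> m /=; have [[_ -> _]] := hap m.
move=> m x /andP[/ltW x0 _]; rewrite /= (le_trans (CP _))// ler_pM2l//.
by have [_ h _ _] := hap m; exact: h.
Qed.

Lemma weakstar_of_pointwise_curves :
  (forall s, 0 <= s -> tn n s @[n --> \oo] --> t s) ->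
  (forall s, 0 <= s -> zn n s @[n --> \oo] --> z s) ->
  @weakstar_W1infty R R^o S tn t /\ weakstar_W1infty S (fun n => iZV P \o zn n) (iZV P \o z).
Proof.
move=> ct cz; split.
  apply: (@weakstar_W1infty_lipschitz R R^o _ _ _ real_fin_coord 1 _ ltr01 S 1 tn t 0) => //.
  - by move=> i v; rewrite mul1r.
  - by move=> n; have [[]] := hap n.
  - move=> n x y /andP[x0 _] /andP[y0 _]; rewrite mul1r.
    by have [] := approx_lip hP hap n x0 y0.
  - by move=> s /andP[s0 _]; exact: ct.
have [n [e [b [_ [_ [_ [_ be ec bc _]]]]]]] := finite_dimension hP hZV.
have [C C0 CP] := coord_unif_bounded ec.
have [C1 C10 C1P] := iZV_upper hP; have [C2 C20 C2P] := nv_equiv hP hZV.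
apply: (@weakstar_W1infty_lipschitz R V _ _ _ ec C CP C0 S (C1 * C2) _ _ (iZV P (z0 P))) => //.
- exact: mulr_gt0.
- by move=> m /=; have [[_ -> _]] := hap m.
- move=> m x y /andP[x0 _] /andP[y0 _]; rewrite /= -iZVB (le_trans (C1P _))//.
  rewrite -mulrA ler_pM2l// (le_trans (C2P _).1)// ler_pM2l//.
  by have [] := approx_lip hP hap m x0 y0.
- move=> s /andP[s0 _].
  exact: (cvg_comp _ _ (cz s s0) (@iZV_continuous _ _ _ _ _ _ hP _)).
Qed.

End WeakStarCurves.

Theorem theorem5p4 (R : realType) (Z W V X : completeNormedModType R)
    (P : ris_data Z W V X) (hP : assumptions P)
    (hZV : Z_eq_V P)
    (cbar : R) (hcbar : is_cbar P cbar)
    (tol : nat -> R) (tol_gt0 : forall n, 0 < tol n)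
    (tol_cvg : tol n @[n --> \oo] --> (0 : R))
    (tau1 : nat -> R) (htau1 : forall n, tol n / (2 * cbar) <= tau1 n)
    (tau : nat -> nat -> R) (z : nat -> nat -> Z) (N : nat -> nat)
    (hrun : forall n, adaptive_run P (tol n) (tau1 n) (tau n) (z n) (N n))
    (S : nat -> R)
    (hS : forall n, max_param P (that P (tau n) (z n) (N n)) (S n)) :
  let cvg_along (sub : nat -> nat) :=
    param_cvg P (S \o sub) (fun j => that P (tau (sub j)) (z (sub j)) (N (sub j)))
      (fun j => zhat P (tau (sub j)) (z (sub j)) (N (sub j))) in
  (exists (sub : nat -> nat) (Soo : R) (too : R -> R) (zoo : R -> Z),
     increasing_seq sub /\ cvg_along sub Soo too zoo) /\
  (forall (sub : nat -> nat) (Soo : R) (too : R -> R) (zoo : R -> Z),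
     increasing_seq sub -> cvg_along sub Soo too zoo ->
     BV_solution P Soo too zoo).
Proof.
move=> cvg_along.
have [M [B [K [M0 B0 K0 H]]]] := adaptive_run_approx hP hZV.
pose eps n := tol n + tol n + Num.sqrt (K * tol n) * B.
pose t_ n := that P (tau n) (z n) (N n); pose z_ n := zhat P (tau n) (z n) (N n).
have hap n : approx_curve P M (eps n) (S n) (t_ n) (z_ n).
  by have [_ [_ h]] := H _ _ _ _ _ _ (tol_gt0 n) (hrun n) (hS n).
have hT n : Tend P <= S n <= B.
  by have [-> [-> _]] := H _ _ _ _ _ _ (tol_gt0 n) (hrun n) (hS n).
have hT1 n : Tend P <= S n by have /andP[] := hT n.
have ceps : eps n @[n --> \oo] --> (0 : R).
  have c1 : K * tol n @[n --> \oo] --> K * 0 by apply: cvgMl_tmp.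
  have c2 : Num.sqrt (K * tol n) @[n --> \oo] --> Num.sqrt (K * 0).
    exact: (cvg_comp _ _ c1 (@sqrt_continuous R _)).
  have c3 : eps n @[n --> \oo] --> 0 + 0 + Num.sqrt (K * 0) * B.
    by apply: cvgD; [exact: cvgD|exact: cvgMr_tmp].
  by move: c3; rewrite mulr0 sqrtr0 mul0r !addr0.
split.
  have [sub [Soo [too [zoo [si cS ct cz]]]]] := approx_subsequence hP hZV hap hT.
  exists sub, Soo, too, zoo; split => //.
  have hap' j := hap (sub j).
  have T_le := limit_T_le (fun j => hT1 (sub j)) cS.
  have Soo0 := lt_le_trans (T_gt0 hP) T_le.
  have [wt wz] := weakstar_of_pointwise_curves hP hZV hap' Soo0 ct cz.
  by split.
move=> sub Soo too zoo si [cS wt wz].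
have hap' j := hap (sub j).
have hT' j := hT1 (sub j).
have T_le := limit_T_le hT' cS.
have Soo0 := lt_le_trans (T_gt0 hP) T_le.
have ceps' : eps (sub j) @[j --> \oo] --> (0 : R) := cvg_comp _ _ (cvg_increasing_seq si) ceps.
have pw := pointwise_of_weakstar hP hZV hap' Soo0 wt wz.
have pt s hs := proj1 (pw s hs); have pz s hs := proj2 (pw s hs).
(* The derivatives of the solution are the ones supplied by the convergence of the subsequence. *)
have [dt_ [dt [_ Wt _ _]]] := wt; have [dz_ [dz [_ Wz _ _]]] := wz.
apply: (@BV_of_limit _ _ _ _ _ P hP hZV M Soo too zoo dt dz T_le) => //.
- exact: (limit_t0 hP hap' hT' cS pt).
- exact: (limit_z0 hP hap' hT' cS pz).
- exact: (limit_tS hP hap' hT' cS pt).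
- by move=> s; exact: (limit_t_itv hP hZV hap' hT' cS pt pz).
- by move=> s; exact: (limit_zM hap' pz).
- by move=> a b; exact: (limit_lip hP hZV hap' pt pz).
- by move=> r d v; exact: (limit_derivative hP hZV hap' hT' ceps' cS pt pz).
Qed.
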